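(* Let $u_B\in\mathcal U$ be given and assume that, for all $u$ in a small neighborhood of $u_B$, the basis $r_j(u)$ ($1\le j\le N$) of right eigenvectors of $\nabla f(u)$ is a family of eigenvectors for the viscosity matrix $B(u)$, the eigenvalues $b_j(u)$ of $B(u)$ are positive, and $$\lambda_p(u)<0\le\lambda_{p+1}(u)$$ holds for some $p$. Then the set $\mathcal E^{\text{layer}}_{\text{viscosity}}(u_B)$ contains the point $u_B$ and, locally nearby $u_B$, contains a manifold with dimension $p$ at least. When $0<\lambda_{p+1}(u_B)$, $\mathcal E^{\text{layer}}_{\text{viscosity}}(u_B)$ is (locally nearby $u_B$) a manifold with dimension exactly $p$ and its tangent space at the point $u_B$ is spanned by the eigenvectors $r_j(u_B)$, $j=1,2,\dots,p$.
   Context: $\mathcal U\subset\mathbb{R}^N$ is convex and open and $f:\mathcal U\to\mathbb{R}^N$ is smooth. The system $\partial_tu+\partial_xf(u)=0$ is strictly hyperbolic: $\nabla f(u)$ has $N$ real and distinct eigenvalues $\lambda_1(u)<\dots<\lambda_N(u)$ with corresponding bases of left and right eigenvectors $\ell_j(u)$, $r_j(u)$. The matrix $B(u)$ ($N\times N$) depends smoothly on $u\in\mathcal U$ and is positive; it is the viscosity matrix in $\partial_tu^\epsilon+\partial_xf(u^\epsilon)=\epsilon\,\partial_x(B(u^\epsilon)\partial_xu^\epsilon)$. The set $\mathcal E^{\text{layer}}_{\text{viscosity}}(u_B)$ is the set of all $v_\infty\in\mathcal U$ such that the problem $$B(v)\,\partial_yv=f(v)-f(v_\infty),\qquad v(0)=u_B,\qquad\lim_{y\to\infty}v(y)=v_\infty$$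 admits a (smooth) solution $v(y)\in\mathcal U$ for $y\ge0$.
   Formalization: In the case 0<λ_{p+1}(u_B), ''E is locally nearby u_B a manifold'' is proved for layers whose profiles v(y) stay in a small neighborhood of u_B; with profiles free in U the claim fails, since a large homoclinic excursion can add further end states near u_B. *)

(* Defs.v *)
From HB Require Import structures.
From mathcomp Require Import all_boot all_order all_algebra.
From mathcomp Require Import all_classical all_reals all_analysis.

Set Implicit Arguments.
Unset Strict Implicit.
Unset Printing Implicit Defensive.

Import Order.TTheory GRing.Theory Num.Theory.
Import numFieldNormedType.Exports.

Local Open Scope classical_set_scope.
Local Open Scope ring_scope.

(* [U] is meant to be open. *)
Fixpoint Ck_on (R : realType) (V W : normedModType R) (k : nat)
    (U : set V) (f : V -> W) : Prop :=
  match k with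
  | 0 => forall x, U x -> {for x, continuous f}
  | k'.+1 => (forall x, U x -> differentiable f x) /\
             (forall w : V, Ck_on k' U (fun x => 'D_w f x))
  end.

Definition smooth_on (R : realType) (V W : normedModType R)
    (U : set V) (f : V -> W) : Prop :=
  forall k, Ck_on k U f.

(* Smoothness up to the boundary of [0, +oo): all derivatives exist on
   (0, +oo) and have a limit at 0+. *)
Definition smooth_halfline (R : realType) (V : normedModType R)
    (v : R -> V) : Prop :=
  {within [set y : R | 0 <= y], continuous v} /\
  forall k, (forall y : R, 0 < y -> derivable (derive1n k v) y 1) /\
            cvg (derive1n k v y @[y --> (0 : R)^'+]).

(* States are column vectors; the library's [jacobian] is the transposed
   matrix, acting on row vectors. *)
Definition grad (R : realType) (N : nat) (f : 'cV[R]_N -> 'cV[R]_N)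
    (u : 'cV[R]_N) : 'M[R]_N :=
  \matrix_(i, j) ('d f u (delta_mx j 0 : 'cV[R]_N)) i 0.

Definition strictly_hyperbolic (R : realType) (N : nat) (U : set 'cV[R]_N)
    (f : 'cV[R]_N -> 'cV[R]_N) (lam : 'I_N -> 'cV[R]_N -> R)
    (l : 'I_N -> 'cV[R]_N -> 'rV[R]_N)
    (r : 'I_N -> 'cV[R]_N -> 'cV[R]_N) : Prop :=
  forall u, U u ->
    [/\ forall i j : 'I_N, (i < j)%N -> lam i u < lam j u,
        forall j, l j u *m grad f u = lam j u *: l j u,
        forall j, grad f u *m r j u = lam j u *: r j u,
        (\matrix_(i, j) l i u 0 j) \in unitmx &
        (\matrix_(i, j) r j u i 0) \in unitmx].

Definition positive_mx (R : realType) (N : nat) (A : 'M[R]_N) : Prop :=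
  forall x : 'cV[R]_N, x != 0 -> 0 < (x^T *m A *m x) 0 0.

(* The equation is imposed for y > 0; it extends to y = 0, with the one-sided
   derivative, by [smooth_halfline]. *)
Definition layer_profile (R : realType) (N : nat) (U : set 'cV[R]_N)
    (f : 'cV[R]_N -> 'cV[R]_N) (B : 'cV[R]_N -> 'M[R]_N)
    (uB vinf : 'cV[R]_N) (v : R -> 'cV[R]_N) : Prop :=
  [/\ smooth_halfline v,
      forall y, 0 <= y -> U (v y),
      forall y, 0 < y -> B (v y) *m derive1 v y = f (v y) - f vinf,
      v 0 = uB &
      v y @[y --> +oo] --> vinf].

(* The domain [U] of the system is an argument, so that [layer_set V f B uB]
   for a neighborhood [V] of [uB] is the set associated with the system
   restricted to the domain [V]. *)
Definition layer_set (R : realType) (N : nat) (U : set 'cV[R]_N)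
    (f : 'cV[R]_N -> 'cV[R]_N) (B : 'cV[R]_N -> 'M[R]_N)
    (uB : 'cV[R]_N) : set 'cV[R]_N :=
  [set vinf | U vinf /\ exists v, layer_profile U f B uB vinf v].

(* Embedded smooth submanifold of R^N (regular surface of dimension q):
   locally the homeomorphic image of a smooth immersion [phi] of an open
   subset of R^q, [psi] being the continuous inverse of [phi]. *)
Definition submanifold (R : realType) (N q : nat) (M : set 'cV[R]_N) : Prop :=
  forall x, M x -> exists (W : set 'cV[R]_N) (O : set 'cV[R]_q)
      (phi : 'cV[R]_q -> 'cV[R]_N) (psi : 'cV[R]_N -> 'cV[R]_q),
    [/\ open W, W x & open O] /\
    [/\ smooth_on O phi,
        forall s, O s -> injective ('d phi s),
        phi @` O = M `&` W,
        forall s, O s -> psi (phi s) = s &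
        {within M `&` W, continuous psi}].

Definition tangent_space (R : realType) (N : nat) (M : set 'cV[R]_N)
    (x : 'cV[R]_N) : set 'cV[R]_N :=
  [set w | exists (e : R) (c : R -> 'cV[R]_N),
     0 < e /\
     [/\ smooth_on [set t : R | `|t| < e] c,
         forall t, `|t| < e -> M (c t),
         c 0 = x &
         derive1 c 0 = w]].

(* Main.v *)
Require Import Defs.
From HB Require Import structures.
From mathcomp Require Import all_boot all_order all_algebra.
From mathcomp Require Import all_classical all_reals all_analysis.
From mathcomp Require Import lra ring.

(** Why the theorem holds.

    Let Q be the matrix whose columns are the vectors [r j uB], and write a
    layer as [v = vinf + Q w], so that [w] tends to 0.  The condition
    [v 0 = uB] says [vinf = uB - Q (w 0)]: the unknown end state is a function
    of [w 0].  Eliminating it leaves one equation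
    [w' = Lam w + h (w 0, w)] for a decaying [w], where [Lam] is diagonal with
    entries [mu j = lam j uB / b j uB] because the [r j uB] are
    eigenvectors of both matrices, [h] is smooth, [h (a, 0) = 0], and the differential of [h]
    vanishes at the origin ([nonlin0], [nonlin_diff0]).

    This equation is solved as in the Lyapunov-Perron construction of stable
    manifolds.  Choose [eta > 0] so small that [mu j + eta < 0] for [j < p],
    while [mu j + eta > 0] for the other indices, and put
    [w y = exp (- eta y) x y].  Decay of [w] follows from boundedness of [x],
    and [x] solves a fixed point equation [x = K (s, Psi x)] in the space of
    bounded continuous functions: [K] solves the linear system with bounded
    right-hand side and prescribed components [s] of [x 0] along the [p]
    contracted directions, and [Psi] is the superposition operator of [h].
    Since the differential of [Psi] at 0 is 0, the equation is a contraction
    near 0 and has one small solution [x s] for every small [s].  The weight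
    is what makes a vanishing [mu p] harmless.  The end states
    [uB - Q (x s 0)] form the manifold; it is a graph over the span of the
    first [p] eigenvectors ([strong_stable_family], [layer_submanifold]), and
    because [x s = K (s, 0) + o(s)] that span is its tangent space
    ([layer_tangent_space]).

    The substantial point is that [s |-> x s 0] has derivatives of all orders
    on one fixed ball.  Smoothness is handled through tangent maps
    [Tf (z, u) = 'd f z u]: a map is smooth when [f], [Tf], [TTf], and so on
    are differentiable.  If [x] solves [Phi (s, x s) = 0] with an invertible
    partial differential, then the pair [(x, Tx)] solves an equation of the
    same kind for [(Phi, T Phi)] on the same set of parameters, so once such
    solutions are known to be differentiable they are smooth
    ([implicit_tsm]).  Superposition operators are treated in the same
    way: the tangent map of one is another one ([superpos_tangent],
    [superpos_tsm]).

    When [0 < mu p], no [mu j] vanishes, and uniqueness holds without the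
    weight: two bounded small solutions with the same contracted
    components at 0 differ by a bounded solution of a linear equation whose
    right-hand side is small relative to the difference
    ([bounded_solution_unique]).  Hence every layer that stays close to
    [uB] has its end state on the manifold ([layer_local_uniqueness]). *)

Set Implicit Arguments.
Unset Strict Implicit.
Unset Printing Implicit Defensive.

Import Order.TTheory GRing.Theory Num.Theory.
Import numFieldNormedType.Exports.

Local Open Scope classical_set_scope.
Local Open Scope ring_scope.

(** * Bounded linear maps and differentials *)

Section Differentials.
Context {R : realType}.
Implicit Types V W X : normedModType R.

(** A predicate on functions, rather than the bundled structure of linear
    maps, so that explicit functions can be used as differentials. *)
Definition blin V W (f : V -> W) :=
  linear f /\ exists M : R, forall x, `|f x| <= M * `|x|.

Lemma diff_eps V W (f : V -> W) x : differentiable f x ->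
  forall e : R, 0 < e -> exists2 d : R, 0 < d &
    forall h, `|h| < d -> `|f (x + h) - f x - 'd f x h| <= e * `|h|.
Proof.
move=> /diff_locally dfx e e0.
have := dfx => /eqaddoP /(_ e e0) /nbhs_ballP [d /= d0 dP].
exists d => // h hd; have := dP h; rewrite -ball_normE /= sub0r normrN => /(_ hd).
by rewrite !fctE /= [h + x]addrC opprD addrA.
Qed.

Lemma blin_continuous V W (f : V -> W) : blin f -> continuous f.
Proof.
case=> flin [M fM].
pose fM' := GRing.isLinear.Build _ _ _ _ _ flin.
pose fL : {linear V -> W} := HB.pack f fM'.
rewrite -[f]/(fL : V -> W); apply: bounded_linear_continuous.
apply/linear_boundedP; near=> r => x /=.
by rewrite (le_trans (fM x)) // ler_wpM2r.
Unshelve. all: by end_near. Qed.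

(** The differential is unique, so an estimate of the remainder for one
    bounded linear map both proves differentiability and identifies ['d f x]. *)
Lemma eps_diff V W (f L : V -> W) x : blin L ->
  (forall e : R, 0 < e -> exists2 d : R, 0 < d &
    forall h, `|h| < d -> `|f (x + h) - f x - L h| <= e * `|h|) ->
  is_diff x f L.
Proof.
move=> Lb fL; have Lc := blin_continuous Lb.
case: Lb => Llin _.
pose LM := GRing.isLinear.Build _ _ _ _ _ Llin.
pose LL : {linear V -> W} := HB.pack L LM.
have H : f \o shift x = cst (f x) + LL +o_ 0 id.
  apply/eqaddoP => e e0; have [d d0 dP] := fL e e0.
  apply/nbhs_ballP; exists d => // h; rewrite -ball_normE /= sub0r normrN => /dP.
  by rewrite !fctE /= [h + x]addrC opprD addrA.
have E : 'd f x = LL :> (V -> W) by apply: diff_unique.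
by apply: DiffDef => //; apply/diff_locallyP; rewrite E.
Qed.

Lemma diff_blin V W (f : V -> W) x : differentiable f x -> blin ('d f x).
Proof.
move=> df; split; first exact: linearP.
have [k _ kP] := linear_lipschitz (diff_continuous df).
by exists k.
Qed.

Lemma blin_diff V W (f : V -> W) x : blin f -> is_diff x f f.
Proof.
move=> fb; apply: eps_diff => // e e0; exists 1 => // h _.
have [flin _] := fb.
have -> : f (x + h) = f x + f h by have := flin 1 x h; rewrite !scale1r.
by rewrite [f x + _]addrC addrK subrr normr0 mulr_ge0 // ltW.
Qed.

Lemma blinD V W (f : V -> W) x y : blin f -> f (x + y) = f x + f y.
Proof. by case=> flin _; have := flin 1 x y; rewrite !scale1r. Qed.

Lemma blin0 V W (f : V -> W) : blin f -> f 0 = 0.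
Proof. by move=> fb; apply: (addrI (f 0)); rewrite -blinD // !addr0. Qed.

Lemma blinZ V W (f : V -> W) a x : blin f -> f (a *: x) = a *: f x.
Proof.
by move=> fb; have := fb.1 a x 0; rewrite !addr0 (blin0 fb) addr0.
Qed.

Lemma blinN V W (f : V -> W) x : blin f -> f (- x) = - f x.
Proof. by move=> fb; rewrite -scaleN1r blinZ // scaleN1r. Qed.

Lemma blinB V W (f : V -> W) x y : blin f -> f (x - y) = f x - f y.
Proof. by move=> fb; rewrite blinD // blinN. Qed.

Lemma blin_bound V W (f : V -> W) : blin f ->
  exists2 M : R, 0 < M & forall x, `|f x| <= M * `|x|.
Proof.
case=> _ [M fM]; exists (Num.max M 1); first by rewrite lt_max ltr01 orbT.
by move=> x; rewrite (le_trans (fM x)) // ler_wpM2r // le_max lexx.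
Qed.

Lemma blin_id V : blin (@id V).
Proof. by split=> //; exists 1 => x; rewrite mul1r. Qed.

Lemma blin_comp V W X (f : V -> W) (g : W -> X) :
  blin f -> blin g -> blin (g \o f).
Proof.
move=> fb gb; split; first by move=> a x y /=; rewrite fb.1 gb.1.
have [M M0 fM] := blin_bound fb; have [N N0 gN] := blin_bound gb.
exists (N * M) => x /=; rewrite (le_trans (gN _)) // -mulrA ler_wpM2l //.
exact: ltW.
Qed.

Lemma blin_pair V W X (f : V -> W) (g : V -> X) :
  blin f -> blin g -> blin (fun x => (f x, g x)).
Proof.
move=> fb gb; split; first by move=> a x y /=; rewrite fb.1 gb.1.
have [M M0 fM] := blin_bound fb; have [N N0 gN] := blin_bound gb.
exists (Num.max M N) => x; rewrite prod_normE /= ge_max.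
by rewrite (le_trans (fM x)) ?(le_trans (gN x)) // ler_wpM2r // le_max lexx ?orbT.
Qed.

Lemma normr_fst V W (x : V * W) : `|x.1| <= `|x|.
Proof. by rewrite prod_normE le_max lexx. Qed.

Lemma normr_snd V W (x : V * W) : `|x.2| <= `|x|.
Proof. by rewrite prod_normE le_max lexx orbT. Qed.

Lemma blin_fst V W : blin (@fst V W).
Proof. by split=> //; exists 1 => x; rewrite mul1r normr_fst. Qed.

Lemma blin_snd V W : blin (@snd V W).
Proof. by split=> //; exists 1 => x; rewrite mul1r normr_snd. Qed.

Lemma blin_cst0 V W : blin (fun _ : V => 0 : W).
Proof.
split; first by move=> a x y; rewrite scaler0 addr0.
by exists 0 => x; rewrite normr0 mul0r.
Qed.

Lemma blin_add V W (f g : V -> W) : blin f -> blin g -> blin (fun x => f x + g x).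
Proof.
move=> fb gb; split; first by move=> a x y /=; rewrite fb.1 gb.1 scalerDr addrACA.
have [M M0 fM] := blin_bound fb; have [N N0 gN] := blin_bound gb.
by exists (M + N) => x; rewrite (le_trans (ler_normD _ _)) // mulrDl lerD.
Qed.

Lemma blin_opp V W (f : V -> W) : blin f -> blin (fun x => - f x).
Proof.
move=> fb; split; first by move=> a x y /=; rewrite fb.1 opprD scalerN.
by have [M M0 fM] := blin_bound fb; exists M => x; rewrite normrN.
Qed.

Lemma near_eq_diff V W (f g : V -> W) x :
  (\forall y \near x, f y = g y) -> differentiable f x -> is_diff x g ('d f x).
Proof.
move=> fg df; apply: eps_diff; first exact: diff_blin.
move=> e e0; have [d d0 dP] := diff_eps df e0.
have /nbhs_ballP[d' /= d'0 d'P] := fg.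
exists (Num.min d d'); first by rewrite lt_min d0.
move=> h; rewrite lt_min => /andP[hd hd'].
rewrite -!d'P ?dP //; first exact: ballxx.
by rewrite -ball_normE /= opprD addrA subrr sub0r normrN.
Qed.

Lemma near_eq_is_diff V W (f g df : V -> W) x :
  (\forall y \near x, f y = g y) -> is_diff x f df -> is_diff x g df.
Proof. by move=> fg [f1 <-]; exact: near_eq_diff. Qed.

End Differentials.

(** * Smoothness through iterated tangent maps *)

Section TangentSmooth.
Context {R : realType}.

(** [tsm k U f] iterates the tangent map [(z, u) |-> 'd f z u], which doubles
    the domain and keeps the codomain.  Unlike iterated directional
    derivatives, this controls the dependence on base point and direction
    jointly, which is what compositions need in infinite dimension. *)
Fixpoint tsm (W : normedModType R) (k : nat) :
    forall V : normedModType R, set V -> (V -> W) -> Prop :=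
  fun V U f => match k with
  | 0 => forall x, U x -> {for x, continuous f}
  | k'.+1 => (forall x, U x -> differentiable f x) /\
     tsm k' (U `*` [set: V]) (fun z : V * V => 'd f (z.1) (z.2))
  end.

Definition tsmooth (V W : normedModType R) (U : set V) (f : V -> W) :=
  forall k, tsm k U f.

Implicit Types V W X Y : normedModType R.

Lemma open_tangent V (U : set V) : open U -> open (U `*` [set: V]).
Proof.
move=> oU; have -> : U `*` [set: V] = fst @^-1` U.
  by apply/seteqP; split=> [z []|z ?].
by apply: open_comp => // z _; exact: blin_continuous (blin_fst V V) z.
Qed.

Lemma tsm_ext k V W (U : set V) (f g : V -> W) : open U ->
  (forall x, U x -> f x = g x) -> tsm k U f -> tsm k U g.
Proof.
elim: k V U f g => [|k IH] V U f g oU fg /=.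
  move=> fc x Ux; have nU : nbhs x U by exact: open_nbhs_nbhs.
  rewrite /prop_for /continuous_at -fg //.
  apply: cvg_trans (fc x Ux); apply: near_eq_cvg.
  by apply: filterS nU => y; exact: fg.
move=> [df tf].
have D x : U x -> is_diff x g ('d f x).
  move=> Ux; apply: near_eq_diff; last exact: df.
  by apply: filterS (open_nbhs_nbhs (conj oU Ux)) => y; exact: fg.
split; first by move=> x /D [].
apply: IH tf; first exact: open_tangent.
by move=> z [Uz _]; rewrite /= (@diff_val _ _ _ _ _ _ _ (D _ Uz)).
Qed.

Lemma tsm_sub k V W (U U' : set V) (f : V -> W) :
  U' `<=` U -> tsm k U f -> tsm k U' f.
Proof.
elim: k V U U' f => [|k IH] V U U' f sU /=; first by move=> fc x /sU; exact: fc.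
move=> [df tf]; split; first by move=> x /sU; exact: df.
by apply: IH tf => z [/sU ? ?].
Qed.

Lemma tsmS k V W (U : set V) (f : V -> W) : tsm k.+1 U f -> tsm k U f.
Proof.
elim: k V U f => [|k IH] V U f.
  by move=> /= [df _] x Ux; exact/differentiable_continuous/df.
by move=> [df tf]; split=> //; exact: IH.
Qed.

Lemma tsm_blin k V W (U : set V) (f : V -> W) : open U -> blin f -> tsm k U f.
Proof.
elim: k V U f => [|k IH] V U f oU fb /=.
  by move=> x _; exact: blin_continuous.
split; first by move=> x _; have [] := blin_diff x fb.
have oT := open_tangent oU.
apply: (@tsm_ext _ _ _ _ (f \o snd)) => //; last first.
  by apply: IH => //; apply: blin_comp => //; exact: blin_snd.
by move=> z _; rewrite (@diff_val _ _ _ _ _ _ _ (blin_diff _ fb)).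
Qed.

Lemma tsm_cst k V W (U : set V) (c : W) : open U -> tsm k U (fun _ : V => c).
Proof.
case: k => [|k] oU; first by move=> x _; exact: cst_continuous.
split; first by move=> x _; exact: differentiable_cst.
apply: (@tsm_ext _ _ _ _ (fun=> 0)); first exact: open_tangent.
  by move=> z _; rewrite (@diff_val _ _ _ _ _ _ _ (is_diff_cst c z.1)).
by apply: tsm_blin; [exact: open_tangent | exact: blin_cst0].
Qed.

Lemma blin_tangent V W (L : V -> W) : blin L ->
  blin (fun z : V * V => (L z.1, L z.2)).
Proof.
move=> bL; apply: (@blin_pair _ _ _ _ (L \o fst) (L \o snd));
  apply: blin_comp => //; [exact: blin_fst | exact: blin_snd].
Qed.

Lemma tsm_precomp k V W X (U : set W) (f : W -> X) (L : V -> W) :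
  open U -> blin L -> tsm k U f -> tsm k (L @^-1` U) (f \o L).
Proof.
elim: k V W U f L => [|k IH] V W U f L oU bL /=.
  move=> fc x Ux; apply: continuous_comp; last exact: fc.
  exact: blin_continuous.
have oU' : open (L @^-1` U) by apply: open_comp => // x _; exact: blin_continuous.
move=> [df tf].
have D x := blin_diff x bL.
split.
  by move=> x Ux; apply: differentiable_comp; [have [] := D x | exact: df].
apply: (@tsm_ext _ _ _ _
  ((fun z : W * W => 'd f (z.1) (z.2)) \o (fun z : V * V => (L z.1, L z.2)))).
- exact: open_tangent.
- move=> z [Uz _] /=; rewrite [in RHS]diff_comp; [|by have [] := D z.1|exact: df].
  by rewrite /= (@diff_val _ _ _ _ _ _ _ (D z.1)).
- have := IH _ _ _ _ _ (open_tangent oU) (blin_tangent bL) tf.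
  by move=> H; apply: tsm_sub H => z [].
Qed.

Lemma tsm_pair k V W X (U : set V) (f : V -> W) (g : V -> X) : open U ->
  tsm k U f -> tsm k U g -> tsm k U (fun x => (f x, g x)).
Proof.
elim: k V U f g => [|k IH] V U f g oU.
  by move=> fc gc x Ux; apply: cvg_pair; [exact: fc | exact: gc].
move=> [df tf] [dg tg]; split.
  by move=> x Ux; apply: differentiable_pair; [exact: df | exact: dg].
have oT := open_tangent oU.
apply: (tsm_ext oT _ (IH _ _ _ _ oT tf tg)).
by move=> z [Uz _] /=; rewrite diff_pair //; [exact: df | exact: dg].
Qed.

(** By the chain rule the tangent map of [g \o f] is the tangent map of [g]
    composed with [(f, Tf)], so the induction closes on compositions. *)
Lemma tsm_comp k V W X (U : set V) (U' : set W) (f : V -> W) (g : W -> X) :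
  open U -> open U' -> (forall x, U x -> U' (f x)) ->
  tsm k U f -> tsm k U' g -> tsm k U (g \o f).
Proof.
elim: k V W U U' f g => [|k IH] V W U U' f g oU oU' fU.
  by move=> fc gc x Ux; apply: continuous_comp; [exact: fc | exact/gc/fU].
move=> tfS [dg tg]; have [df tf] := tfS; split.
  by move=> x Ux; apply: differentiable_comp; [exact: df | exact/dg/fU].
have oT := open_tangent oU.
have pf : tsm k (U `*` [set: V]) (fun z => (f z.1, 'd f (z.1) (z.2))).
  apply: tsm_pair => //.
  have := tsm_precomp oU (blin_fst V V) (tsmS tfS).
  by move=> H; apply: tsm_sub H => z [].
apply: (tsm_ext oT _ (IH _ _ _ _ _ _ oT (open_tangent oU') _ pf tg)).
  by move=> z [Uz _] /=; rewrite [in RHS]diff_comp //; [exact: df | exact/dg/fU].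
by move=> z [Uz _]; split=> //=; exact: fU.
Qed.

Lemma tsm_postcomp k V W X (U : set V) (f : V -> W) (L : W -> X) :
  open U -> blin L -> tsm k U f -> tsm k U (L \o f).
Proof.
move=> oU bL tf; apply: (tsm_comp oU openT _ tf) => //.
by apply: tsm_blin => //; exact: openT.
Qed.

Lemma tsmD k V W (U : set V) (f g : V -> W) : open U ->
  tsm k U f -> tsm k U g -> tsm k U (fun x => f x + g x).
Proof.
move=> oU tf tg.
apply: (@tsm_postcomp _ _ _ _ _ (fun x => (f x, g x)) (fun p => p.1 + p.2)) => //.
  by apply: blin_add; [exact: blin_fst | exact: blin_snd].
exact: tsm_pair.
Qed.

Lemma tsmN k V W (U : set V) (f : V -> W) : open U ->
  tsm k U f -> tsm k U (fun x => - f x).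
Proof.
move=> oU tf; apply: (@tsm_postcomp _ _ _ _ _ f (fun p => - p)) => //.
by apply: blin_opp; exact: blin_id.
Qed.

Lemma tsmB k V W (U : set V) (f g : V -> W) : open U ->
  tsm k U f -> tsm k U g -> tsm k U (fun x => f x - g x).
Proof. by move=> oU tf tg; apply: tsmD => //; exact: tsmN. Qed.

Lemma tsm_sum k V W (U : set V) n (f : 'I_n -> V -> W) : open U ->
  (forall i, tsm k U (f i)) -> tsm k U (fun x => \sum_(i < n) f i x).
Proof.
move=> oU; elim: n f => [|n IH] f tf.
  apply: (@tsm_ext _ _ _ _ (fun=> 0)) => //; last exact: tsm_cst.
  by move=> x _; rewrite big_ord0.
apply: (@tsm_ext _ _ _ _ (fun x => \sum_(i < n) f (widen_ord (leqnSn n) i) x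
   + f ord_max x)) => //; first by move=> x _; rewrite big_ord_recr.
by apply: tsmD => //; exact: IH.
Qed.

Definition bbilin V W X (b : V -> W -> X) :=
  [/\ forall v, linear (b v), forall w, linear (b^~ w) &
      exists M : R, forall v w, `|b v w| <= M * `|v| * `|w|].

Lemma bbilin_l V W X (b : V -> W -> X) w : bbilin b -> blin (b^~ w).
Proof.
by move=> [_ bl [M bM]]; split=> //; exists (M * `|w|) => v; rewrite mulrAC.
Qed.

Lemma bbilin_r V W X (b : V -> W -> X) v : bbilin b -> blin (b v).
Proof. by move=> [bl _ [M bM]]; split=> //; exists (M * `|v|) => w. Qed.

Lemma bbilin_diff V W X (b : V -> W -> X) p : bbilin b ->
  is_diff p (fun q => b q.1 q.2) (fun q => b p.1 q.2 + b q.1 p.2).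
Proof.
move=> bb; apply: eps_diff.
  apply: blin_add.
    exact: (blin_comp (blin_snd _ _) (bbilin_r _ bb)).
  exact: (blin_comp (blin_fst _ _) (bbilin_l _ bb)).
have [_ _ [M0 bM0]] := bb.
pose M := Num.max M0 1.
have M_gt0 : 0 < M by rewrite lt_max ltr01 orbT.
have bM v w : `|b v w| <= M * `|v| * `|w|.
  by rewrite (le_trans (bM0 v w)) // !ler_wpM2r // le_max lexx.
move=> e e0; exists (e / M); first by rewrite divr_gt0.
move=> [h k] /= hk.
have -> : b (p.1 + h) (p.2 + k) - b p.1 p.2 - (b p.1 k + b h p.2) = b h k.
  rewrite (blinD _ _ (bbilin_l _ bb)) !(blinD _ _ (bbilin_r _ bb)).
  move: (b h p.2) (b h k) (b p.1 p.2) (b p.1 k) => A B C D.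
  apply/eqP; rewrite subr_eq; apply/eqP.
  by rewrite addrAC [C + D]addrC addrK addrA addrC.
rewrite (le_trans (bM h k)) // mulrAC.
have hk' := normr_fst (h, k); have kk' := normr_snd (h, k).
rewrite mulrAC; apply: ler_pM => //; first by rewrite mulr_ge0 // ltW.
rewrite -ler_pdivlMl //; rewrite mulrC.
exact: le_trans hk' (ltW hk).
Qed.

(** The tangent map of a bilinear map is a sum of two copies of the same map,
    precomposed with linear maps. *)
Lemma tsm_bbilin k V W X (b : V -> W -> X) (U : set (V * W)) : open U ->
  bbilin b -> tsm k U (fun q => b q.1 q.2).
Proof.
move=> oU bb; suff: tsm k [set: V * W] (fun q => b q.1 q.2) by move=> H; apply: tsm_sub H.
elim: k {oU U} => [|k IH].
  move=> x _; apply: differentiable_continuous.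
  by have [] := bbilin_diff x bb.
have oT : open ([set: V * W] `*` [set: V * W]) by apply: open_tangent; exact: openT.
split; first by move=> x _; have [] := bbilin_diff x bb.
apply: (@tsm_ext _ _ _ _ (fun z : (V * W) * (V * W) =>
   b z.1.1 z.2.2 + b z.2.1 z.1.2)) => //.
  by move=> z _; rewrite (@diff_val _ _ _ _ _ _ _ (bbilin_diff z.1 bb)).
have b11 : blin (fun z : (V * W) * (V * W) => (z.1.1, z.2.2)).
  apply: blin_pair.
    exact: (blin_comp (blin_fst _ _) (blin_fst _ _)).
  exact: (blin_comp (blin_snd _ _) (blin_snd _ _)).
have b21 : blin (fun z : (V * W) * (V * W) => (z.2.1, z.1.2)).
  apply: blin_pair.
    exact: (blin_comp (blin_snd _ _) (blin_fst _ _)).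
  exact: (blin_comp (blin_fst _ _) (blin_snd _ _)).
apply: tsmD => //.
  by apply: tsm_sub (tsm_precomp openT b11 IH).
by apply: tsm_sub (tsm_precomp openT b21 IH).
Qed.

Lemma tsm_bilin k V W X Y (b : W -> X -> Y) (U : set V) (f : V -> W)
  (g : V -> X) : open U -> bbilin b ->
  tsm k U f -> tsm k U g -> tsm k U (fun x => b (f x) (g x)).
Proof.
move=> oU bb tf tg.
apply: (@tsm_comp _ _ _ _ _ [set: W * X] (fun x => (f x, g x))
  (fun q => b q.1 q.2)) => //; first exact: openT.
  exact: tsm_pair.
by apply: tsm_bbilin => //; exact: openT.
Qed.

End TangentSmooth.

(** * Smoothness in spaces of matrices *)

Section FiniteDim.
Context {R : realType}.

Lemma mx_norm_le m n (A : 'M[R]_(m, n)) (c : R) : 0 <= c ->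
  (forall i j, `|A i j| <= c) -> `|A| <= c.
Proof.
move=> c0 Ac; rewrite [leLHS]/Num.norm /= mx_normrE; apply/bigmax_leP.
by split=> // -[i j] _; exact: Ac.
Qed.

Lemma coord_norm_le m n (A : 'M[R]_(m, n)) i j : `|A i j| <= `|A|.
Proof.
rewrite [leRHS]/Num.norm /= mx_normrE.
exact: (le_bigmax _ (fun ij : 'I_m * 'I_n => `|A ij.1 ij.2|) (i, j)).
Qed.

Lemma blin_coord m n i j : blin (fun A : 'M[R]_(m, n) => A i j).
Proof.
split; first by move=> a A B; rewrite !mxE.
by exists 1 => A; rewrite mul1r coord_norm_le.
Qed.

Lemma bbilin_mulmx m n q : bbilin (@mulmx R m n q).
Proof.
split; first by move=> A a B C; rewrite mulmxDr scalemxAr.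
  by move=> A a B C; rewrite mulmxDl scalemxAl.
exists n%:R => A B; apply: mx_norm_le; first by rewrite !mulr_ge0.
move=> i j; rewrite mxE (le_trans (ler_norm_sum _ _ _)) //.
have -> : n%:R * `|A| * `|B| = \sum_(k < n) `|A| * `|B|.
  by rewrite sumr_const card_ord -[RHS]mulr_natl mulrA.
apply: ler_sum => k _; rewrite normrM.
by apply: ler_pM => //; exact: coord_norm_le.
Qed.

Lemma bbilin_scale (V : normedModType R) : bbilin (fun (a : R) (v : V) => a *: v).
Proof.
split; first by move=> a c v w; rewrite scalerDr !scalerA mulrC.
  by move=> v c a b; rewrite scalerDl -scalerA.
by exists 1 => a v; rewrite mul1r normrZ.
Qed.

Lemma col_sum_delta N (x : 'cV[R]_N) :
  x = \sum_(i < N) x i 0 *: (delta_mx i 0 : 'cV[R]_N).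
Proof.
by rewrite {1}[x]matrix_sum_delta; apply: eq_bigr => i _; rewrite big_ord1.
Qed.

(** In finite dimension the tangent map is the sum of the partial derivatives
    weighted by the coordinates of the direction, hence as regular as they are. *)
Lemma Ck_on_tsm k N (W : normedModType R) (U : set 'cV[R]_N)
    (f : 'cV[R]_N -> W) : open U -> Ck_on k U f -> tsm k U f.
Proof.
move=> oU; elim: k f => [//|k IH] f [df Df]; split=> //.
have oT := open_tangent oU.
apply: (@tsm_ext _ _ _ _ _ (fun z : 'cV[R]_N * 'cV[R]_N =>
   \sum_(i < N) z.2 i 0 *: ('D_(delta_mx i 0 : 'cV[R]_N) f z.1))) => //.
  move=> z [Uz _]; rewrite [in RHS](col_sum_delta z.2) linear_sum.
  by apply: eq_bigr => i _; rewrite linearZ /= deriveE //; exact: df.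
apply: tsm_sum => // i; apply: (tsm_bilin oT (bbilin_scale W)).
  by apply: tsm_blin => //; apply: (blin_comp (blin_snd _ _) (blin_coord i 0)).
have := tsm_precomp oU (blin_fst _ 'cV[R]_N) (IH _ (Df (delta_mx i 0))).
by move=> H; apply: tsm_sub H => z [].
Qed.

Lemma tsm_Ck_on k (V W : normedModType R) (U : set V) (f : V -> W) :
  open U -> tsm k U f -> Ck_on k U f.
Proof.
move=> oU; elim: k f => [//|k IH] f [df tf]; split=> // w.
apply: IH; apply: (@tsm_ext _ _ _ _ _
   ((fun z : V * V => 'd f (z.1) (z.2)) \o (fun x => (x, w)))) => //.
  by move=> x Ux /=; rewrite deriveE //; exact: df.
apply: (tsm_comp oU (open_tangent oU) _ _ tf) => //.
apply: tsm_pair => //; last exact: tsm_cst.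
by apply: tsm_blin => //; exact: blin_id.
Qed.

Lemma smooth_on_tsmooth N (W : normedModType R) (U : set 'cV[R]_N)
    (f : 'cV[R]_N -> W) : open U -> smooth_on U f -> tsmooth U f.
Proof. by move=> oU sf k; apply: Ck_on_tsm. Qed.

Lemma tsmooth_smooth_on (V W : normedModType R) (U : set V) (f : V -> W) :
  open U -> tsmooth U f -> smooth_on U f.
Proof. by move=> oU sf k; apply: tsm_Ck_on. Qed.

Lemma invmx_sub n (A B : 'M[R]_n) : A \in unitmx -> B \in unitmx ->
  invmx B - invmx A = - (invmx B *m (B - A) *m invmx A).
Proof.
move=> uA uB; rewrite mulmxBr mulmxBl mulVmx // mul1mx -mulmxA mulmxV //.
by rewrite mulmx1 opprB.
Qed.

Lemma invmx_bound n : exists2 M : R, 0 < M &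
  forall A B C : 'M[R]_n, `|A *m B *m C| <= M * `|A| * `|B| * `|C|.
Proof.
have [_ _ [M bM]] := bbilin_mulmx n n n.
exists (Num.max M 1 * Num.max M 1).
  by rewrite mulr_gt0 // lt_max ltr01 orbT.
set K := Num.max M 1; have K0 : 0 <= K by rewrite le_max ler01 orbT.
have bK (A B : 'M[R]_n) : `|A *m B| <= K * `|A| * `|B|.
  by rewrite (le_trans (bM _ _)) // !ler_wpM2r // le_max lexx.
move=> A B C; rewrite (le_trans (bK _ _)) // ler_wpM2r //.
by rewrite -!mulrA ler_wpM2l // mulrA.
Qed.

(** The resolvent identity bounds [invmx B - invmx A] by a multiple of
    [|invmx B| |B - A|]; for [B] close to [A] the first factor is at most
    twice [|invmx A| + 1]. *)
Lemma invmx_lip n (A : 'M[R]_n) : A \in unitmx ->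
  exists2 C : R, 0 < C & exists2 d : R, 0 < d & forall B, B \in unitmx ->
    `|B - A| < d -> `|invmx B - invmx A| <= C * `|B - A|.
Proof.
move=> uA; have [M M0 bM] := invmx_bound n.
pose a := `|invmx A| + 1; have a0 : 0 < a by rewrite ltr_wpDl.
have aA : `|invmx A| <= a by rewrite lerDl.
exists (2 * M * a * a); first by rewrite !mulr_gt0.
exists (2 * M * a)^-1; first by rewrite invr_gt0 !mulr_gt0.
move=> B uB BA; rewrite invmx_sub // normrN.
have BA' : 2 * (M * a * `|B - A|) <= 1.
  have := ltW BA; rewrite -[X in _ <= X]mul1r ler_pdivlMr ?mulr_gt0 //.
  by apply: le_trans; rewrite le_eqVlt; apply/orP; left; apply/eqP; ring.
have iB : `|invmx B| <= 2 * a.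
  have : `|invmx B| <= a + (M * a * `|B - A|) * `|invmx B|.
    rewrite -[X in `|X| <= _](subrK (invmx A)) addrC (le_trans (ler_normD _ _)) //.
    rewrite lerD // invmx_sub // normrN (le_trans (bM _ _ _)) //.
    have : M * `|invmx B| * `|B - A| * `|invmx A| <= M * `|invmx B| * `|B - A| * a.
      by rewrite ler_wpM2l // !mulr_ge0 // ltW.
    by move/le_trans; apply; rewrite le_eqVlt; apply/orP; left; apply/eqP; ring.
  have : M * a * `|B - A| * `|invmx B| <= 2^-1 * `|invmx B|.
    by rewrite ler_wpM2r // -[leRHS]mulr1 ler_pdivlMl.
  by lra.
rewrite (le_trans (bM _ _ _)) //.
have : M * `|invmx B| * `|B - A| * `|invmx A| <= M * (2 * a) * `|B - A| * a.
  apply: ler_pM => //; first by rewrite !mulr_ge0 // ltW.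
  by rewrite ler_wpM2r // ler_wpM2l // ltW.
by move/le_trans; apply; rewrite le_eqVlt; apply/orP; left; apply/eqP; ring.
Qed.

(** The resolvent identity, rearranged so that both remaining terms are of
    higher order when [L] approximates [D]. *)
Lemma invmx_alg n (I D L A : 'M[R]_n) : I - A = - (I *m D *m A) ->
  I - A + A *m L *m A = - ((I - A) *m D *m A) - A *m (D - L) *m A.
Proof.
move=> key; rewrite {1}key !mulmxBl mulmxBr mulmxBl !opprB.
by rewrite [RHS]addrC addrA subrK addrC.
Qed.

Lemma diff_invmx (V : normedModType R) n (B : V -> 'M[R]_n) (U : set V) x :
  open U -> U x -> (forall y, U y -> B y \in unitmx) -> differentiable B x ->
  is_diff x (fun y => invmx (B y))
    (fun h => - (invmx (B x) *m 'd B x h *m invmx (B x))).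
Proof.
move=> oU Ux uB dB.
have [M M0 bM] := invmx_bound n.
have [C C0 [d d0 lipC]] := invmx_lip (uB x Ux).
set A := invmx (B x).
have bd := diff_blin dB.
have [K K0 bK] := blin_bound bd.
have bL : blin (fun h => - (A *m 'd B x h *m A)).
  apply: blin_opp.
  apply: (@blin_comp _ _ _ _ ('d B x) (fun D => A *m D *m A)) => //.
  apply: (@blin_comp _ _ _ _ (mulmx A) (mulmxr A)).
    by apply: bbilin_r; exact: bbilin_mulmx.
  by apply: (@bbilin_l _ _ _ _ (@mulmx R n n n)); exact: bbilin_mulmx.
apply: eps_diff => // e e0.
have [d1 d10 dP1] := diff_eps dB ltr01.
pose e' := e / (2 * M * (`|A| + 1) ^+ 2).
have a0 : 0 < `|A| + 1 by rewrite ltr_wpDl.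
have e'0 : 0 < e' by rewrite divr_gt0 // mulr_gt0 ?mulr_gt0 // exprn_gt0.
have [d2 d20 dP2] := diff_eps dB e'0.
have [d3 /= d30 dP3] := (nbhs_ballP _ _).1 (open_nbhs_nbhs (conj oU Ux)).
pose c := M * C * (`|A| + 1) * (K + 1) ^+ 2.
have c0 : 0 < c by rewrite !mulr_gt0 // ?exprn_gt0 // ltr_pwDl.
exists (Num.min (Num.min d1 d2) (Num.min d3 (Num.min (d / (K + 1)) (e / (2 * c))))).
  by rewrite !lt_min d10 d20 d30 !divr_gt0 ?mulr_gt0 // ltr_pwDl.
move=> h; rewrite !lt_min => /andP[/andP[hd1 hd2] /andP[hd3 /andP[hd hc]]].
set D := B (x + h) - B x.
have UxH : U (x + h).
  by apply: dP3; rewrite -ball_normE /= opprD addrA subrr sub0r normrN.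
have DK : `|D| <= (K + 1) * `|h|.
  rewrite mulrDl -[D](subrK ('d B x h)) addrC (le_trans (ler_normD _ _)) //.
  by rewrite lerD // -[leRHS]/(1 * `|h|) ?mul1r; have := dP1 h hd1; rewrite mul1r.
have Dd : `|D| < d.
  by rewrite (le_lt_trans DK) // mulrC -ltr_pdivlMr // ltr_pwDl.
have -> : invmx (B (x + h)) - A - - (A *m 'd B x h *m A) =
   - ((invmx (B (x + h)) - A) *m D *m A) - A *m (D - 'd B x h) *m A.
  by rewrite opprK; apply: invmx_alg; rewrite invmx_sub ?uB.
rewrite (le_trans (ler_normD _ _)) // !normrN.
have H1 : `|(invmx (B (x + h)) - A) *m D *m A| <= c * `|h| ^+ 2.
  rewrite (le_trans (bM _ _ _)) //.
  have H : `|invmx (B (x + h)) - A| <= C * `|D| by apply: lipC => //; exact: uB.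
  have : M * `|invmx (B (x + h)) - A| * `|D| * `|A| <=
         M * (C * ((K + 1) * `|h|)) * ((K + 1) * `|h|) * (`|A| + 1).
    apply: ler_pM => //; rewrite ?lerDl // ?mulr_ge0 //; try exact: ltW.
    apply: ler_pM => //; rewrite ?mulr_ge0 //; try exact: ltW.
    rewrite ler_wpM2l ?(ltW M0) // (le_trans H) // ler_wpM2l //; exact: ltW.
  by move/le_trans; apply; rewrite le_eqVlt; apply/orP; left; apply/eqP;
    rewrite /c; ring.
have H2 : `|A *m (D - 'd B x h) *m A| <= e / 2 * `|h|.
  rewrite (le_trans (bM _ _ _)) //.
  have : M * `|A| * `|D - 'd B x h| * `|A| <=
         M * (`|A| + 1) * (e' * `|h|) * (`|A| + 1).
    apply: ler_pM => //; rewrite ?lerDl // ?mulr_ge0 //; try exact: ltW.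
    apply: ler_pM => //; rewrite ?mulr_ge0 //; try exact: ltW.
      by rewrite ler_wpM2l ?lerDl // ltW.
    exact: dP2.
  move/le_trans; apply; rewrite le_eqVlt; apply/orP; left; apply/eqP.
  by rewrite /e'; field; rewrite ?gt_eqF.
have H3 : c * `|h| ^+ 2 <= e / 2 * `|h|.
  rewrite expr2 mulrA ler_wpM2r // -ler_pdivlMl //.
  by apply: le_trans (ltW hc) _; rewrite le_eqVlt; apply/orP; left; apply/eqP;
    field; rewrite ?gt_eqF.
by rewrite (le_trans (lerD (le_trans H1 H3) H2)) // -mulrDl -splitr.
Qed.

(** The tangent map of the inverse is [- invmx B (TB) invmx B], in which only
    the inverse itself and [TB] occur; the induction costs one derivative of [B]. *)
Lemma tsm_invmx k (V : normedModType R) n (B : V -> 'M[R]_n) (U : set V) :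
  open U -> (forall y, U y -> B y \in unitmx) -> tsm k.+1 U B ->
  tsm k U (fun y => invmx (B y)).
Proof.
move=> oU uB tB.
have D x (Ux : U x) := diff_invmx oU Ux uB (tB.1 x Ux).
have := tsmS tB; elim: k tB => [|k IH] tB _.
  by move=> x Ux; apply: differentiable_continuous; have [] := D x Ux.
have oT := open_tangent oU.
split; first by move=> x Ux; have [] := D x Ux.
have tI := IH (tsmS tB) (tsmS (tsmS tB)).
have tI' : tsm k (U `*` [set: V]) (fun z => invmx (B z.1)).
  have H := tsm_precomp oU (blin_fst V V) tI.
  by apply: tsm_sub H => z [].
apply: (@tsm_ext _ _ _ _ _ (fun z : V * V =>
   - (invmx (B z.1) *m 'd B (z.1) (z.2) *m invmx (B z.1)))) => //.
  move=> z [Uz _]; apply: esym.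
  exact: (congr1 (fun g => g z.2) (@diff_val _ _ _ _ _ _ _ (D z.1 Uz))).
apply: tsmN => //; apply: (tsm_bilin oT (bbilin_mulmx n n n)) => //.
by apply: (tsm_bilin oT (bbilin_mulmx n n n)) => //; exact: tsmS tB.2.
Qed.

End FiniteDim.

(** * Regularity of implicit functions in normed spaces *)

Section ImplicitRegularity.
Context {R : realType}.
Implicit Types V W P E F : normedModType R.

Lemma ball0P V (x h : V) (d : R) : `|h| < d -> ball x d (x + h).
Proof. by rewrite -ball_normE /= opprD addrA subrr sub0r normrN. Qed.

Lemma open_eps V (U : set V) x : open U -> U x ->
  exists2 d : R, 0 < d & forall h, `|h| < d -> U (x + h).
Proof.
move=> oU Ux.
have [d /= d0 dP] := (nbhs_ballP _ _).1 (open_nbhs_nbhs (conj oU Ux)).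
by exists d => // h hd; apply: dP; exact: ball0P.
Qed.

Lemma cont_eps V W (f : V -> W) x : {for x, continuous f} ->
  forall e : R, 0 < e -> exists2 d : R, 0 < d &
    forall h, `|h| < d -> `|f (x + h) - f x| < e.
Proof.
move=> fc e e0; have /cvgrPdist_lt /(_ e e0) /nbhs_ballP[d /= d0 dP] := fc.
by exists d => // h hd; rewrite distrC; apply: dP; exact: ball0P.
Qed.

Lemma eps_cont V W (f : V -> W) x :
  (forall e : R, 0 < e -> exists2 d : R, 0 < d &
    forall h, `|h| < d -> `|f (x + h) - f x| <= e) -> {for x, continuous f}.
Proof.
move=> fe; apply/cvgrPdist_le => e e0; have [d d0 dP] := fe e e0.
apply/nbhs_ballP; exists d => // y; rewrite -ball_normE /= => xy.
rewrite distrC -[y](subrK x) [y - x + x]addrC; apply: dP.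
by rewrite distrC.
Qed.

Lemma blin_inr V W : blin (fun w : W => (0 : V, w)).
Proof. by apply: blin_pair; [exact: blin_cst0 | exact: blin_id]. Qed.

Lemma blin_inl V W : blin (fun v : V => (v, 0 : W)).
Proof. by apply: blin_pair; [exact: blin_id | exact: blin_cst0]. Qed.

Lemma pair_split V W (z : V * W) : z = (z.1, 0) + (0, z.2).
Proof. by case: z => a b; congr (_, _); rewrite /= ?addr0 ?add0r. Qed.

Lemma diff_shift V W (f L : V -> W) (c : W) x : blin L ->
  (forall y, f y = c + L y) -> is_diff x f L.
Proof.
move=> bL fL; apply: eps_diff => // e e0; exists 1 => // h _.
rewrite !fL (blinD _ _ bL) addrA [c + L x + _]addrC addrK subrr normr0.
by rewrite mulr_ge0 // ltW.
Qed.

Local Notation T f := (fun z => 'd f (z.1) (z.2)).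

(** The tangent map is linear in the direction, so differentiating it in the
    direction reproduces the differential. *)
Lemma diff_tangent_snd V W (U : set V) (f : V -> W) z v v' :
  open U -> tsm 2 U f -> U z ->
  'd (T f) (z, v) (0, v') = 'd f z v'.
Proof.
move=> oU [df [dTf _]] Uz.
have dA : is_diff v (fun w : V => (z, w)) (fun w => (0, w)).
  apply: (@diff_shift _ _ _ _ (z, 0)); first exact: blin_inr.
  by move=> y; rewrite [LHS]pair_split.
have dT : differentiable (T f) (z, v) by apply: dTf.
have := diff_comp (@ex_diff _ _ _ _ _ _ _ dA) dT.
move/(congr1 (fun g => g v')) => /=.
rewrite (@diff_val _ _ _ _ _ _ _ dA) => <-.
rewrite [X in 'd X _ _](_ : _ = ('d f z : V -> W)) //.
by rewrite (@diff_val _ _ _ _ _ _ _ (blin_diff v (diff_blin (df _ Uz)))).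
Qed.

Lemma diff_tangent_fst0 V W (U : set V) (f : V -> W) z h :
  open U -> tsm 2 U f -> U z -> 'd (T f) (z, 0) (h, 0) = 0.
Proof.
move=> oU [df [dTf _]] Uz.
have dA : is_diff z (fun w : V => (w, 0 : V)) (fun w => (w, 0)).
  by apply: blin_diff; exact: blin_inl.
have dT : differentiable (T f) (z, 0) by apply: dTf.
have := diff_comp (@ex_diff _ _ _ _ _ _ _ dA) dT.
move/(congr1 (fun g => g h)) => /=.
rewrite (@diff_val _ _ _ _ _ _ _ dA) => <-.
rewrite [X in 'd X _ _](_ : _ = cst 0); first by rewrite diff_cst.
by apply/funext => y /=; rewrite linear0.
Qed.

(** Differentiability of the tangent map at [(z, 0)] gives
    ['d f (z + h) v - 'd f z v = o(|h| + |v|)].  For [v] of the size of the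
    radius of validity this is an estimate relative to [|v|], and both sides
    are homogeneous in [v]. *)
Lemma diff_norm_continuous V W (U : set V) (f : V -> W) z :
  open U -> tsm 2 U f -> U z -> forall e : R, 0 < e ->
  exists2 d : R, 0 < d & forall h, `|h| < d -> U (z + h) /\ forall v,
    `|'d f (z + h) v - 'd f z v| <= e * `|v|.
Proof.
move=> oU tf Uz e e0.
have [df [dTf _]] := tf.
have dT : differentiable (T f) (z, 0) by apply: dTf.
have [d d0 dP] := diff_eps dT e0.
have [d' d'0 d'P] := open_eps oU Uz.
have H h v : `|h| < d -> `|v| < d ->
    `|'d f (z + h) v - 'd f z v| <= e * Num.max `|h| `|v|.
  move=> hd vd; have := dP (h, v).
  rewrite prod_normE /= gt_max hd vd => /(_ isT).
  rewrite linear0 subr0 add0r.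
  suff -> : 'd (T f) (z, 0) (h, v) = 'd f z v by [].
  rewrite [X in 'd _ _ X](pair_split (h, v)) linearD /=.
  by rewrite (diff_tangent_snd _ _ oU tf) // (diff_tangent_fst0 _ oU tf) // add0r.
exists (Num.min d' (d / 2)); first by rewrite lt_min d'0 divr_gt0.
move=> h; rewrite lt_min => /andP[hd' hd]; split; first exact: d'P.
have h_d : `|h| < d by rewrite (lt_trans hd) // ltr_pdivrMr // ltr_pMr // ltr1n.
move=> v; have [->|v0] := eqVneq v 0; first by rewrite !linear0 addr0 !normr0 mulr0.
have nv : 0 < `|v| by rewrite normr_gt0.
pose c := d / 2 / `|v|; have c0 : 0 < c by rewrite !divr_gt0.
have cv : `|c *: v| = d / 2 by rewrite normrZ gtr0_norm // /c divfK // gt_eqF.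
have := H h (c *: v) h_d.
rewrite cv ltr_pdivrMr // ltr_pMr // ltr1n => /(_ isT).
rewrite max_r; last exact: ltW.
rewrite (blinZ _ _ (diff_blin (df _ Uz))).
rewrite (blinZ _ _ (diff_blin (df _ (d'P _ hd')))).
rewrite -scalerBr normrZ gtr0_norm //.
by rewrite -cv normrZ gtr0_norm // mulrCA ler_pM2l.
Qed.

(** The partial differential in the second variable is onto and bounded
    below. *)
Definition invertible_snd P E F (Phi : P * E -> F) (z : P * E) :=
  (forall g, exists y, 'd Phi z (0, y) = g) /\
  exists C : R, forall y, `|y| <= C * `|'d Phi z (0, y)|.

(** With [D = x (s + h) - x s], expanding [Phi = 0] gives
    ['d Phi (h, D) = o(|h| + |D|)].  Inverting the partial differential
    compares [D] with the solution [L h] of ['d Phi (h, L h) = 0]; the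
    resulting bound first shows [D = O(h)], and then [D - L h = o(h)]. *)
Lemma implicit_diff P E F (Phi : P * E -> F) (O : set P) (x : P -> E) s :
  open O -> O s -> (forall t, O t -> Phi (t, x t) = 0) ->
  {for s, continuous x} -> differentiable Phi (s, x s) ->
  invertible_snd Phi (s, x s) ->
  differentiable x s /\ forall h, 'd Phi (s, x s) (h, 'd x s h) = 0.
Proof.
move=> oO Os Px xc dPhi [surj [C0 inj0]].
set z := (s, x s) in dPhi surj inj0 *.
pose C := Num.max C0 1.
have C_gt0 : 0 < C by rewrite lt_max ltr01 orbT.
have inj y : `|y| <= C * `|'d Phi z (0, y)|.
  by rewrite (le_trans (inj0 y)) // ler_wpM2r // le_max lexx.
have bz := diff_blin dPhi.
have [M M0 bM] := blin_bound bz.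
have sel h : exists y, 'd Phi z (h, y) = 0.
  have [y yP] := surj (- 'd Phi z (h, 0)); exists y.
  by rewrite (pair_split (h, y)) linearD /= yP subrr.
pose L h := projT1 (cid (sel h)).
have LP h : 'd Phi z (h, L h) = 0 by rewrite /L; case: cid.
have uniq y y' h : 'd Phi z (h, y) = 'd Phi z (h, y') -> y = y'.
  move=> yy; apply/eqP; rewrite -subr_eq0 -normr_le0 (le_trans (inj _)) //.
  have -> : (0, y - y') = (h, y) - (h, y') :> P * E by congr (_, _); rewrite /= subrr.
  by rewrite linearB /= yy subrr normr0 mulr0.
have bL : blin L.
  split.
    move=> a u v; apply: (uniq _ _ (a *: u + v)); rewrite LP.
    have -> : (a *: u + v, a *: L u + L v) = a *: (u, L u) + (v, L v) by [].
    by rewrite linearP /= !LP scaler0 addr0.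
  exists (C * M) => h; rewrite (le_trans (inj _)) // -mulrA ler_wpM2l ?(ltW C_gt0) //.
  have -> : 'd Phi z (0, L h) = - 'd Phi z (h, 0).
    apply/eqP; rewrite -addr_eq0 -linearD /=.
    have -> : (0, L h) + (h, 0) = (h, L h) by congr (_, _); rewrite /= ?addr0 ?add0r.
    by rewrite LP.
  rewrite normrN (le_trans (bM _)) // ler_wpM2l ?(ltW M0) //.
  by rewrite prod_normE /= normr0 max_l.
have [K K0 bK] := blin_bound bL.
have D : is_diff s x L.
  apply: eps_diff => // e e0.
  (* [e1] is small enough to absorb [|D|] on the left, and then to give [e]. *)
  pose c := 2 * K + 2; have c0 : 0 < c by rewrite addr_gt0 ?mulr_gt0.
  pose e1 := Num.min (2 * C)^-1 (e / (C * c)).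
  have e10 : 0 < e1 by rewrite lt_min invr_gt0 mulr_gt0 // divr_gt0 // mulr_gt0.
  have [d d0 dP] := diff_eps dPhi e10.
  have [d1 d10 dP1] := cont_eps xc d0.
  have [d2 d20 dP2] := open_eps oO Os.
  exists (Num.min d (Num.min d1 d2)); first by rewrite !lt_min d0 d10.
  move=> h; rewrite !lt_min => /and3P[hd hd1 hd2].
  set D := x (s + h) - x s.
  have xD : x (s + h) = x s + D by rewrite [RHS]addrC subrK.
  have nD : `|D| < d by exact: dP1.
  have := dP (h, D); rewrite prod_normE /= gt_max hd nD => /(_ isT).
  have -> : z + (h, D) = (s + h, x (s + h)) by rewrite xD.
  have Pz : Phi z = 0 by exact: Px.
  rewrite (Px _ (dP2 _ hd2)) Pz subrr sub0r normrN.
  have -> : 'd Phi z (h, D) = 'd Phi z (0, D - L h).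
    have -> : (0, D - L h) = (h, D) - (h, L h) :> P * E by congr (_, _); rewrite /= subrr.
    by rewrite linearB /= LP subr0.
  move=> rho.
  have DL : `|D - L h| <= C * e1 * Num.max `|h| `|D|.
    by rewrite (le_trans (inj _)) // -mulrA ler_wpM2l // ltW.
  have maxD : Num.max `|h| `|D| <= `|h| + `|D|.
    by rewrite ge_max lerDl lerDr !normr_ge0.
  have Ce1 : C * e1 <= 2^-1.
    rewrite -ler_pdivlMl // /e1 ge_min.
    by apply/orP; left; rewrite invfM mulrC.
  have nDh : `|D| <= (2 * K + 1) * `|h|.
    have : `|D| <= `|L h| + 2^-1 * (`|h| + `|D|).
      rewrite -[X in `|X| <= _](subrK (L h)) addrC (le_trans (ler_normD _ _)) //.
      by rewrite lerD // (le_trans DL) // ler_pM ?mulr_ge0 ?(ltW C_gt0) ?(ltW e10) ?le_max ?normr_ge0.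
    by have := bK h; lra.
  rewrite (le_trans DL) //.
  have : C * e1 * Num.max `|h| `|D| <= C * (e / (C * c)) * (c * `|h|).
    apply: ler_pM; rewrite ?mulr_ge0 ?(ltW C_gt0) ?(ltW e10) ?le_max ?normr_ge0 //.
      by rewrite ler_wpM2l ?(ltW C_gt0) // /e1 ge_min lexx orbT.
    by rewrite (le_trans maxD) // /c; lra.
  move/le_trans; apply; rewrite le_eqVlt; apply/orP; left; apply/eqP.
  by field; rewrite ?gt_eqF.
split; first by have [] := D.
by move=> h; rewrite (@diff_val _ _ _ _ _ _ _ D) LP.
Qed.

(** ['d x s v] is characterized by ['d Phi (s, x s) (v, 'd x s v) = 0]; the
    operator in this equation is continuous in norm and invertible, so its
    solution is continuous in all data. *)
Lemma implicit_diff_continuous P E F (Phi : P * E -> F) (Om : set (P * E))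
    (O : set P) (x : P -> E) :
  open Om -> open O -> tsm 2 Om Phi ->
  (forall t, O t -> Om (t, x t)) ->
  (forall s, O s -> {for s, continuous x}) ->
  (forall s, O s -> forall h, 'd Phi (s, x s) (h, 'd x s h) = 0) ->
  (forall s, O s -> invertible_snd Phi (s, x s)) ->
  forall z, (O `*` [set: P]) z -> {for z, continuous (T x)}.
Proof.
move=> oOm oO tPhi xOm xc dx inv [s v] [/= Os _].
have [_ [C0 inj0]] := inv s Os.
set z := (s, x s) in inj0 *.
pose C := Num.max C0 1.
have C_gt0 : 0 < C by rewrite lt_max ltr01 orbT.
have inj y : `|y| <= C * `|'d Phi z (0, y)|.
  by rewrite (le_trans (inj0 y)) // ler_wpM2r // le_max lexx.
have bz := diff_blin (tPhi.1 _ (xOm _ Os)).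
have [M M0 bM] := blin_bound bz.
apply: eps_cont => e e0 /=.
set xi := 'd x s v.
pose a := `|v| + 1 + `|xi| + 1.
have a0 : 0 < a by rewrite !ltr_wpDl ?addr_ge0.
pose e1 := Num.min (2 * C)^-1 (e / (4 * C * a)).
have e10 : 0 < e1 by rewrite lt_min invr_gt0 mulr_gt0 // divr_gt0 // !mulr_gt0.
have [d d0 dP] := diff_norm_continuous oOm tPhi (xOm s Os) e10.
have [d1 d10 dP1] := cont_eps (xc s Os) d0.
have [d2 d20 dP2] := open_eps oO Os.
exists (Num.min (Num.min d d1) (Num.min d2 (Num.min 1 (e / (4 * C * M))))).
  by rewrite !lt_min d0 d10 d20 ltr01 divr_gt0 ?mulr_gt0.
move=> [h k] /=; rewrite prod_normE /= gt_max => /andP[hh kk].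
move: hh kk; rewrite !lt_min => /andP[/andP[hd hd1] /andP[hd2 _]].
move=> /andP[_ /andP[_ /andP[k1 kM]]].
set xi' := 'd x (s + h) (v + k).
set D := x (s + h) - x s.
have zh : (s + h, x (s + h)) = z + (h, D) by congr (_, _); rewrite /= [RHS]addrC subrK.
have := dP (h, D); rewrite prod_normE /= gt_max hd dP1 // => /(_ isT) [_].
rewrite -zh => /(_ (v + k, xi')).
rewrite (dx _ (dP2 _ hd2)) sub0r normrN => H1.
(* Subtracting the two equations isolates the difference of the solutions. *)
have H2 : 'd Phi z (0, xi' - xi) = 'd Phi z (v + k, xi') - 'd Phi z (k, 0).
  rewrite -linearB /=; apply/eqP; rewrite -subr_eq0 -linearB /=.
  have -> : (0, xi' - xi) - ((v + k, xi') - (k, 0)) = - (v, xi) :> P * E.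
    by congr (_, _) => /=; rewrite ?subr0 ?addrK ?sub0r // addrC addKr.
  by rewrite linearN /= dx // oppr0.
have H3 : `|xi' - xi| <= C * (e1 * (`|v| + 1 + `|xi'|) + M * `|k|).
  rewrite (le_trans (inj _)) // ler_wpM2l ?(ltW C_gt0) // H2 (le_trans (ler_normB _ _)) //.
  apply: lerD.
    rewrite (le_trans H1) // ler_wpM2l ?(ltW e10) // prod_normE /= ge_max.
    have := ler_normD v k; have := normr_ge0 xi'; have := normr_ge0 v; have := ltW k1.
    by move=> *; apply/andP; split; lra.
  by rewrite (le_trans (bM _)) // prod_normE /= normr0 max_l.
have H4 : `|xi'| <= `|xi| + `|xi' - xi|.
  by rewrite -[X in `|X| <= _](subrK xi) addrC (le_trans (ler_normD _ _)).
have H5 : C * e1 <= 2^-1.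
  rewrite -ler_pdivlMl // /e1 ge_min.
  by apply/orP; left; rewrite invfM mulrC.
have H6 : C * e1 * a <= e / 4.
  have : C * e1 * a <= C * (e / (4 * C * a)) * a.
    by rewrite ler_wpM2r ?(ltW a0) // ler_wpM2l ?(ltW C_gt0) // /e1 ge_min lexx orbT.
  move/le_trans; apply; rewrite le_eqVlt; apply/orP; left; apply/eqP.
  by field; rewrite ?gt_eqF.
have H7 : C * M * `|k| <= e / 4.
  rewrite mulrC -ler_pdivlMr ?mulr_gt0 //; apply: le_trans (ltW kM) _.
  rewrite le_eqVlt; apply/orP; left; apply/eqP; by field; rewrite ?gt_eqF.
have H8 : C * e1 * `|xi' - xi| <= 2^-1 * `|xi' - xi| by rewrite ler_wpM2r.
have H9 : C * e1 * `|xi'| <= C * e1 * (`|xi| + `|xi' - xi|).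
  by rewrite ler_wpM2l // mulr_ge0 ?ltW.
have H10 : C * e1 * (`|v| + 1 + `|xi|) <= C * e1 * a.
  by rewrite ler_wpM2l ?mulr_ge0 ?(ltW C_gt0) ?(ltW e10) // /a; lra.
move: H3 H6 H7 H8 H9 H10.
have -> : C * (e1 * (`|v| + 1 + `|xi'|) + M * `|k|) =
  C * e1 * (`|v| + 1) + C * e1 * `|xi'| + C * M * `|k| by ring.
move: (C * e1) => c; rewrite !mulrDr.
by move: (c * `|xi'|) (c * `|xi|) (c * `|xi' - xi|) (c * `|v|) (c * 1)
  (C * M * `|k|) (c * a) => *; lra.
Qed.

(** The partial differential of [(Phi, T Phi)] is block triangular with the
    partial differential of [Phi] twice on the diagonal. *)
Lemma invertible_tangent P E F (Phi : P * E -> F) (Om : set (P * E)) w :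
  open Om -> tsm 2 Om Phi -> Om (w.1.1, w.2.1) ->
  invertible_snd Phi (w.1.1, w.2.1) ->
  invertible_snd (fun w : (P * P) * (E * E) =>
    (Phi (w.1.1, w.2.1), 'd Phi (w.1.1, w.2.1) (w.1.2, w.2.2))) w.
Proof.
move=> oOm tPhi; case: w => [[s v] [x xi]] /= Omz [surj [C inj]].
have [dPhi [dT _]] := tPhi.
set z := (s, x) in Omz surj inj.
have bL1 : blin (fun w : (P * P) * (E * E) => (w.1.1, w.2.1)).
  apply: blin_pair.
    exact: (blin_comp (blin_fst _ _) (blin_fst _ _)).
  exact: (blin_comp (blin_snd _ _) (blin_fst _ _)).
have bL2 : blin (fun w : (P * P) * (E * E) => ((w.1.1, w.2.1), (w.1.2, w.2.2))).
  apply: blin_pair => //; apply: blin_pair.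
    exact: (blin_comp (blin_fst _ _) (blin_snd _ _)).
  exact: (blin_comp (blin_snd _ _) (blin_snd _ _)).
set w0 := ((s, v), (x, xi)).
have d1 := blin_diff w0 bL1; have d2 := blin_diff w0 bL2.
have dz : differentiable Phi z by exact: dPhi.
have dTz : differentiable (T Phi) (z, (v, xi)) by apply: dT.
have e1 : differentiable (Phi \o (fun w : (P * P) * (E * E) => (w.1.1, w.2.1))) w0.
  by apply: differentiable_comp => //; have [] := d1.
have e2 : differentiable ((T Phi) \o
   (fun w : (P * P) * (E * E) => ((w.1.1, w.2.1), (w.1.2, w.2.2)))) w0.
  by apply: differentiable_comp => //; have [] := d2.
have key y y' : 'd (fun w : (P * P) * (E * E) =>
    (Phi (w.1.1, w.2.1), 'd Phi (w.1.1, w.2.1) (w.1.2, w.2.2))) w0 (0, (y, y')) =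
    ('d Phi z (0, y), 'd (T Phi) (z, (v, xi)) ((0, y), 0) + 'd Phi z (0, y')).
  have -> := diff_pair e1 e2.
  rewrite [X in (X _, _)]diff_comp; [|by have [] := d1|exact: dz].
  rewrite [X in (_, X _)]diff_comp; [|by have [] := d2|exact: dTz].
  rewrite /= (@diff_val _ _ _ _ _ _ _ d1) (@diff_val _ _ _ _ _ _ _ d2) /=.
  congr (_, _).
  rewrite [X in 'd _ _ X]pair_split linearD /=; congr (_ + _).
  exact: (diff_tangent_snd _ _ oOm tPhi).
have bQ : blin (fun y : E => 'd (T Phi) (z, (v, xi)) ((0, y), 0)).
  apply: (@blin_comp _ _ _ _ (fun y : E => ((0 : P, y), 0 : P * E))).
    by apply: blin_pair; [exact: blin_inr | exact: blin_cst0].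
  exact: diff_blin.
have [M M0 bM] := blin_bound bQ.
split.
  move=> [g1 g2]; have [y yP] := surj g1.
  have [y' y'P] := surj (g2 - 'd (T Phi) (z, (v, xi)) ((0, y), 0)).
  by exists (y, y'); rewrite key yP y'P addrC subrK.
pose C' := Num.max C 1.
have C_gt0 : 0 < C' by rewrite lt_max ltr01 orbT.
have inj' y : `|y| <= C' * `|'d Phi z (0, y)|.
  by rewrite (le_trans (inj y)) // ler_wpM2r // le_max lexx.
exists (C' * (1 + M * C')) => -[y y']; rewrite key.
set g1 := 'd Phi z (0, y); set q := 'd (T Phi) _ _; set g2 := 'd Phi z (0, y').
rewrite [leRHS]mulrC.
set g := `|(g1, q + g2)|.
have n1 : `|g1| <= g by exact: normr_fst (g1, q + g2).
have n2 : `|q + g2| <= g by exact: normr_snd (g1, q + g2).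
have g0 : 0 <= g by exact: normr_ge0.
have ny : `|y| <= C' * g by rewrite (le_trans (inj' y)) // ler_wpM2l // ltW.
have nq : `|q| <= M * C' * g.
  by rewrite (le_trans (bM y)) // -mulrA ler_wpM2l // ltW.
have ng2 : `|g2| <= g + M * C' * g.
  rewrite -[g2](addKr q) addrC (le_trans (ler_normD _ _)) // normrN lerD //.
have ny' : `|y'| <= C' * (g + M * C' * g).
  by rewrite (le_trans (inj' y')) // ler_wpM2l // ltW.
have p0 : 0 <= C' * (M * C' * g) by rewrite !mulr_ge0 // ltW.
rewrite prod_normE /= ge_max; apply/andP; split.
  by rewrite (le_trans ny) //; move: p0; rewrite -subr_ge0 => p0; rewrite -subr_ge0;
    apply: le_trans p0 _; rewrite le_eqVlt; apply/orP; left; apply/eqP; ring.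
by rewrite (le_trans ny') // le_eqVlt; apply/orP; left; apply/eqP; ring.
Qed.

(** If [x] solves [Phi = 0], then [(x, Tx)] solves [(Phi, T Phi) = 0], over the
    same base points and with all directions allowed.  The statement for [k]
    applied to this larger problem is the statement for [k + 1], so the domain
    does not shrink with the order of differentiation. *)
Theorem implicit_tsm k : forall P E F (Phi : P * E -> F) (Om : set (P * E))
    (O : set P) (x : P -> E),
  open Om -> open O -> tsmooth Om Phi ->
  (forall s, O s -> [/\ Om (s, x s), Phi (s, x s) = 0,
     {for s, continuous x} & invertible_snd Phi (s, x s)]) ->
  tsm k O x.
Proof.
elim: k => [|k IH] P E F Phi Om O x oOm oO tPhi H.
  by move=> s /H[].
have dx s : O s -> differentiable x s /\
    forall h, 'd Phi (s, x s) (h, 'd x s h) = 0.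
  move=> Os; have [Omz _ xc inv] := H s Os.
  apply: (implicit_diff oO) => //; first by move=> t /H[].
  exact: (tPhi 1%N).1.
split; first by move=> s /dx[].
have oT := open_tangent oO.
suff pT : tsm k (O `*` [set: P]) (fun z : P * P => (x z.1, 'd x (z.1) (z.2))).
  exact: (tsm_postcomp oT (blin_snd _ _) pT).
have bL1 : blin (fun w : (P * P) * (E * E) => (w.1.1, w.2.1)).
  apply: blin_pair.
    exact: (blin_comp (blin_fst _ _) (blin_fst _ _)).
  exact: (blin_comp (blin_snd _ _) (blin_fst _ _)).
have bL2 : blin (fun w : (P * P) * (E * E) => ((w.1.1, w.2.1), (w.1.2, w.2.2))).
  apply: blin_pair => //; apply: blin_pair.
    exact: (blin_comp (blin_fst _ _) (blin_snd _ _)).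
  exact: (blin_comp (blin_snd _ _) (blin_snd _ _)).
pose Om' := (fun w : (P * P) * (E * E) => (w.1.1, w.2.1)) @^-1` Om.
have oOm' : open Om'.
  by apply: open_comp => // w _; exact: (blin_continuous bL1).
apply: (IH _ _ _ (fun w : (P * P) * (E * E) =>
    (Phi (w.1.1, w.2.1), 'd Phi (w.1.1, w.2.1) (w.1.2, w.2.2))) Om') => //.
  move=> j; apply: tsm_pair => //; first exact: (tsm_precomp oOm bL1 (tPhi j)).
  have := tsm_precomp (open_tangent oOm) bL2 (tPhi j.+1).2.
  by move=> K; apply: tsm_sub K => w.
move=> [s v] [/= Os _].
have [Omz Phi0 xc inv] := H s Os.
split => //.
- by rewrite /= Phi0 (dx s Os).2.
- apply: cvg_pair.
    by apply: (@continuous_comp _ _ _ fst x) => //; exact: blin_continuous (blin_fst _ _) _.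
  have xOm t : O t -> Om (t, x t) by move=> /H[].
  have xct t : O t -> {for t, continuous x} by move=> /H[].
  have inv' t : O t -> invertible_snd Phi (t, x t) by move=> /H[].
  have dx' t : O t -> forall h, 'd Phi (t, x t) (h, 'd x t h) = 0 by move=> /dx[].
  have Oz : (O `*` [set: P]) (s, v) by [].
  have cT := implicit_diff_continuous oOm oO (tPhi 2%N) xOm xct dx' inv' Oz.
  exact: cT.
- exact: (invertible_tangent oOm (tPhi 2%N)).
Qed.

End ImplicitRegularity.

(** * The Banach space of bounded continuous functions *)

Section BoundedContinuous.
Context {R : realType} (T : topologicalType) (Y : normedModType R).

Definition bounded_continuous : {pred T -> Y} :=
  fun f => `[< continuous f /\ exists M : R, forall t, `|f t| <= M >].

Record bcfun := BCFun { bcval :> T -> Y; bcvalP : bcval \in bounded_continuous }.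

HB.instance Definition _ := [isSub for bcval].
HB.instance Definition _ := [Choice of bcfun by <:].

Lemma bounded_continuous_submod : submod_closed bounded_continuous.
Proof.
split.
  by apply/asboolP; split; [move=> t; exact: cst_continuous|exists 0 => t; rewrite normr0].
move=> a f g /asboolP[fc [M fM]] /asboolP[gc [N gN]]; apply/asboolP; split.
  move=> t; apply: continuousD; last exact: gc.
  by apply: continuousZ; [exact: cst_continuous | exact: fc].
exists (`|a| * M + N) => t; rewrite (le_trans (ler_normD _ _)) // lerD //.
by rewrite normrZ ler_wpM2l.
Qed.

HB.instance Definition _ :=
  GRing.isSubmodClosed.Build R (T -> Y) bounded_continuous
    bounded_continuous_submod.
HB.instance Definition _ := [SubChoice_isSubLmodule of bcfun by <:].

Lemma bcfun_continuous (f : bcfun) : continuous f.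
Proof. by have /asboolP[] := bcvalP f. Qed.

Lemma bcfun_bounded (f : bcfun) : exists M : R, forall t, `|f t| <= M.
Proof. by have /asboolP[] := bcvalP f. Qed.

Lemma bcfunP (f g : bcfun) : (forall t, f t = g t) -> f = g.
Proof. by move=> fg; apply: val_inj; apply/funext. Qed.

Lemma bcfunZ (f : bcfun) (a : R) t : (a *: f : bcfun) t = a *: f t.
Proof. by []. Qed.

Lemma bcfunE (f g : bcfun) t :
  ((f + g : bcfun) t = f t + g t) * ((- f : bcfun) t = - f t) *
  ((f - g : bcfun) t = f t - g t).
Proof. by []. Qed.

(** The infimum of the bounds is the supremum norm, and it is also meaningful
    when the domain is empty. *)
Definition bcnorm (f : bcfun) : R :=
  inf [set M | 0 <= M /\ forall t, `|f t| <= M].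

Lemma bcnorm_set (f : bcfun) : [set M | 0 <= M /\ forall t, `|f t| <= M] !=set0.
Proof.
have [M fM] := bcfun_bounded f; exists (Num.max 0 M); split.
  by rewrite le_max lexx.
by move=> t; rewrite le_max fM orbT.
Qed.

Lemma bcnorm_ge0 (f : bcfun) : 0 <= bcnorm f.
Proof. by apply: lb_le_inf; [exact: bcnorm_set | move=> M []]. Qed.

Lemma bcnorm_ge (f : bcfun) t : `|f t| <= bcnorm f.
Proof. by apply: lb_le_inf; [exact: bcnorm_set | move=> M [_]]. Qed.

Lemma bcnorm_le (f : bcfun) M : 0 <= M -> (forall t, `|f t| <= M) -> bcnorm f <= M.
Proof. by move=> M0 fM; apply: ge_inf => //; exists 0 => ? []. Qed.

Lemma bcnormD (f g : bcfun) : bcnorm (f + g) <= bcnorm f + bcnorm g.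
Proof.
apply: bcnorm_le => [|t]; first by rewrite addr_ge0 ?bcnorm_ge0.
by rewrite bcfunE (le_trans (ler_normD _ _)) // lerD // bcnorm_ge.
Qed.

Lemma bcnormZ (a : R) (f : bcfun) : bcnorm (a *: f) = `|a| * bcnorm f.
Proof.
have le b (g : bcfun) : bcnorm (b *: g) <= `|b| * bcnorm g.
  apply: bcnorm_le => [|t]; first by rewrite mulr_ge0 ?bcnorm_ge0.
  by rewrite bcfunZ normrZ ler_wpM2l // bcnorm_ge.
apply/eqP; rewrite eq_le le /=.
have [->|a0] := eqVneq a 0; first by rewrite normr0 mul0r bcnorm_ge0.
rewrite -ler_pdivlMl ?normr_gt0 // -normfV.
by rewrite -[X in bcnorm X <= _](scalerK a0) le.
Qed.

Lemma bcnorm0_eq0 (f : bcfun) : bcnorm f = 0 -> f = 0.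
Proof.
move=> f0; apply: bcfunP => t; apply/eqP.
by rewrite -normr_le0 -f0 bcnorm_ge.
Qed.

HB.instance Definition _ :=
  Lmodule_isNormed.Build R bcfun bcnormD bcnormZ bcnorm0_eq0.

Lemma bcfun_norm_ge (f : bcfun) t : `|f t| <= `|f|.
Proof. exact: bcnorm_ge. Qed.

Lemma bcfun_norm_le (f : bcfun) (M : R) :
  0 <= M -> (forall t, `|f t| <= M) -> `|f| <= M.
Proof. exact: bcnorm_le. Qed.

Lemma blin_eval t : blin (fun f : bcfun => f t).
Proof. by split=> //; exists 1 => f; rewrite mul1r bcfun_norm_ge. Qed.

End BoundedContinuous.

HB.instance Definition _ (R : realType) m n :=
  Complete.copy 'M[R]_(m, n) 'M[R]_(m, n).

Section BoundedContinuousComplete.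
Context {R : realType} (T : topologicalType) (Y : completeNormedModType R).
Local Notation E := (bcfun T Y).

Lemma bcfun_complete (F : set_system E) : ProperFilter F -> cauchy F -> cvg F.
Proof.
move=> FF /cauchy_ballP Fc.
have small (e : R) : 0 < e -> exists2 A, F A &
    forall f g, A f -> A g -> `|f - g| <= e.
  move=> e0; have [[A B] /= [FA FB] AB] := Fc e e0.
  exists (A `&` B); first exact: filterI.
  move=> f g [Af _] [_ Bg]; have := AB (f, g) (conj Af Bg).
  by rewrite /= -ball_normE /= => /ltW.
have lim t : exists y : Y, (fun f : E => f t) @ F --> y.
  suff /cvg_ex[y yP] : cvg ((fun f : E => f t) @ F) by exists y.
  apply: cauchy_cvg; apply/cauchy_ballP => e e0.
  have e20 : 0 < e / 2 by rewrite divr_gt0.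
  have [A FA Ad] := small _ e20.
  exists ((fun f : E => f t) @` A, (fun f : E => f t) @` A).
    by split; apply: (@filterS _ F _ A) FA => f Af; exists f.
  move=> [_ _] [/= [f Af <-] [g Ag <-]]; rewrite -ball_normE /=.
  rewrite (le_lt_trans (bcfun_norm_ge (f - g) t)) // (le_lt_trans (Ad _ _ Af Ag)) //.
  by rewrite ltr_pdivrMr // ltr_pMr // ltr1n.
pose g t := projT1 (cid (lim t)).
have gP t : (fun f : E => f t) @ F --> g t by rewrite /g; case: cid.
have close A e : F A -> (forall f g, A f -> A g -> `|f - g| <= e) ->
    forall f t, A f -> `|f t - g t| <= e.
  move=> FA Ad f t Af; apply/ler_addgt0Pr => d d0.
  have /cvgrPdist_lt /(_ d d0) gd := gP t.
  have [h [Ah hd]] := @filter_ex _ F _ _ (filterI FA gd).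
  rewrite -(subrK (h t) (f t)) -addrA (le_trans (ler_normD _ _)) // lerD //.
    by rewrite (le_trans (bcfun_norm_ge (f - h) t)) // Ad.
  by rewrite distrC ltW.
have gc : continuous g.
  move=> t; apply/cvgrPdist_lt => e e0.
  have e30 : 0 < e / 3 by rewrite divr_gt0.
  have [A FA Ad] := small _ e30.
  have [f Af] := @filter_ex _ F _ _ FA.
  have /cvgrPdist_lt /(_ _ e30) := @bcfun_continuous _ _ _ f t.
  apply: filterS => u fu.
  have := close A _ FA Ad f t Af; have := close A _ FA Ad f u Af => h1 h2.
  rewrite distrC in h2.
  have -> : g t - g u = (g t - f t) + (f t - f u) + (f u - g u).
    by rewrite !addrA subrK subrK.
  have := ler_normD ((g t - f t) + (f t - f u)) (f u - g u).
  have := ler_normD (g t - f t) (f t - f u).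
  by lra.
have [A FA Ad] := small _ ltr01.
have [f Af] := @filter_ex _ F _ _ FA.
have gbc : g \in @bounded_continuous R T Y.
  apply/asboolP; split=> //; exists (`|f| + 1) => t.
  rewrite -[g t](subKr (f t)) (le_trans (ler_normB _ _)) // lerD //.
    exact: bcfun_norm_ge.
  exact: (close A _ FA Ad).
apply/cvg_ex; exists (BCFun gbc).
apply/cvgrPdist_le => e e0; have [B FB Bd] := small _ e0.
apply: filterS (FB) => h Bh; rewrite distrC; apply: bcfun_norm_le; first exact: ltW.
by move=> t; exact: (close B _ FB Bd).
Qed.

HB.instance Definition _ := Uniform_isComplete.Build E bcfun_complete.

End BoundedContinuousComplete.


(** * The mean value inequality *)

Section MeanValue.
Context {R : realType}.
Implicit Types V W : normedModType R.

(** The target is any normed space, so there is no point where the derivative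
    equals the difference quotient.  For every [e > 0] the set of [t] up to
    which [|phi s - phi 0| <= (M + e) s] holds is closed and can be extended at
    each of its points, so it reaches 1. *)
Lemma mean_value W (phi : R -> W) (M : R) :
  (forall t : R, 0 <= t <= 1 -> differentiable phi t /\ `|'d phi t 1| <= M) ->
  `|phi 1 - phi 0| <= M.
Proof.
move=> dphi; apply/ler_addgt0Pr => e e0.
have M0 : 0 <= M by apply: le_trans (dphi 0 _).2; rewrite ?lexx ?ler01.
(* Every point controls the growth on both sides of it, with slope [M + e]. *)
have loc t : 0 <= t <= 1 -> exists2 d : R, 0 < d & forall s,
    `|s - t| < d -> `|phi s - phi t| <= (M + e) * `|s - t|.
  move=> /dphi[dt Mt]; have [d d0 dP] := diff_eps dt e0.
  exists d => // s st; have := dP _ st; rewrite [t + _]addrC subrK => H.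
  have -> : phi s - phi t = (phi s - phi t - 'd phi t (s - t)) + 'd phi t (s - t).
    by rewrite subrK.
  rewrite (le_trans (ler_normD _ _)) // addrC mulrDl lerD //.
  rewrite -[X in 'd phi t X]mulr1 -[X in 'd phi t X]/((s - t) *: (1 : R)).
  by rewrite linearZ normrZ mulrC ler_wpM2r.
pose S := [set t : R | 0 <= t <= 1 /\
   forall s, 0 <= s <= t -> `|phi s - phi 0| <= (M + e) * s].
have S0 : S 0.
  split; first by rewrite lexx ler01.
  move=> s /andP[s0 s1]; have -> : s = 0 by apply/eqP; rewrite eq_le s0 s1.
  by rewrite subrr normr0 mulr0.
have Sb : ubound S 1 by move=> t [/andP[]].
have hS : has_sup S by split; [exists 0 | exists 1].
set c := sup S.
have c0 : 0 <= c by exact: (ub_le_sup (proj2 hS) S0).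
have c1 : c <= 1 by apply: ge_sup => //; exists 0.
have c01 : 0 <= c <= 1 by rewrite c0.
have below s : 0 <= s -> s < c -> `|phi s - phi 0| <= (M + e) * s.
  move=> s0 sc; have ds : 0 < c - s by rewrite subr_gt0.
  have [t [t01 tP]] := sup_adherent ds hS; rewrite -/c subKr => st.
  by apply: tP; rewrite s0 ltW.
have [d d0 dP] := loc c c01.
have Mc : 0 <= M + e by rewrite addr_ge0 // ltW.
have atc : `|phi c - phi 0| <= (M + e) * c.
  have [cz|cn0] := eqVneq c 0; first by rewrite cz subrr normr0 mulr0.
  have cp : 0 < c by rewrite lt_neqAle eq_sym cn0.
  pose s := Num.max 0 (c - d / 2).
  have s0 : 0 <= s by rewrite le_max lexx.
  have sc : s < c by rewrite gt_max cp ltrBlDr ltrDl divr_gt0.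
  have sd : `|s - c| < d.
    rewrite distrC gtr0_norm ?subr_gt0 // ltrBlDr -ltrBlDl lt_max; apply/orP; right.
    by rewrite ltrD2l ltrN2 ltr_pdivrMr // ltr_pMr // ltr1n.
  have H : `|phi c - phi s| <= (M + e) * (c - s).
    rewrite distrC -[X in _ * X]gtr0_norm ?subr_gt0 // [`|c - s|]distrC.
    exact: dP.
  rewrite -(subrK (phi s) (phi c)) -addrA (le_trans (ler_normD _ _)) //.
  by rewrite (le_trans (lerD H (below s s0 sc))) // -mulrDr subrK lexx.
have upto s : 0 <= s -> s < c + d -> `|phi s - phi 0| <= (M + e) * s.
  move=> s0 sd; have [sc|] := ltP s c; first exact: below.
  move=> cs; have := dP s; rewrite ger0_norm ?subr_ge0 // ltrBlDl => /(_ sd) H.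
  rewrite -(subrK (phi c) (phi s)) -addrA (le_trans (ler_normD _ _)) //.
  by rewrite (le_trans (lerD H atc)) // -mulrDr subrK.
have [|c1'] := ltP 1 (c + d); first by move=> /(upto 1 ler01); rewrite mulr1.
have Sc : S (c + d / 2).
  have dd : d / 2 < d by rewrite ltr_pdivrMr // ltr_pMr // ltr1n.
  have d20 : 0 < d / 2 by rewrite divr_gt0.
  split; first by rewrite addr_ge0 ?(ltW d20) //= (le_trans _ c1') // lerD2l ltW.
  by move=> s /andP[s0 sd]; apply: upto => //; rewrite (le_lt_trans sd) // ltrD2l.
have := ub_le_sup (proj2 hS) Sc; rewrite -/c gerDl leNgt divr_gt0 //.
Qed.

Lemma mean_value_segment V W (f : V -> W) x y (M : R) :
  (forall t : R, 0 <= t <= 1 -> differentiable f (x + t *: (y - x)) /\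
     `|'d f (x + t *: (y - x)) (y - x)| <= M) ->
  `|f y - f x| <= M.
Proof.
move=> H; pose g (t : R) := x + t *: (y - x).
have dg t : is_diff t g (fun s => s *: (y - x)).
  apply: (@diff_shift _ _ _ _ _ x) => //.
  exact: (bbilin_l _ (bbilin_scale V)).
have := @mean_value _ (f \o g) M; rewrite /= /g scale1r scale0r addr0 [x + (y - x)]addrC subrK.
apply=> t t01; have [df dM] := H t t01; have d1 := @ex_diff _ _ _ _ _ _ _ (dg t).
split; first exact: differentiable_comp.
by rewrite diff_comp //= (@diff_val _ _ _ _ _ _ _ (dg t)) scale1r.
Qed.

Lemma taylor_segment V W (f : V -> W) x h (M : R) :
  (forall t : R, 0 <= t <= 1 -> differentiable f (x + t *: h) /\
     `|'d f (x + t *: h) h - 'd f x h| <= M) ->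
  `|f (x + h) - f x - 'd f x h| <= M.
Proof.
move=> H; have dfx : differentiable f x.
  by have [] := H 0; rewrite ?lexx ?ler01 // scale0r addr0.
have bL := diff_blin dfx.
have dL y := blin_diff y bL.
have := @mean_value_segment _ _ (fun y => f y - 'd f x y) x (x + h) M.
rewrite [x + h]addrC addrK [h + x]addrC linearD /= => K.
have -> : f (x + h) - f x - 'd f x h =
    f (x + h) - ('d f x x + 'd f x h) - (f x - 'd f x x).
  by rewrite opprB opprD -[RHS]addrA addrACA addNr add0r addrA addrAC.
apply: K => t t01; have [df dM] := H t t01.
have dL' := @ex_diff _ _ _ _ _ _ _ (dL (x + t *: h)).
split; first exact: differentiableB.
by rewrite diffB //= (@diff_val _ _ _ _ _ _ _ (dL _)).
Qed.

End MeanValue.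

(** * Superposition operators *)

Section Superposition.
Context {R : realType}.
Implicit Types V W Y Z : normedModType R.

Lemma compact_bound (X : topologicalType) W (K : set X) (f : X -> W) :
  compact K -> (forall x, K x -> {for x, continuous f}) ->
  exists2 M : R, 0 <= M & forall x, K x -> `|f x| <= M.
Proof.
move=> cK fc.
have : compact (f @` K).
  apply: continuous_compact => //; apply: continuous_in_subspaceT => x.
  by rewrite inE; exact: fc.
move=> /compact_bounded[M [_ MP]]; exists (Num.max 0 (M + 1)).
  by rewrite le_max lexx.
move=> x Kx; apply: (MP (Num.max 0 (M + 1))); last by exists x.
by rewrite lt_max ltrDl ltr01 orbT.
Qed.

Lemma homogeneous_bound Z (p : Z -> R) (d M : R) : 0 < d ->
  (forall a x, p (a *: x) = `|a| * p x) ->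
  (forall x, `|x| <= d -> p x <= M) -> forall x, p x <= M / d * `|x|.
Proof.
move=> d0 hp pM x.
have [->|x0] := eqVneq x 0.
  have p0 : p 0 = 0 by have := hp 0 0; rewrite scale0r normr0 mul0r.
  by rewrite p0 normr0 mulr0.
have nx : 0 < `|x| by rewrite normr_gt0.
have c0 : 0 < d / `|x| by rewrite divr_gt0.
have := pM ((d / `|x|) *: x).
rewrite hp normrZ (gtr0_norm c0) divfK ?gt_eqF // lexx => /(_ isT).
by rewrite mulrAC ler_pdivrMr // mulrC -ler_pdivlMr // mulrAC.
Qed.

Lemma linear_funZ V W (f : V -> W) a x : linear f -> f (a *: x) = a *: f x.
Proof.
move=> lf; have f0 : f 0 = 0.
  by have := lf (-1) 0 0; rewrite scaler0 addr0 scaleN1r addNr.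
by have := lf a x 0; rewrite f0 !addr0.
Qed.

Context {T : topologicalType} (tau : T -> R).
Hypothesis tau_c : continuous tau.
Hypothesis tau01 : forall t, 0 < tau t <= 1.

(** The data of the operator sending [z] to
    [t |-> (tau t)^-1 h (A (e t z) + tau t B (e t z))].  Here [A] and [B] split a
    state into the part that is kept and the part that is scaled by the
    weight [tau].  The division by [tau] is compensated by the vanishing of
    [h] where the scaled part is zero ([superpos_0]).  The compact sets of [superpos_cpt]
    contain the whole path joining the weight to zero, uniformly in [t].
    All of these conditions are inherited by the tangent map of [h]. *)
Record superpos Y Z V (OmZ : set Z) (OmV : set V) (A B : V -> V) (e : T -> Z -> V)
    (h : V -> Y) : Prop := Superpos {
  superpos_oZ : open OmZ;
  superpos_oV : open OmV;
  superpos_A : blin A;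
  superpos_B : blin B;
  superpos_e : forall t, blin (e t);
  superpos_eb : exists2 M : R, 0 <= M & forall t z, `|e t z| <= M * `|z|;
  superpos_ec : forall z, continuous (e^~ z);
  superpos_V : forall M : R, compact [set v : V | `|v| <= M];
  superpos_cpt : forall z, OmZ z -> exists2 d : R, 0 < d &
    exists2 C, compact C /\ C `<=` OmV & forall x, `|x| <= d ->
      forall t (s : R), 0 <= s <= 1 ->
      C (A (e t (z + x)) + s *: B (e t (z + x)));
  superpos_h : tsmooth OmV h;
  superpos_0 : forall v, OmV (A v) -> h (A v) = 0 }.

Definition superpos_fun Y Z V (A B : V -> V) (e : T -> Z -> V) (h : V -> Y) (z : Z) (t : T) : Y :=
  (tau t)^-1 *: h (A (e t z) + tau t *: B (e t z)).

Definition superpos_op Y Z V (A B : V -> V) (e : T -> Z -> V) (h : V -> Y) (z : Z) :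
    bcfun T Y :=
  insubd (0 : bcfun T Y) (superpos_fun A B e h z).

Definition tpair V W (L : V -> W) (v : V * V) : W * W := (L v.1, L v.2).

Local Notation Tg h := (fun z => 'd h (z.1) (z.2)).

Lemma tau_gt0 t : 0 < tau t. Proof. by case/andP: (tau01 t). Qed.

(** Along the path [s |-> A v + s (tau t) B v], from a zero of [h] to the
    actual argument, the derivative carries a factor [tau t], which cancels
    the division by [tau t]. *)
Lemma superpos_bound Y Z V (OmZ : set Z) (OmV : set V) A B e (h : V -> Y) z :
  superpos OmZ OmV A B e h -> OmZ z ->
  exists2 d : R, 0 < d & exists2 M : R, 0 <= M &
    forall x, `|x| <= d -> forall t, `|superpos_fun A B e h (z + x) t| <= M.
Proof.
move=> H Oz; have [d d0 [C [cC CV] CP]] := superpos_cpt H Oz.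
have [Me Me0 eM] := superpos_eb H.
have [KB KB0 bB] := blin_bound (superpos_B H).
pose b := KB * (Me * (`|z| + d)).
have [M M0 MP] : exists2 M : R, 0 <= M & forall x,
    (C `*` [set v : V | `|v| <= b]) x -> `|'d h (x.1) (x.2)| <= M.
  apply: (compact_bound (f := Tg h)).
    by apply: compact_setX => //; exact: (superpos_V H).
  by move=> x [Cx _]; apply: (superpos_h H 1%N).2 => //; split=> //; exact: CV.
exists d => //; exists M => // x xd t.
set v := e t (z + x).
have vb : `|B v| <= b.
  rewrite (le_trans (bB _)) // ler_wpM2l ?(ltW KB0) // (le_trans (eM _ _)) //.
  by rewrite ler_wpM2l // (le_trans (ler_normD _ _)) // lerD2l.
have t0 := tau_gt0 t.
have A0 : h (A v) = 0.
  apply: (superpos_0 H); apply: CV.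
  by have := CP x xd t 0; rewrite scale0r addr0; apply; rewrite lexx ler01.
rewrite /superpos_fun -/v normrZ gtr0_norm ?invr_gt0 // ler_pdivrMl //.
rewrite -[h _]subr0 -A0; apply: mean_value_segment => s /andP[s0 s1].
rewrite [A v + _]addrC addrK scalerA.
have Cs : C (A v + (s * tau t) *: B v).
  apply: CP => //; rewrite mulr_ge0 ?(ltW t0) //=.
  by rewrite mulr_ile1 ?(ltW t0) //; case/andP: (tau01 t).
have dh := (superpos_h H 1%N).1 _ (CV _ Cs); split=> //.
rewrite (blinZ _ _ (diff_blin dh)) normrZ gtr0_norm // ler_wpM2l ?(ltW t0) //.
exact: (MP (_, _)).
Qed.

Lemma superpos_dom Y Z V (OmZ : set Z) (OmV : set V) A B e (h : V -> Y) z t :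
  superpos OmZ OmV A B e h -> OmZ z -> OmV (A (e t z) + tau t *: B (e t z)).
Proof.
move=> H Oz; have [d d0 [C [cC CV] CP]] := superpos_cpt H Oz; apply: CV.
have := CP 0; rewrite addr0; apply; first by rewrite normr0 ltW.
by case/andP: (tau01 t) => /ltW -> ->.
Qed.

Lemma superpos_bc Y Z V (OmZ : set Z) (OmV : set V) A B e (h : V -> Y) z :
  superpos OmZ OmV A B e h -> OmZ z ->
  superpos_fun A B e h z \in @bounded_continuous R T Y.
Proof.
move=> H Oz; apply/asboolP; split.
  move=> t; apply: (@continuousZ _ _ _ (fun t => (tau t)^-1)
    (fun t => h (A (e t z) + tau t *: B (e t z)))).
    by apply: cvgV; [rewrite gt_eqF // tau_gt0 | exact: tau_c].
  apply: (@continuous_comp _ _ _ (fun t => A (e t z) + tau t *: B (e t z)) h).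
    apply: continuousD.
      apply: (@continuous_comp _ _ _ (e^~ z) A); first exact: (superpos_ec H).
      exact: (blin_continuous (superpos_A H)).
    apply: continuousZ; first exact: tau_c.
    apply: (@continuous_comp _ _ _ (e^~ z) B); first exact: (superpos_ec H).
    exact: (blin_continuous (superpos_B H)).
  by apply: (superpos_h H 0%N); exact: superpos_dom H Oz.
have [d d0 [M M0 MP]] := superpos_bound H Oz; exists M => t.
by have := MP 0; rewrite addr0; apply; rewrite normr0 ltW.
Qed.

Lemma superpos_opE Y Z V (OmZ : set Z) (OmV : set V) A B e (h : V -> Y) z t :
  superpos OmZ OmV A B e h -> OmZ z -> superpos_op A B e h z t = superpos_fun A B e h z t.
Proof. by move=> H Oz; rewrite /superpos_op -[bcval _]/(\val _) val_insubd (superpos_bc H Oz). Qed.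

Lemma blin_tpair V W (L : V -> W) : blin L -> blin (tpair L).
Proof. exact: blin_tangent. Qed.

(** Differentiating [h (A v) = 0] along the range of [A] gives the vanishing
    condition for the tangent map; the compact sets are multiplied by balls of
    directions. *)
Lemma superpos_tangent Y Z V (OmZ : set Z) (OmV : set V) A B e (h : V -> Y) :
  superpos OmZ OmV A B e h ->
  superpos (OmZ `*` [set: Z]) (OmV `*` [set: V]) (tpair A) (tpair B)
      (fun t => tpair (e t)) (Tg h).
Proof.
move=> H; have [oZ oV bA bB be [Me Me0 eM] ec cV cpt hs h0] := H; split.
- exact: open_tangent.
- exact: open_tangent.
- exact: blin_tpair.
- exact: blin_tpair.
- by move=> t; exact: blin_tpair.
- exists Me => // t [z s]; rewrite prod_normE /= ge_max.
  apply/andP; split; rewrite (le_trans (eM _ _)) // ler_wpM2l //.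
    exact: normr_fst (z, s).
  exact: normr_snd (z, s).
- by move=> [z s] t; apply: cvg_pair; exact: ec.
- move=> M; rewrite (_ : mkset _ = [set v : V | `|v| <= M] `*` [set v : V | `|v| <= M]).
    exact: compact_setX.
  apply/seteqP; split=> -[v w] /=; rewrite prod_normE /= ge_max.
    by move/andP.
  by move=> [-> ->].
- move=> [z s] [/= Oz _]; have [d d0 [C [cC CV] CP]] := cpt z Oz.
  have [KA KA0 bKA] := blin_bound bA; have [KB KB0 bKB] := blin_bound bB.
  exists d => //; pose b := (KA + KB) * (Me * (`|s| + d)).
  exists (C `*` [set v : V | `|v| <= b]).
    split; first exact: compact_setX.
    by move=> [v w] [/= /CV ? _].
  move=> [x y]; rewrite prod_normE /= ge_max => /andP[xd yd] t r r01.
  split; first exact: CP.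
  case/andP: r01 => r0 r1 /=.
  rewrite (le_trans (ler_normD _ _)) // /b mulrDl.
  have ey : `|e t (s + y)| <= Me * (`|s| + d).
    rewrite (le_trans (eM _ _)) // ler_wpM2l // (le_trans (ler_normD _ _)) //.
    by rewrite lerD2l.
  apply: lerD; first by rewrite (le_trans (bKA _)) // ler_wpM2l ?(ltW KA0).
  rewrite normrZ ger0_norm // -[leRHS]mul1r; apply: ler_pM => //.
  by rewrite (le_trans (bKB _)) // ler_wpM2l ?(ltW KB0).
- by move=> k; exact: (hs k.+1).2.
- move=> [v w] [/= Ov _].
  have bAd := blin_diff v bA; have dA := @ex_diff _ _ _ _ _ _ _ bAd.
  have dh : differentiable h (A v) by exact: (hs 1%N).1.
  have := diff_comp dA dh => /(congr1 (fun g => g w)) /=.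
  rewrite (@diff_val _ _ _ _ _ _ _ bAd) => <-.
  have : is_diff v (h \o A) ('d (cst (0 : Y)) v).
    apply: near_eq_diff; last exact: differentiable_cst.
    have oA : open (A @^-1` OmV).
      by apply: open_comp => // y _; exact: (blin_continuous bA).
    apply: filterS (open_nbhs_nbhs (conj oA Ov)) => y /= Oy.
    by rewrite h0.
  by move=> D; rewrite (@diff_val _ _ _ _ _ _ _ D) diff_cst.
Qed.

Lemma superpos_tangent_lin Y Z V (OmZ : set Z) (OmV : set V) A B e (h : V -> Y) z t :
  superpos OmZ OmV A B e h -> OmZ z ->
  linear (fun s => superpos_fun (tpair A) (tpair B) (fun t => tpair (e t)) (Tg h) (z, s) t).
Proof.
move=> H Oz a x y; rewrite /superpos_fun /=.
rewrite ((superpos_e H t).1 a) ((superpos_A H).1 a) ((superpos_B H).1 a).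
rewrite scalerDr scalerA mulrC -scalerA addrACA -scalerDr linearP /=.
by rewrite scalerDr !scalerA mulrC.
Qed.

(** [superpos_bound] applied to the tangent data, made homogeneous in the
    direction. *)
Lemma superpos_tangent_bound Y Z V (OmZ : set Z) (OmV : set V) A B e (h : V -> Y) z :
  superpos OmZ OmV A B e h -> OmZ z ->
  exists2 d : R, 0 < d & exists2 M : R, 0 <= M &
    forall x, `|x| <= d -> OmZ (z + x) /\ forall s t,
    `|superpos_fun (tpair A) (tpair B) (fun t => tpair (e t)) (Tg h) (z + x, s) t|
      <= M * `|s|.
Proof.
move=> H Oz; have HT := superpos_tangent H.
have [d d0 [M M0 MP]] := superpos_bound HT (conj Oz I : (OmZ `*` [set: Z]) (z, 0)).
have [d' d'0 d'P] := open_eps (superpos_oZ H) Oz.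
exists (Num.min d (d' / 2)); first by rewrite lt_min d0 divr_gt0.
exists (M / d); first by rewrite divr_ge0 // ltW.
move=> x; rewrite le_min => /andP[xd xd'].
have Ox : OmZ (z + x).
  by apply: d'P; rewrite (le_lt_trans xd') // ltr_pdivrMr // ltr_pMr // ltr1n.
split=> // s t; move: s; apply: homogeneous_bound => //.
  by move=> a s; rewrite (linear_funZ _ _ (superpos_tangent_lin t H Ox)) normrZ.
move=> s sd; have := MP (x, s); rewrite prod_normE /= ge_max xd sd => /(_ isT t).
by rewrite -[(z, 0) + (x, s)]/(z + x, 0 + s) add0r.
Qed.

Lemma superpos_segment Y Z V (OmZ : set Z) (OmV : set V) A B e (h : V -> Y) z x t (s : R) :
  superpos OmZ OmV A B e h ->
  A (e t (z + s *: x)) + tau t *: B (e t (z + s *: x)) =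
  A (e t z) + tau t *: B (e t z) + s *: (A (e t x) + tau t *: B (e t x)).
Proof.
move=> H; rewrite addrC [z + _]addrC ((superpos_e H t).1 s) ((superpos_A H).1 s) ((superpos_B H).1 s).
rewrite scalerDr scalerDr !scalerA [s * _]mulrC addrC.
by rewrite addrACA addrC.
Qed.

(** The mean value inequality, with the derivative bounded uniformly in [t]
    by [superpos_tangent_bound]. *)
Lemma superpos_lip Y Z V (OmZ : set Z) (OmV : set V) A B e (h : V -> Y) z :
  superpos OmZ OmV A B e h -> OmZ z ->
  exists2 d : R, 0 < d & exists2 M : R, 0 <= M &
    forall x y, `|x| <= d -> `|y| <= d -> forall t,
    `|superpos_fun A B e h (z + x) t - superpos_fun A B e h (z + y) t| <= M * `|x - y|.
Proof.
move=> H Oz; have [d d0 [M M0 MP]] := superpos_tangent_bound H Oz.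
exists d => //; exists M => // x y xd yd t.
have t0 := tau_gt0 t.
rewrite /superpos_fun -scalerBr normrZ gtr0_norm ?invr_gt0 // ler_pdivrMl //.
have E := superpos_segment (z + y) (x - y) t _ H.
have Ex : A (e t (z + x)) + tau t *: B (e t (z + x)) =
    A (e t (z + y)) + tau t *: B (e t (z + y)) +
    (A (e t (x - y)) + tau t *: B (e t (x - y))).
  have -> : z + x = z + y + (x - y) by rewrite -addrA [y + _]addrC subrK.
  by have := E 1; rewrite !scale1r.
apply: mean_value_segment => s /andP[s0 s1].
rewrite Ex [X in X - _]addrC addrK -E -addrA.
have xy : `|y + s *: (x - y)| <= d.
  have -> : y + s *: (x - y) = s *: x + (1 - s) *: y.
    by rewrite scalerBr scalerBl scale1r addrCA addrA.
  rewrite (le_trans (ler_normD _ _)) // !normrZ ger0_norm // ger0_norm ?subr_ge0 //.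
  have : s * `|x| + (1 - s) * `|y| <= s * d + (1 - s) * d.
    by rewrite lerD // ler_wpM2l // subr_ge0.
  by move=> /le_trans; apply; rewrite -mulrDl [s + _]addrC subrK mul1r.
have [Oxy bd] := MP _ xy.
have dh : differentiable h (A (e t (z + (y + s *: (x - y)))) +
    tau t *: B (e t (z + (y + s *: (x - y))))).
  by apply: (superpos_h H 1%N).1; exact: superpos_dom H Oxy.
split=> //; have := bd (x - y) t; rewrite /superpos_fun /= normrZ.
by rewrite gtr0_norm ?invr_gt0 // ler_pdivrMl.
Qed.

(** Pointwise in [t] the remainder is bounded by the variation of the
    differential along a segment; [superpos_lip] for the tangent data bounds this
    by a constant times [|x|^2], uniformly in [t]. *)
Lemma superpos_diff Y Z V (OmZ : set Z) (OmV : set V) A B e (h : V -> Y) z :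
  superpos OmZ OmV A B e h -> OmZ z ->
  is_diff z (superpos_op A B e h)
    (fun s => superpos_op (tpair A) (tpair B) (fun t => tpair (e t)) (Tg h) (z, s)).
Proof.
move=> H Oz; have HT := superpos_tangent H.
have Tz s : (OmZ `*` [set: Z]) (z, s) by [].
have [d1 d10 [M1 M10 MP1]] := superpos_tangent_bound H Oz.
have [d2 d20 [M2 M20 MP2]] := superpos_lip HT (Tz 0).
apply: eps_diff.
  split.
    move=> a x y; apply: bcfunP => t; rewrite bcfunE bcfunZ !(superpos_opE _ HT) //.
    exact: superpos_tangent_lin H Oz _ _ _.
  exists M1 => s; apply: bcfun_norm_le; first by rewrite mulr_ge0.
  move=> t; rewrite (superpos_opE _ HT) //.
  by have := (MP1 0 _).2 s t; rewrite addr0; apply; rewrite normr0 ltW.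
move=> eps eps0.
pose M := M2 + 1; have M_gt0 : 0 < M by rewrite ltr_wpDl.
exists (Num.min (Num.min d1 d2) (eps * d2 / M)).
  by rewrite !lt_min d10 d20 divr_gt0 // mulr_gt0.
move=> x; rewrite !lt_min => /andP[/andP[/ltW xd1 /ltW xd2] /ltW xe].
apply: bcfun_norm_le; first by rewrite mulr_ge0 // ltW.
move=> t; rewrite [X in `|X|](_ : _ = superpos_fun A B e h (z + x) t - superpos_fun A B e h z t -
    superpos_fun (tpair A) (tpair B) (fun t => tpair (e t)) (Tg h) (z, x) t); last first.
  have K := superpos_opE t HT (Tz x); have Ozx := (MP1 x xd1).1.
  by rewrite -K -(superpos_opE t H Oz) -(superpos_opE t H Ozx).
have t0 := tau_gt0 t.
rewrite /superpos_fun /= -!scalerBr normrZ gtr0_norm ?invr_gt0 // ler_pdivrMl //.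
have E := superpos_segment z x t _ H.
have := E 1; rewrite !scale1r => ->.
apply: taylor_segment => s /andP[s0 s1]; rewrite -E.
have sx : `|s *: x| <= `|x| by rewrite normrZ ger0_norm // ler_piMl.
have Os : OmZ (z + s *: x) by apply: (MP1 _ _).1; exact: le_trans sx xd1.
split; first by apply: (superpos_h H 1%N).1; exact: superpos_dom H Os.
have key : `|superpos_fun (tpair A) (tpair B) (fun t => tpair (e t)) (Tg h) (z + s *: x, x) t
   - superpos_fun (tpair A) (tpair B) (fun t => tpair (e t)) (Tg h) (z, x) t|
   <= (M2 * `|x|) / d2 * `|x|.
  pose p y := `|superpos_fun (tpair A) (tpair B) (fun t => tpair (e t)) (Tg h) (z + s *: x, y) t
   - superpos_fun (tpair A) (tpair B) (fun t => tpair (e t)) (Tg h) (z, y) t|.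
  apply: (@homogeneous_bound _ p) => //.
    move=> a y; rewrite /p.
    rewrite (linear_funZ _ _ (superpos_tangent_lin t H Os)).
    rewrite (linear_funZ _ _ (superpos_tangent_lin t H Oz)).
    by rewrite -scalerBr normrZ.
  move=> y yd; rewrite /p.
  have := MP2 (s *: x, y) (0, y); rewrite !prod_normE /= !ge_max normr0 yd.
  rewrite (le_trans sx xd2) (ltW d20) => /(_ isT isT t).
  rewrite -[(z, 0) + (s *: x, y)]/(z + s *: x, 0 + y).
  rewrite -[(z, 0) + (0, y)]/(z + 0, 0 + y) !add0r !addr0 => /le_trans; apply.
  rewrite ler_wpM2l // subr0 subrr normr0 max_l //.
move: key; rewrite /superpos_fun /= -scalerBr normrZ gtr0_norm ?invr_gt0 //.
rewrite ler_pdivrMl // => /le_trans; apply; rewrite ler_wpM2l ?(ltW t0) //.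
rewrite ler_wpM2r // ler_pdivrMr //.
have : M2 * `|x| <= M * `|x| by rewrite ler_wpM2r // /M lerDl.
move=> /le_trans; apply.
by move: xe; rewrite ler_pdivlMr // mulrC.
Qed.

(** The tangent map of the operator of [h] is the operator of the tangent map
    of [h]. *)
Lemma superpos_tsm k : forall Y Z V (OmZ : set Z) (OmV : set V) A B e (h : V -> Y),
  superpos OmZ OmV A B e h -> tsm k OmZ (superpos_op A B e h).
Proof.
elim: k => [|k IH] Y Z V OmZ OmV A B e h H.
  by move=> z Oz; apply: differentiable_continuous; have [] := superpos_diff H Oz.
split; first by move=> z Oz; have [] := superpos_diff H Oz.
apply: (@tsm_ext _ _ _ _ _
   (superpos_op (tpair A) (tpair B) (fun t => tpair (e t)) (Tg h))).
- exact: open_tangent (superpos_oZ H).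
- move=> [z s] [Oz _]; apply: esym.
  exact: (congr1 (fun g => g s) (@diff_val _ _ _ _ _ _ _ (superpos_diff H Oz))).
- by apply: IH; exact: superpos_tangent H.
Qed.

End Superposition.

(** * Scalar linear equations on a half-line *)

Section LinearODE.
Context {R : realType}.
Implicit Types W : normedModType R.

Lemma is_derive1_diff W (f : R -> W) (y : R) d :
  is_derive y 1 f d <-> is_diff y f (fun h : R => h *: d).
Proof.
split=> -[df dE].
  have df' : differentiable f y by exact/derivable1_diffP.
  by apply: DiffDef => //; rewrite deriv1E // derive1E dE.
apply: DeriveDef; first exact/derivable1_diffP.
by rewrite deriveE // dE scale1r.
Qed.

Lemma is_derive_expRM (a y : R) :
  is_derive y 1 (fun t => expR (a * t)) (a * expR (a * y)).
Proof.
have h : is_derive y 1 ( *%R a) a.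
  apply/is_derive1_diff; apply: (@diff_shift _ _ _ _ _ 0).
    exact: (bbilin_l _ (bbilin_scale R^o)).
  by move=> t; rewrite add0r mulrC.
have e : is_derive (a * y) 1 (@expR R) (expR (a * y)).
  apply: DeriveDef; first exact: derivable_expR.
  exact: (congr1 (fun g => g (a * y)) (derive_expR R)).
by rewrite mulrC; exact: is_derive1_comp.
Qed.

Lemma continuous_expRM (a : R) : continuous (fun t => expR (a * t)).
Proof.
move=> t; have [/derivable1_diffP d _] := is_derive_expRM a t.
exact: differentiable_continuous.
Qed.

Lemma nincr_halfline (m m' : R -> R) : continuous m ->
  (forall y : R, 0 < y -> is_derive y 1 m (m' y)) ->
  (forall y : R, 0 < y -> m' y <= 0) ->
  forall x y : R, 0 <= x -> x <= y -> m y <= m x.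
Proof.
move=> mc dm m0; apply: ler0_derive1_nincry.
- by move=> x; rewrite in_itv /= andbT => /dm[].
- by move=> x; rewrite in_itv /= andbT derive1E => x0; have [_ ->] := dm x x0; exact: m0.
- exact: continuous_subspaceT.
Qed.

Lemma exp_weight_derive (nu k y g : R) (x : R -> R) :
  is_derive y 1 x (nu * x y + g) ->
  is_derive y 1 (fun t => expR (- nu * t) * (x t - k)) (expR (- nu * y) * (g + nu * k)).
Proof.
move=> dx; have de := is_derive_expRM (- nu) y.
have dxk : is_derive y 1 (fun t => x t - k) (nu * x y + g - 0).
  by apply: is_deriveB.
apply: (is_derive_eq (is_deriveM de dxk)).
by rewrite -![_ *: _]/(_ * _); ring.
Qed.

(** Multiplying [x - k] by [exp (- nu y)] yields a monotone function, because
    [nu k] dominates the forcing term.  For [nu < 0] it is nonpositive at 0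
    and nonincreasing; for [nu > 0] it is nondecreasing, and tends to 0 since
    [x] is bounded. *)
Lemma linear_ode_upper (nu c s : R) (x g : R -> R) : nu != 0 -> continuous x ->
  (forall y : R, 0 < y -> is_derive y 1 x (nu * x y + g y)) ->
  (forall y : R, 0 < y -> `|g y| <= c) ->
  (nu < 0 -> x 0 <= s) ->
  (0 < nu -> exists M : R, forall y : R, 0 <= y -> x y <= M) ->
  forall y : R, 0 <= y -> x y <= Num.max s (c / `|nu|).
Proof.
move=> nu0 xc dx gc xs xM y y0.
set k := Num.max s _.
pose m (t : R) : R := expR (- nu * t) * (x t - k).
have mc : continuous m.
  move=> t; apply: (@continuousM _ _ (fun t => expR (- nu * t)) (fun t => x t - k)).
    exact: continuous_expRM.
  by apply: (@continuousB _ _ _ x (cst k)); [exact: xc | exact: cst_continuous].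
have dm (t : R) : 0 < t -> is_derive t 1 m (expR (- nu * t) * (g t + nu * k)).
  by move=> t0; apply: exp_weight_derive; exact: dx.
have nn : 0 < `|nu| by rewrite normr_gt0.
have kc : c <= `|nu| * k.
  by rewrite mulrC -ler_pdivrMr // /k le_max lexx orbT.
rewrite -subr_le0 -(pmulr_rle0 _ (expR_gt0 (- nu * y))).
have [nup|nun] := ltP 0 nu; last first.
  have nul : nu < 0 by rewrite lt_neqAle nu0.
  apply: le_trans (nincr_halfline mc dm _ (lexx 0) y0) _.
    move=> t t0; rewrite pmulr_rle0 ?expR_gt0 //.
    have := gc t t0; move: kc; rewrite ltr0_norm // ler_norml => kc /andP[_ gt].
    by rewrite -subr_ge0 in kc; rewrite -oppr_ge0; move: gt kc => *; lra.
  rewrite /m pmulr_rle0 ?expR_gt0 // subr_le0.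
  by rewrite (le_trans (xs nul)) // /k le_max lexx.
have [M xM'] := xM nup.
rewrite leNgt; apply/negP => mpos.
have mN (t : R) : is_derive t 1 m (expR (- nu * t) * (g t + nu * k)) ->
    is_derive t 1 (fun t => - m t) (- (expR (- nu * t) * (g t + nu * k))).
  by move=> dmt; apply: is_deriveN.
have mNc : continuous (fun t => - m t).
  by move=> t; apply: continuousN; exact: mc.
have incr (z : R) : y <= z -> m y <= m z.
  move=> yz; rewrite -lerN2.
  apply: (nincr_halfline mNc (fun t t0 => mN t (dm t t0))) => // t t0.
  rewrite oppr_le0 mulr_ge0 ?expR_ge0 //.
  have := gc t t0; move: kc; rewrite gtr0_norm // ler_norml => kc /andP[gt _].
  by lra.
pose M' := Num.max (M - k) 1.
have M'0 : 0 < M' by rewrite lt_max ltr01 orbT.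
rewrite -/(m y) in mpos.
(* At this [z] the bound [M' exp (- nu z) <= M' / (1 + nu z)] falls below [m y]. *)
pose z := Num.max y (M' / (nu * m y)).
have yz : y <= z by rewrite le_max lexx.
have z0 : 0 <= z by exact: le_trans y0 yz.
have mz : m z <= (expR (nu * z))^-1 * M'.
  rewrite /m mulNr expRN ler_wpM2l ?invr_ge0 ?expR_ge0 //.
  by rewrite /M' le_max lerD2r xM'.
have ez : 1 + nu * z <= expR (nu * z) by exact: expR_ge1Dx.
have H : m y * (1 + nu * z) <= M'.
  have := le_trans (incr z yz) mz; rewrite mulrC ler_pdivlMr ?expR_gt0 //.
  by apply: le_trans; rewrite ler_wpM2l // ltW.
have zM : M' / (nu * m y) <= z by rewrite le_max lexx orbT.
move: zM; rewrite (ler_pdivrMr _ _ (mulr_gt0 nup mpos)) => zM.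
have : z * (nu * m y) = m y * (nu * z) by ring.
by rewrite mulrDr mulr1 in H; move=> E; lra.
Qed.

Lemma linear_ode_bound (nu c s : R) (x g : R -> R) : nu != 0 -> continuous x ->
  (forall y : R, 0 < y -> is_derive y 1 x (nu * x y + g y)) ->
  (forall y : R, 0 < y -> `|g y| <= c) ->
  (nu < 0 -> `|x 0| <= s) ->
  (0 < nu -> exists M : R, forall y : R, 0 <= y -> `|x y| <= M) ->
  forall y : R, 0 <= y -> `|x y| <= Num.max s (c / `|nu|).
Proof.
move=> nu0 xc dx gc xs xM y y0; rewrite ler_norml lerNl; apply/andP; split.
  apply: (@linear_ode_upper nu c s (fun t => - x t) (fun t => - g t)) => //.
  - by move=> t; apply: continuousN; exact: xc.
  - move=> t t0; apply: (is_derive_eq (is_deriveN (dx t t0))).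
    by rewrite opprD mulrN.
  - by move=> t t0; rewrite normrN gc.
  - by move=> /xs; rewrite ler_norml lerNl => /andP[].
  - move=> /xM[M xM']; exists M => t /xM'; by rewrite ler_norml lerNl => /andP[].
apply: (@linear_ode_upper nu c s x g) => //.
  by move=> /xs; rewrite ler_norml => /andP[].
by move=> /xM[M xM']; exists M => t /xM'; rewrite ler_norml => /andP[].
Qed.

(** Starting the integral at -1 makes the antiderivative differentiable at 0
    as well. *)
Lemma antiderivative (f : R -> R) : continuous f ->
  exists F : R -> R, forall y : R, -1 < y -> is_derive y 1 F (f y).
Proof.
move=> fc.
exists (fun y => \int[@lebesgue_measure R]_(t in `[-1, y]) f t)%R => y y1.
have int : (@lebesgue_measure R).-integrable `[-1, y + 1] (EFin \o f).
  apply: continuous_compact_integrable; first exact: segment_compact.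
  exact: continuous_subspaceT.
have yy : y < y + 1 by rewrite ltrDl.
have [d dE] := continuous_FTC1_closed yy int y1 (fc y).
by apply: DeriveDef; [exact: d | rewrite -derive1E; exact: dE].
Qed.

Lemma continuous_max0 : continuous (fun y : R => Num.max y 0).
Proof.
by move=> y; apply: continuous_max; [exact: cvg_id | exact: cst_continuous].
Qed.

Lemma near_max0 W (f : R -> W) (y : R) d : 0 < y -> is_derive y 1 f d ->
  is_derive y 1 (fun t => f (Num.max t 0)) d.
Proof.
  move=> y0 df; apply: (near_eq_is_derive _ df).
near=> t; rewrite max_l //; apply: ltW; near: t; exact: lt_nbhsr.
Unshelve. all: by end_near. Qed.

(** Variation of constants.  For [nu > 0] the constant must be minus the
    integral of [exp (- nu t) g t] over the whole half-line, for the solution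
    to stay bounded.  This number is obtained as the supremum of the lower
    bounds [Q y], which lie below all upper bounds [P y].  The solution is
    extended by a constant to the negative half-line. *)
Lemma linear_ode_exists (nu s c : R) (g : R -> R) : nu != 0 -> continuous g ->
  (forall y : R, `|g y| <= c) ->
  exists x : R -> R, [/\ continuous x,
    forall y : R, 0 < y -> is_derive y 1 x (nu * x y + g y),
    forall y : R, y <= 0 -> x y = x 0,
    nu < 0 -> x 0 = s &
    exists M : R, forall y : R, `|x y| <= M].
Proof.
move=> nu0 gc gM.
have [F FP] : exists F : R -> R,
    forall y : R, -1 < y -> is_derive y 1 F (expR (- nu * y) * g y).
  apply: antiderivative => y.
  apply: (@continuousM _ _ (fun t => expR (- nu * t)) g); last exact: gc.
  exact: continuous_expRM.
pose X (K y : R) : R := expR (nu * y) * (F y + K).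
have dX (K y : R) : -1 < y -> is_derive y 1 (X K) (nu * X K y + g y).
  move=> y1; have de := is_derive_expRM nu y.
  have dF : is_derive y 1 (fun t => F t + K) (expR (- nu * y) * g y + 0).
    by apply: is_deriveD; exact: FP.
  apply: (is_derive_eq (is_deriveM de dF)); rewrite -![_ *: _]/(_ * _) addr0.
  rewrite mulrA -expRD mulNr subrr expR0 mul1r addrC; congr (_ + _).
  by rewrite /X; ring.
pose x (K y : R) : R := X K (Num.max y 0).
have xc (K : R) : continuous (x K).
  move=> y; suff H : {for y, continuous (X K \o (fun y : R => Num.max y 0))} by exact: H.
  apply: continuous_comp; first exact: continuous_max0.
  apply: differentiable_continuous; apply/derivable1_diffP.
  have y1 : -1 < Num.max y 0 by rewrite lt_max ltrN10 orbT.
  by have [] := dX K _ y1.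
have dx (K y : R) : 0 < y -> is_derive y 1 (x K) (nu * x K y + g y).
  move=> y0; have xX : x K y = X K y by rewrite /x max_l // ltW.
  by rewrite xX; apply: near_max0 => //; apply: dX; exact: lt_trans (ltrN10 _) y0.
have xneg (K y : R) : y <= 0 -> x K y = x K 0 by move=> y0; rewrite /x maxxx max_r.
have x0 (K : R) : x K 0 = F 0 + K by rewrite /x maxxx /X mulr0 expR0 mul1r.
have fin (K M : R) : (forall y : R, 0 <= y -> `|x K y| <= M) -> forall y : R, `|x K y| <= M.
  move=> xM y; have [/xM //|/ltW y0] := leP 0 y.
  by rewrite xneg // xM.
have [nup|nun] := ltP 0 nu; last first.
  have nul : nu < 0 by rewrite lt_neqAle nu0.
  exists (x (s - F 0)); split.
  - exact: xc.
  - exact: dx.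
  - exact: xneg.
  - by rewrite x0 addrC subrK.
  - exists (Num.max `|s| (c / `|nu|)); apply: fin.
    apply: (linear_ode_bound nu0 (xc _) (dx _)) => //.
      by move=> _; rewrite x0 addrC subrK.
    by rewrite ltNge nun.
have c0 : 0 <= c by exact: le_trans (gM 0).
pose E (y : R) : R := c / nu * expR (- nu * y).
have E0 (y : R) : 0 <= E y by rewrite mulr_ge0 ?expR_ge0 // divr_ge0 // ltW.
have Fc (y : R) : {for Num.max y 0, continuous F}.
  apply: differentiable_continuous; apply/derivable1_diffP.
  have y1 : -1 < Num.max y 0 by rewrite lt_max ltrN10 orbT.
  by have [] := FP _ y1.
have Ec : continuous E.
  move=> t; apply: (@continuousM _ _ (cst (c / nu)) (fun t => expR (- nu * t))).
    exact: cst_continuous.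
  exact: continuous_expRM.
pose P (y : R) : R := F (Num.max y 0) + E y; pose Q (y : R) : R := F (Num.max y 0) - E y.
have FMc : continuous (fun y : R => F (Num.max y 0)).
  move=> y; suff H : {for y, continuous (F \o (fun y : R => Num.max y 0))} by exact: H.
  by apply: continuous_comp; [exact: continuous_max0 | exact: Fc].
have dE (y : R) : is_derive y 1 E (- (expR (- nu * y) * c)).
  have := is_deriveZ (c / nu) (is_derive_expRM (- nu) y).
  move=> H; apply: (is_derive_eq H); rewrite -![_ *: _]/(_ * _).
  by field.
have decP (a b' : R) : 0 <= a -> a <= b' -> P b' <= P a.
  apply: (@nincr_halfline P (fun y : R => expR (- nu * y) * (g y - c))).
  - by move=> t; apply: (@continuousD _ _ _ (fun y : R => F (Num.max y 0)) E); [exact: FMc | exact: Ec].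
  - move=> t t0; have := FP t (lt_trans (ltrN10 _) t0) => /(near_max0 t0) dFt.
    by apply: (is_derive_eq (is_deriveD dFt (dE t))); rewrite mulrBr.
  - move=> t t0; rewrite pmulr_rle0 ?expR_gt0 // subr_le0.
    by have := gM t; rewrite ler_norml => /andP[].
have incQ (a b' : R) : 0 <= a -> a <= b' -> - Q b' <= - Q a.
  apply: (@nincr_halfline (fun y : R => - Q y) (fun y : R => - (expR (- nu * y) * (g y + c)))).
  - move=> t; apply: continuousN; apply: (@continuousB _ _ _ (fun y : R => F (Num.max y 0)) E);
      [exact: FMc | exact: Ec].
  - move=> t t0; have := FP t (lt_trans (ltrN10 _) t0) => /(near_max0 t0) dFt.
    apply: (is_derive_eq (is_deriveN (is_deriveB dFt (dE t)))).
    by rewrite opprK mulrDr.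
  - move=> t t0; rewrite oppr_le0 mulr_ge0 ?expR_ge0 //.
    by have := gM t; rewrite ler_norml => /andP[]; lra.
have QP (a b' : R) : 0 <= a -> 0 <= b' -> Q a <= P b'.
  move=> a0 b0; pose z := Num.max a b'.
  have az : a <= z by rewrite le_max lexx.
  have bz : b' <= z by rewrite le_max lexx orbT.
  have := incQ a z a0 az; have := decP b' z b0 bz; rewrite lerN2.
  have : Q z <= P z by rewrite /Q /P; have := E0 z; lra.
  by move=> *; lra.
pose S := [set Q y | y in [set y : R | 0 <= y]].
have hS : has_sup S.
  split; first by exists (Q 0); exists 0 => //=.
  by exists (P 0) => _ [y y0 <-]; exact: QP.
exists (x (- sup S)); split; [exact: xc|exact: dx|exact: xneg| |].
  by rewrite ltNge (ltW nup).
exists (c / nu); apply: fin => y y0.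
have lo : Q y <= sup S by apply: (ub_le_sup (proj2 hS)); exists y.
have hi : sup S <= P y by apply: ge_sup; [case: hS | move=> _ [z z0 <-]; exact: QP].
move: lo hi; rewrite /x /Q /P max_l // /X => lo hi.
have FE : `|F y - sup S| <= E y by rewrite ler_norml; apply/andP; split; lra.
rewrite normrM gtr0_norm ?expR_gt0 //.
have : expR (nu * y) * `|F y - sup S| <= expR (nu * y) * E y.
  by rewrite ler_wpM2l // expR_ge0.
move=> /le_trans; apply; rewrite /E mulrCA -expRD mulNr subrr expR0 mulr1 //.
Qed.

End LinearODE.

(** * Fixed points depending smoothly on a parameter *)

Section SmoothFixedPoint.
Context {R : realType}.

Lemma contraction_exists (E : completeNormedModType R) (U : set E) (F : E -> E)
    (q : R) : closed U -> U !=set0 -> 0 <= q -> q < 1 ->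
  (forall x, U x -> U (F x)) ->
  (forall x y, U x -> U y -> `|F x - F y| <= q * `|x - y|) ->
  exists2 x, U x & x = F x.
Proof.
move=> cU U0 q0 q1 FU Fq.
have funF : {homo F : x / U x >-> U x} by [].
pose FM := isFun.Build E E U U F FU.
pose f : {fun U >-> U} := HB.pack F FM.
have [] := @banach_fixed_point _ _ U f => //; last by move=> x Ux xF; exists x.
exists (NngNum q0); split => //.
by move=> [x y] [/= Ux Uy]; exact: Fq.
Qed.

Lemma small_lipschitz (V W : normedModType R) (Om : set V) (f : V -> W) (e : R) :
  open Om -> Om 0 -> tsmooth Om f -> (forall y, 'd f 0 y = 0) -> 0 < e ->
  exists2 d : R, 0 < d & forall x, `|x| < d ->
  Om x /\ (forall y, `|'d f x y| <= e * `|y|) /\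
  forall y, `|y| < d -> `|f x - f y| <= e * `|x - y|.
Proof.
move=> oOm Om0 sf df0 e0.
have [d d0 dP] := diff_norm_continuous oOm (sf 2) Om0 e0.
have dP' x : `|x| < d -> Om x /\ forall y, `|'d f x y| <= e * `|y|.
  move=> /dP; rewrite add0r => -[Ox bx]; split=> // y.
  by have := bx y; rewrite df0 subr0.
exists d => // x xd; have [Ox bx] := dP' x xd; split=> //; split=> // y yd.
apply: mean_value_segment => t /andP[t0 t1].
have td : `|y + t *: (x - y)| < d.
  have -> : y + t *: (x - y) = t *: x + (1 - t) *: y.
    by rewrite scalerBr scalerBl scale1r addrCA addrA.
  rewrite (le_lt_trans (ler_normD _ _)) // !normrZ ger0_norm // ger0_norm ?subr_ge0 //.
  pose m := Num.max `|x| `|y|.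
  have md : m < d by rewrite gt_max xd.
  have : t * `|x| + (1 - t) * `|y| <= t * m + (1 - t) * m.
    by rewrite lerD // ler_wpM2l ?subr_ge0 // /m le_max lexx ?orbT.
  by rewrite -mulrDl [t + _]addrC subrK mul1r => /le_lt_trans; apply.
have [Ot bt] := dP' _ td; split; last exact: bt.
exact: (sf 1%N).1.
Qed.

Context (P : normedModType R) (E : completeNormedModType R).
Context (K : P * E -> E) (Psi : E -> E) (OmE : set E) (kappa c : R).
Hypothesis bK : blin K.
Hypothesis kappa0 : 0 < kappa.
Hypothesis c0 : 0 < c.
Hypothesis K_snd : forall g, `|K (0, g)| <= kappa * `|g|.
Hypothesis K_fst : forall s, `|K (s, 0)| <= c * `|s|.
Hypothesis oOmE : open OmE.
Hypothesis Om0 : OmE 0.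
Hypothesis sPsi : tsmooth OmE Psi.
Hypothesis Psi0 : Psi 0 = 0.
Hypothesis dPsi0 : forall y, 'd Psi 0 y = 0.

Lemma K_split s g : K (s, g) = K (s, 0) + K (0, g).
Proof. by rewrite -(blinD _ _ bK); congr K; congr (_, _); rewrite /= ?addr0 ?add0r. Qed.

(** The factor [(2 kappa)^-1] makes [x |-> K (s, Psi x)] a contraction with
    constant 1/2 on a small ball.  Its fixed points are the zeros of
    [Phi (s, x) = x - K (s, Psi x)], and the same contraction constant inverts
    the partial differential [y |-> y - K (0, 'd Psi x y)], so [implicit_tsm]
    applies.  As ['d Psi 0 = 0], the equation for ['d x 0] reduces to
    ['d x 0 h = K (h, 0)]. *)
Lemma smooth_fixed_point : exists (d : R) (x : P -> E),
  [/\ 0 < d,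
      forall s, `|s| < d -> [/\ OmE (x s), x s = K (s, Psi (x s)) &
        `|x s| <= 2 * c * `|s|],
      tsmooth (ball (0 : P) d) x &
      is_diff 0 x (fun h => K (h, 0))].
Proof.
have k20 : 0 < (2 * kappa)^-1 by rewrite invr_gt0 mulr_gt0.
have [d1 d10 dP] := small_lipschitz oOmE Om0 sPsi dPsi0 k20.
pose rho := d1 / 2; have rho0 : 0 < rho by rewrite divr_gt0.
have rhod : rho < d1 by rewrite ltr_pdivrMr // ltr_pMr // ltr1n.
(* This leaves room for [c |s| <= rho / 2] in the ball of radius [rho]. *)
pose d := rho / (2 * c); have d0 : 0 < d by rewrite divr_gt0 // mulr_gt0.
have lipK x y : `|x| < d1 -> `|y| < d1 ->
    `|K (0, Psi x) - K (0, Psi y)| <= 2^-1 * `|x - y|.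
  move=> xd yd; rewrite -(blinB _ _ bK).
  have -> : (0, Psi x) - (0, Psi y) = (0, Psi x - Psi y) :> P * E.
    by congr (_, _); rewrite /= subrr.
  rewrite (le_trans (K_snd _)) //.
  have := (dP x xd).2.2 y yd => H.
  have : kappa * `|Psi x - Psi y| <= kappa * ((2 * kappa)^-1 * `|x - y|).
    by rewrite ler_wpM2l // ltW.
  move/le_trans; apply; rewrite le_eqVlt; apply/orP; left; apply/eqP.
  by field; rewrite gt_eqF.
have norm00 : `|0 : E| < d1 by rewrite normr0.
have ex s : exists x, `|s| < d -> `|x| <= rho /\ x = K (s, Psi x).
  have [sd|] := boolP (`|s| < d); last by exists 0.
  have [x Ux xF] : exists2 x, [set x : E | `|x| <= rho] x & x = K (s, Psi x).
    apply: (contraction_exists (q := 2^-1)) => //.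
    - rewrite (_ : mkset _ = closed_ball_ Num.norm 0 rho); last first.
        by apply/seteqP; split=> x; rewrite /closed_ball_ /= sub0r normrN.
      exact: closed_closed_ball_.
    - by exists 0; rewrite /= normr0 ltW.
    - by rewrite invf_lt1 // ltr1n.
    - move=> x /= xr; rewrite K_split (le_trans (ler_normD _ _)) //.
      have xd := le_lt_trans xr rhod.
      have := lipK x 0 xd norm00; rewrite Psi0 (blin0 bK) !subr0 => H.
      have H2 := K_fst s.
      have : c * `|s| <= rho / 2.
        rewrite mulrC -ler_pdivlMr //; apply: le_trans (ltW sd) _.
        by rewrite le_eqVlt; apply/orP; left; apply/eqP; rewrite /d; field; rewrite gt_eqF.
      by lra.
    - move=> x y /= xr yr; rewrite (K_split s (Psi x)) (K_split s (Psi y)).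
      rewrite opprD addrACA subrr add0r.
      by apply: lipK; apply: le_lt_trans rhod.
  by exists x.
pose x s := projT1 (cid (ex s)).
have xP s : `|s| < d -> `|x s| <= rho /\ x s = K (s, Psi (x s)).
  by rewrite /x; case: cid.
have xd1 s : `|s| < d -> `|x s| < d1 by move=> /xP[xr _]; exact: le_lt_trans rhod.
have lip s t : `|s| < d -> `|t| < d -> `|x s - x t| <= 2 * c * `|s - t|.
  move=> sd td; have [_ xs] := xP s sd; have [_ xt] := xP t td.
  have : `|x s - x t| <= c * `|s - t| + 2^-1 * `|x s - x t|.
    rewrite {1}xs {1}xt (K_split s) (K_split t) opprD addrACA.
    rewrite (le_trans (ler_normD _ _)) // lerD ?lipK ?xd1 //.
    rewrite -(blinB _ _ bK).
    have -> : (s, 0) - (t, 0) = (s - t, 0) :> P * E.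
      by congr (_, _); rewrite /= subr0.
    exact: K_fst.
  by lra.
have d00 : `|0 : P| < d by rewrite normr0.
have x0 : x 0 = 0.
  have [_ xs] := xP 0 d00.
  have := lipK (x 0) 0 (xd1 _ d00) norm00; rewrite Psi0 -xs (blin0 bK) !subr0 => H.
  by apply/eqP; rewrite -normr_le0; have := normr_ge0 (x 0); lra.
have bx s : `|s| < d -> `|x s| <= 2 * c * `|s|.
  by move=> sd; have := lip s 0 sd d00; rewrite x0 !subr0.
have cx s : `|s| < d -> {for s, continuous x}.
  move=> sd; apply: eps_cont => e e0.
  exists (Num.min (d - `|s|) (e / (2 * c))).
    by rewrite lt_min subr_gt0 sd divr_gt0 // mulr_gt0.
  move=> h; rewrite lt_min => /andP[h1 h2].
  have sh : `|s + h| < d by rewrite (le_lt_trans (ler_normD _ _)) // -ltrBrDl.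
  rewrite (le_trans (lip _ _ sh sd)) // [s + h]addrC addrK.
  by rewrite mulrC -ler_pdivlMr ?mulr_gt0 // ltW.
pose Phi (z : P * E) := z.2 - K (z.1, Psi z.2).
pose Om := (@snd P E) @^-1` OmE.
have oOm : open Om.
  by apply: open_comp => // z _; exact: (blin_continuous (blin_snd P E)).
have bsnd := blin_snd P E; have bfst := blin_fst P E.
have sPhi : tsmooth Om Phi.
  move=> k; apply: tsmB => //; first exact: tsm_blin.
  apply: (@tsm_postcomp _ k _ _ _ Om (fun z : P * E => (z.1, Psi z.2)) K) => //.
  apply: tsm_pair => //; first exact: tsm_blin.
  exact: (tsm_precomp oOmE bsnd (sPsi k)).
have dPhi z h y : OmE z.2 -> 'd Phi z (h, y) = y - K (h, 'd Psi (z.2) y).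
  move=> Oz.
  have dP2 : differentiable Psi z.2 by exact: (sPsi 1%N).1.
  have ds := blin_diff z bsnd; have df := blin_diff z bfst.
  have ds' := @ex_diff _ _ _ _ _ _ _ ds; have df' := @ex_diff _ _ _ _ _ _ _ df.
  have dPs : differentiable (Psi \o snd) z by exact: differentiable_comp.
  have dpair : differentiable (fun z : P * E => (z.1, (Psi \o snd) z)) z.
    exact: differentiable_pair.
  have dK := blin_diff (z.1, (Psi \o snd) z) bK.
  have dK' := @ex_diff _ _ _ _ _ _ _ dK.
  have dKp : differentiable (K \o (fun z : P * E => (z.1, (Psi \o snd) z))) z.
    exact: differentiable_comp.
  have := diffB ds' dKp => /(congr1 (fun g => g (h, y))) /= E1.
  rewrite [LHS]E1 (@diff_val _ _ _ _ _ _ _ ds) /=; congr (_ - _).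
  rewrite diff_comp // (@diff_val _ _ _ _ _ _ _ dK) /=; congr K.
  rewrite diff_pair // (@diff_val _ _ _ _ _ _ _ df) /=; congr (_, _).
  by rewrite diff_comp // (@diff_val _ _ _ _ _ _ _ ds).
have hyp s : ball (0 : P) d s -> [/\ Om (s, x s), Phi (s, x s) = 0,
     {for s, continuous x} & invertible_snd Phi (s, x s)].
  rewrite -ball_normE /= sub0r normrN => sd.
  have [Ox [bd _]] := dP _ (xd1 s sd).
  have [_ xs] := xP s sd; split=> //.
  - by rewrite /Phi /= -xs subrr.
  - exact: cx.
  have bdK y : `|K (0, 'd Psi (x s) y)| <= 2^-1 * `|y|.
    rewrite (le_trans (K_snd _)) //.
    have : kappa * `|'d Psi (x s) y| <= kappa * ((2 * kappa)^-1 * `|y|).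
      by rewrite ler_wpM2l // ltW.
    move/le_trans; apply; rewrite le_eqVlt; apply/orP; left; apply/eqP.
    by field; rewrite gt_eqF.
  split.
    move=> g.
    have [y _ yP] : exists2 y, [set: E] y & y = g + K (0, 'd Psi (x s) y).
      apply: (contraction_exists (q := 2^-1)) => //.
      - by exists 0.
      - by rewrite invf_lt1 // ltr1n.
      - move=> y y' _ _; rewrite opprD addrACA subrr add0r -(blinB _ _ bK).
        have -> : (0, 'd Psi (x s) y) - (0, 'd Psi (x s) y') =
            (0, 'd Psi (x s) (y - y')) :> P * E.
          by congr (_, _); rewrite /= ?subrr // linearB.
        exact: bdK.
    by exists y; rewrite dPhi //= {1}yP addrK.
  exists 2 => y; rewrite dPhi //=.
  have := ler_normD (y - K (0, 'd Psi (x s) y)) (K (0, 'd Psi (x s) y)).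
  by rewrite subrK; have := bdK y; lra.
have sx : tsmooth (ball (0 : P) d) x.
  by move=> k; apply: (implicit_tsm k oOm _ sPhi hyp); exact: ball_open.
have B0 : ball (0 : P) d 0 by exact: ballxx.
exists d, x; split => //.
  move=> s sd; have [xr xs] := xP s sd; split=> //; last exact: bx.
  by have [] := dP _ (xd1 s sd).
have d0x : differentiable x 0 by exact: (sx 1%N).1.
apply: DiffDef => //; apply/funext => h.
have [_ _ _ inv0] := hyp 0 B0.
have dPhi0 : differentiable Phi (0, x 0) by apply: (sPhi 1%N).1; rewrite /Om /= x0.
have Px t : ball (0 : P) d t -> Phi (t, x t) = 0 by move=> /hyp[].
have [_ /(_ h)] := implicit_diff (ball_open (0 : P) d) B0 Px (cx 0 d00) dPhi0 inv0.
rewrite dPhi /= x0 // dPsi0 => /eqP; rewrite subr_eq0 => /eqP.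
by [].
Qed.

End SmoothFixedPoint.

(** * Bounded solutions of diagonal linear systems *)

Section VectorODE.
Context {R : realType} (N : nat).
Local Notation E := (bcfun R 'cV[R]_N).

Lemma col_derive (x : R -> 'cV[R]_N) (y : R) (d : 'cV[R]_N) :
  (forall j, is_derive y 1 (fun t => x t j 0) (d j 0)) -> is_derive y 1 x d.
Proof.
move=> dx; apply/is_derive1_diff; apply: eps_diff.
  exact: (bbilin_l _ (bbilin_scale 'cV[R]_N)).
move=> e e0.
have /nbhs_ballP[r /= r0 rP] : \forall h \near (0 : R), forall j,
    `|x (y + h) j 0 - x y j 0 - h * d j 0| <= e * `|h|.
  apply: (@filter_forall R 'I_N (fun (j : 'I_N) (h : R) =>
    `|x (y + h) j 0 - x y j 0 - h * d j 0| <= e * `|h|) (nbhs (0 : R)) _) => j.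
  have /is_derive1_diff D := dx j.
  have [r r0 rP] := diff_eps (@ex_diff _ _ _ _ _ _ _ D) e0.
  apply/nbhs_ballP; exists r => // h; rewrite -ball_normE /= sub0r normrN => hr.
  by have := rP h hr; rewrite (@diff_val _ _ _ _ _ _ _ D).
exists r => // h hr; apply: mx_norm_le; first by rewrite mulr_ge0 // ltW.
move=> i k; rewrite ord1 !mxE; apply: rP.
by rewrite -ball_normE /= sub0r normrN.
Qed.

Lemma col_deriveE (x : R -> 'cV[R]_N) (y : R) (d : 'cV[R]_N) j :
  is_derive y 1 x d -> is_derive y 1 (fun t => x t j 0) (d j 0).
Proof.
move=> /is_derive1_diff D; apply/is_derive1_diff.
have C := blin_diff (x y) (blin_coord (R := R) (m := N) (n := 1) j 0).
have dD := @ex_diff _ _ _ _ _ _ _ D; have dC := @ex_diff _ _ _ _ _ _ _ C.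
apply: DiffDef; first exact: (differentiable_comp dD dC).
have -> := diff_comp dD dC.
rewrite (@diff_val _ _ _ _ _ _ _ D) (@diff_val _ _ _ _ _ _ _ C).
by apply/funext => h /=; rewrite mxE.
Qed.

Lemma col_continuous (T : topologicalType) (x : T -> 'cV[R]_N) :
  (forall j, continuous (fun t => x t j 0)) -> continuous x.
Proof.
move=> xc t; apply/cvgrPdist_le => e e0.
have : \forall u \near t, forall j, `|x t j 0 - x u j 0| <= e.
  apply: (@filter_forall T 'I_N (fun (j : 'I_N) (u : T) =>
    `|x t j 0 - x u j 0| <= e) (nbhs t) _) => j.
  by have /cvgrPdist_le := xc j t; apply.
apply: filterS => u xu; apply: mx_norm_le; first exact: ltW.
by move=> i k; rewrite ord1 !mxE.
Qed.

Context (nu : 'I_N -> R) (m : R).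
Hypothesis m0 : 0 < m.
Hypothesis nu_m : forall j, m <= `|nu j|.

Lemma nu_neq0 j : nu j != 0.
Proof. by rewrite -normr_gt0 (lt_le_trans m0). Qed.

(** Only the components along contracted directions ([nu j < 0]) carry an
    initial condition: in the other directions boundedness selects the
    solution. *)
Definition linsol (s : 'cV[R]_N) (g x : E) := [/\
  forall y : R, y <= 0 -> x y = x 0,
  forall (y : R), 0 < y -> forall j,
    is_derive y 1 (fun t : R => x t j 0) (nu j * x y j 0 + g y j 0) &
  forall j, nu j < 0 -> x 0 j 0 = s j 0].

Lemma bcfun_coord_continuous (x : E) j : continuous (fun t : R => x t j 0).
Proof.
move=> t; apply: (@continuous_comp _ _ _ x (fun A : 'cV[R]_N => A j 0)).
  exact: bcfun_continuous.
exact: coord_continuous.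
Qed.

Lemma bcfun_coord_le (x : E) t j : `|x t j 0| <= `|x|.
Proof. exact: le_trans (coord_norm_le _ _ _) (bcfun_norm_ge _ _). Qed.

Lemma linsol_exists s g : exists x, linsol s g x.
Proof.
have ex j := linear_ode_exists (s j 0) (nu_neq0 j)
  (@bcfun_coord_continuous g j) (fun y => bcfun_coord_le g y j).
pose x j := projT1 (cid (ex j)).
have xP j := projT2 (cid (ex j)).
pose v t : 'cV[R]_N := \col_j x j t.
have vb : v \in @bounded_continuous R R 'cV[R]_N.
  apply/asboolP; split.
    apply: col_continuous => j; rewrite (_ : (fun t => v t j 0) = x j).
      by have [] := xP j.
    by apply/funext => t; rewrite mxE.
  have exM j : exists M : R, forall y, `|x j y| <= M by have [] := xP j.
  pose M j := projT1 (cid (exM j)).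
  have MP j y : `|x j y| <= M j by rewrite /M; case: cid => M' /= ->.
  have M0 j : 0 <= M j by exact: le_trans (MP j 0).
  exists (\sum_j M j) => t; apply: mx_norm_le; first exact: sumr_ge0.
  move=> i k; rewrite mxE (le_trans (MP i t)) //.
  by rewrite (bigD1 i) //= lerDl sumr_ge0.
exists (BCFun vb); split.
- by move=> y y0; apply/colP => j; rewrite !mxE; have [_ _ + _ _] := xP j; apply.
- move=> y y0 j; rewrite (_ : (fun t => _) = x j); last first.
    by apply/funext => t; rewrite mxE.
  by rewrite mxE; have [_ + _ _ _] := xP j; apply.
- by move=> j nj; rewrite mxE; have [_ _ _ + _] := xP j; apply.
Qed.

Lemma linsol_bound s g x : linsol s g x -> `|x| <= Num.max `|s| (`|g| / m).
Proof.
move=> [xneg dx x0].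
have k0 : 0 <= Num.max `|s| (`|g| / m) by rewrite le_max normr_ge0.
have H y : 0 <= y -> `|x y| <= Num.max `|s| (`|g| / m).
  move=> y0; apply: mx_norm_le => // i k; rewrite ord1.
  have := @linear_ode_bound _ (nu i) `|g| `|s| _ _ (nu_neq0 i)
    (@bcfun_coord_continuous x i) (fun y y0 => dx y y0 i).
  move=> /(_ _ _ _ y y0) H.
  rewrite (le_trans (H _ _ _)) //.
  - by move=> t _; exact: bcfun_coord_le.
  - by move=> /x0 ->; exact: coord_norm_le.
  - by move=> _; exists `|x| => t _; exact: bcfun_coord_le.
  - rewrite ge_max !le_max lexx /=; apply/orP; right.
    by rewrite ler_wpM2l // lef_pV2 ?posrE // (lt_le_trans m0).
apply: bcfun_norm_le => // y; have [/H //|/ltW y0] := leP 0 y.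
by rewrite xneg // H.
Qed.

Lemma linsol_lin a s g x s' g' x' : linsol s g x -> linsol s' g' x' ->
  linsol (a *: s + s') (a *: g + g') (a *: x + x').
Proof.
move=> [xneg dx x0] [xneg' dx' x0']; split.
- by move=> y y0; rewrite !bcfunE !bcfunZ xneg // xneg'.
- move=> y y0 j; have D := dx y y0 j; have D' := dx' y y0 j.
  have DD := is_deriveD (is_deriveZ a D) D'.
  rewrite (_ : (fun t => _) =
    (a \*: (fun t : R => x t j 0)) + (fun t : R => x' t j 0)); last first.
    by apply/funext => t; rewrite !fctE !mxE.
  apply: (is_derive_eq DD); rewrite !mxE -![_ *: _]/(_ * _); ring.
- by move=> j nj; rewrite !mxE x0 // x0'.
Qed.

Lemma linsol_uniq s g x x' : linsol s g x -> linsol s g x' -> x = x'.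
Proof.
move=> h h'; have := linsol_lin (-1) h h'; rewrite !scaleN1r !addNr => /linsol_bound.
rewrite !normr0 mul0r maxxx normr_le0 addrC subr_eq0 => /eqP ->.
by [].
Qed.

Definition linsol_op (z : 'cV[R]_N * E) : E := projT1 (cid (linsol_exists z.1 z.2)).

Lemma linsol_opP s g : linsol s g (linsol_op (s, g)).
Proof. by rewrite /linsol_op; case: cid. Qed.

Lemma linsol_op_bound s g : `|linsol_op (s, g)| <= Num.max `|s| (`|g| / m).
Proof. exact: linsol_bound (linsol_opP s g). Qed.

Lemma blin_linsol_op : blin linsol_op.
Proof.
split.
  move=> a [s g] [s' g'].
  exact: linsol_uniq (linsol_opP _ _) (linsol_lin a (linsol_opP s g) (linsol_opP s' g')).
exists (Num.max 1 m^-1) => -[s g]; rewrite (le_trans (linsol_op_bound s g)) //.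
rewrite prod_normE /= ge_max; apply/andP; split.
  rewrite -[leLHS]mul1r; apply: ler_pM => //; by rewrite le_max lexx.
rewrite mulrC; apply: ler_pM => //; first by rewrite invr_ge0 ltW.
  by rewrite le_max lexx orbT.
by rewrite le_max lexx orbT.
Qed.

End VectorODE.

(** * Compactness, and regularity up to the boundary *)

Section Bootstrap.
Context {R : realType}.

Lemma pos_min (I : finType) (F : I -> R) : (forall i, 0 < F i) ->
  exists2 m : R, 0 < m & forall i, m <= F i.
Proof.
move=> F0; pose S := \sum_i (F i)^-1 + 1.
have S0 : 0 < S by rewrite ltr_wpDl // sumr_ge0 // => i _; rewrite invr_ge0 ltW.
exists S^-1; first by rewrite invr_gt0.
move=> i; rewrite -[leRHS]invrK lef_pV2 ?posrE ?invr_gt0 //.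
rewrite /S (bigD1 i) //= -addrA lerDl addr_ge0 // sumr_ge0 // => j _.
by rewrite invr_ge0 ltW.
Qed.

Lemma col_ball_compact N (M : R) : compact [set v : 'cV[R]_N | `|v| <= M].
Proof.
have trle a b (u : 'M[R]_(a, b)) : `|u^T| <= `|u|.
  by apply: mx_norm_le => // i j; rewrite mxE coord_norm_le.
have -> : [set v : 'cV[R]_N | `|v| <= M] =
    trmx @` [set u : 'rV[R]_N | `|u| <= M].
  apply/seteqP; split=> [v /= vM|_ /= [u uM <-]].
    by exists v^T; [exact: le_trans (trle _ _ v) vM | rewrite trmxK].
  exact: le_trans (trle _ _ u) uM.
apply: continuous_compact.
  apply: continuous_subspaceT; apply: blin_continuous; split.
    by move=> a u v; rewrite linearP.
  by exists 1 => u; rewrite mul1r; exact: trle.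
apply: bounded_closed_compact.
  exists M; split; first exact: num_real.
  by move=> x Mx u /= uM; rewrite (le_trans uM) // ltW.
rewrite (_ : mkset _ = closed_ball_ Num.norm 0 M); first exact: closed_closed_ball_.
by apply/seteqP; split=> x; rewrite /closed_ball_ /= sub0r normrN.
Qed.

Lemma pair_ball_compact (V W : normedModType R) (M : R) :
  compact [set v : V | `|v| <= M] -> compact [set w : W | `|w| <= M] ->
  compact [set z : V * W | `|z| <= M].
Proof.
move=> cV cW; rewrite (_ : mkset _ = [set v : V | `|v| <= M] `*` [set w : W | `|w| <= M]).
  exact: compact_setX.
apply/seteqP; split=> -[v w] /=; rewrite prod_normE /= ge_max; first by move/andP.
by move=> [-> ->].
Qed.

Lemma bilin_diff (V W X Y : normedModType R) (b : W -> X -> Y) (f df : V -> W)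
    (g dg : V -> X) x : bbilin b -> is_diff x f df -> is_diff x g dg ->
  is_diff x (fun y => b (f y) (g y)) (fun h => b (f x) (dg h) + b (df h) (g x)).
Proof.
move=> bb [f1 f2] [g1 g2].
have B := bbilin_diff (f x, g x) bb; have B1 := @ex_diff _ _ _ _ _ _ _ B.
have P1 : differentiable (fun y => (f y, g y)) x by exact: differentiable_pair.
apply: DiffDef; first exact: (differentiable_comp P1 B1).
have -> := diff_comp P1 B1.
rewrite (@diff_val _ _ _ _ _ _ _ B) diff_pair //.
by apply/funext => h /=; rewrite -f2 -g2.
Qed.

(** All derivatives of [v] are smooth functions of [v]: if the [k]-th one is
    [phi k (v y)], the next one is ['d (phi k) (v y) (gam (v y))].  Their limits
    at 0 then follow from the continuity of [v]. *)
Lemma ode_smooth_halfline (W : normedModType R) (U : set W) (gam : W -> W)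
    (v : R -> W) : open U -> tsmooth U gam -> continuous v ->
  (forall y : R, 0 <= y -> U (v y)) ->
  (forall y : R, 0 < y -> is_derive y 1 v (gam (v y))) ->
  smooth_halfline v.
Proof.
move=> oU sg vc vU dv; split; first exact: continuous_subspaceT.
have [phi phiP] : exists phi : nat -> W -> W, forall k, tsmooth U (phi k) /\
    forall y : R, 0 < y -> derive1n k v y = phi k (v y).
  pose phi := fix phi k : W -> W := if k is k'.+1 then
     (fun u => 'd (phi k') u (gam u)) else id.
  exists phi; elim=> [|k [sk vk]].
    by split=> // k; apply: tsm_blin => //; exact: blin_id.
  split.
    move=> j; apply: (@tsm_comp _ j _ _ _ U (U `*` [set: W])
      (fun u => (u, gam u)) (fun z => 'd (phi k) (z.1) (z.2))) => //.
    - exact: open_tangent.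
    - apply: tsm_pair => //; apply: tsm_blin => //; exact: blin_id.
    - exact: (sk j.+1).2.
  move=> y y0; rewrite derive1nS derive1E.
  have D := dv y y0; have /is_derive1_diff D' := D.
  have dphi : differentiable (phi k) (v y) by apply: (sk 1%N).1; apply: vU; exact: ltW.
  have dD := @ex_diff _ _ _ _ _ _ _ D'.
  have near_eq : \forall t \near y, (phi k \o v) t = derive1n k v t.
    by near=> t; rewrite /= vk //; near: t; exact: lt_nbhsr.
  rewrite -(near_eq_derive _ near_eq) deriveE; last exact: differentiable_comp.
  rewrite diff_comp //= (@diff_val _ _ _ _ _ _ _ D') scale1r.
  by [].
move=> k; have [sk vk] := phiP k; split.
  move=> y y0; have D := dv y y0; have /is_derive1_diff D' := D.
  have dphi : differentiable (phi k) (v y) by apply: (sk 1%N).1; apply: vU; exact: ltW.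
  apply: (@near_eq_derivable _ _ _ (phi k \o v)).
    by near=> t; rewrite /= vk //; near: t; exact: lt_nbhsr.
  apply/derivable1_diffP; apply: differentiable_comp; last exact: dphi.
  exact: (@ex_diff _ _ _ _ _ _ _ D').
apply/cvg_ex; exists (phi k (v 0)).
have cphi : {for 0, continuous (phi k \o v)}.
  apply: continuous_comp; first exact: vc.
  by apply: (sk 0%N); exact: vU.
have H : (phi k \o v) y @[y --> (0 : R)^'+] --> phi k (v 0).
  exact: cvg_at_right_filter cphi.
apply: cvg_trans H; apply: near_eq_cvg.
by near=> y; rewrite /= vk //; near: y; exact: nbhs_right_gt.
Unshelve. all: by end_near. Qed.

End Bootstrap.

(** * The layer equation in eigenvector coordinates *)

Section LayerCoordinates.
Context {R : realType} (N p : nat) (U : set 'cV[R]_N)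
  (f : 'cV[R]_N -> 'cV[R]_N) (B : 'cV[R]_N -> 'M[R]_N) (mu : 'I_N -> R)
  (uB : 'cV[R]_N) (Q : 'M[R]_N).
Local Notation V2 := ('cV[R]_N * 'cV[R]_N)%type.
Local Notation E := (bcfun R 'cV[R]_N).
Local Notation Lam := (diag_mx (\row_j mu j)).

Hypothesis oU : open U.
Hypothesis sf : tsmooth U f.
Hypothesis sB : tsmooth U B.
Hypothesis uBu : forall u, U u -> B u \in unitmx.
Hypothesis UuB : U uB.
Hypothesis uQ : Q \in unitmx.
Hypothesis dfQ : forall w, 'd f uB (Q *m w) = B uB *m (Q *m (Lam *m w)).

(** The end state of the layer whose coordinate vector starts at [a]. *)
Definition endstate (a : 'cV[R]_N) : 'cV[R]_N := uB - Q *m a.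

(** The layer equation [v' = B(v)^-1 (f v - f vinf)], in the coordinates
    [v = endstate a + Q w], minus its linear part at the origin. *)
Definition nonlin (q : V2) : 'cV[R]_N :=
  invmx Q *m (invmx (B (endstate q.1 + Q *m q.2)) *m
    (f (endstate q.1 + Q *m q.2) - f (endstate q.1))) - Lam *m q.2.

Definition nonlin_dom : set V2 :=
  [set q | U (endstate q.1) /\ U (endstate q.1 + Q *m q.2)].

Lemma blin_mulmx m n k (A : 'M[R]_(m, n)) : blin (fun C : 'M[R]_(n, k) => A *m C).
Proof. exact: bbilin_r (bbilin_mulmx _ _ _). Qed.

Let z1 (q : V2) := endstate q.1.
Let z2 (q : V2) := endstate q.1 + Q *m q.2.
Let dz1 (q : V2) := - (Q *m q.1).
Let dz2 (q : V2) := - (Q *m q.1) + Q *m q.2.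

Lemma blin_dz1 : blin dz1.
Proof. exact: blin_opp (blin_comp (blin_fst _ _) (blin_mulmx _ Q)). Qed.

Lemma blin_dz2 : blin dz2.
Proof.
apply: blin_add; first exact: blin_dz1.
exact: (blin_comp (blin_snd _ _) (blin_mulmx _ Q)).
Qed.

Lemma z1E q : z1 q = uB + dz1 q. Proof. by []. Qed.
Lemma z2E q : z2 q = uB + dz2 q. Proof. by rewrite /z2 /dz2 /endstate addrA. Qed.

Lemma tsm_z1 k (O : set V2) : open O -> tsm k O z1.
Proof.
move=> oO; apply: (@tsmD _ k _ _ O (cst uB) dz1) => //; first exact: tsm_cst.
exact: tsm_blin blin_dz1.
Qed.

Lemma tsm_z2 k (O : set V2) : open O -> tsm k O z2.
Proof.
move=> oO; apply: (@tsm_ext _ k _ _ _ (fun q => uB + dz2 q)) => //.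
  by move=> q _; rewrite z2E.
apply: tsmD => //; first exact: tsm_cst.
exact: tsm_blin blin_dz2.
Qed.

Lemma open_nonlin_dom : open nonlin_dom.
Proof.
have -> : nonlin_dom = z1 @^-1` U `&` z2 @^-1` U by [].
apply: openI; apply: open_comp => // q _.
  exact: (tsm_z1 0 openT).
exact: (tsm_z2 0 openT).
Qed.

Lemma nonlin_smooth : tsmooth nonlin_dom nonlin.
Proof.
move=> k; have oD := open_nonlin_dom.
apply: tsmB => //; last first.
  by apply: tsm_blin => //; exact: (blin_comp (blin_snd _ _) (blin_mulmx _ _)).
apply: (@tsm_postcomp _ k _ _ _ _ (fun q : V2 => invmx (B (z2 q)) *m (f (z2 q) - f (z1 q)))
  (mulmx (invmx Q))) => //; first exact: blin_mulmx.
have fz1 : tsm k nonlin_dom (f \o z1).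
  apply: (tsm_comp oD oU _ _ (sf k)); last exact: tsm_z1.
  by move=> q [].
have fz2 : tsm k nonlin_dom (f \o z2).
  apply: (tsm_comp oD oU _ _ (sf k)); last exact: tsm_z2.
  by move=> q [].
have Bz2 : tsm k.+1 nonlin_dom (B \o z2).
  apply: (tsm_comp oD oU _ _ (sB k.+1)); last exact: tsm_z2.
  by move=> q [].
apply: (tsm_bilin oD (bbilin_mulmx N N 1)).
  by apply: (tsm_invmx oD _ Bz2) => q [_ Uq]; exact: uBu.
exact: tsmB.
Qed.

Lemma nonlin_dom0 : nonlin_dom 0.
Proof. by rewrite /nonlin_dom /endstate /= !mulmx0 subr0 addr0. Qed.

Lemma nonlin0 a : nonlin (a, 0) = 0.
Proof. by rewrite /nonlin /= mulmx0 addr0 subrr !mulmx0 subr0. Qed.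

(** At the origin [f v - f vinf] vanishes, so only its own variation
    contributes, and [dfQ] identifies that contribution with [Lam]. *)
Lemma nonlin_diff0 q : 'd nonlin 0 q = 0.
Proof.
have D0 := nonlin_dom0; have oD := open_nonlin_dom.
have z10 : z1 0 = uB by rewrite z1E (blin0 blin_dz1) addr0.
have z20 : z2 0 = uB by rewrite z2E (blin0 blin_dz2) addr0.
have D1 : is_diff 0 z1 dz1 by apply: (@diff_shift _ _ _ _ _ uB); [exact: blin_dz1|].
have D2 : is_diff 0 z2 dz2.
  by apply: (@diff_shift _ _ _ _ _ uB); [exact: blin_dz2|exact: z2E].
have df1 : is_diff 0 (f \o z1) ('d f uB \o dz1).
  have dfu : differentiable f (z1 0) by rewrite z10; exact: (sf 1%N).1.
  have eD := @ex_diff _ _ _ _ _ _ _ D1.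
  apply: DiffDef; first exact: (differentiable_comp eD dfu).
  by have -> := diff_comp eD dfu; rewrite (@diff_val _ _ _ _ _ _ _ D1) z10.
have df2 : is_diff 0 (f \o z2) ('d f uB \o dz2).
  have dfu : differentiable f (z2 0) by rewrite z20; exact: (sf 1%N).1.
  have eD := @ex_diff _ _ _ _ _ _ _ D2.
  apply: DiffDef; first exact: (differentiable_comp eD dfu).
  by have -> := diff_comp eD dfu; rewrite (@diff_val _ _ _ _ _ _ _ D2) z20.
have dF : is_diff 0 (fun q => (f \o z2) q - (f \o z1) q)
    (fun q => 'd f uB (dz2 q) - 'd f uB (dz1 q)) by apply: is_diffB.
have dG : differentiable (fun q => invmx (B (z2 q))) 0.
  have : tsm 1 nonlin_dom (fun q => invmx (B (z2 q))).
    apply: (tsm_invmx oD); first by move=> y [_ Uy]; exact: uBu.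
    apply: (tsm_comp oD oU _ _ (sB 2)); last exact: tsm_z2.
    by move=> y [].
  by move=> [+ _]; apply.
have dG' := differentiableP dG.
have dH := bilin_diff (bbilin_mulmx N N 1) dG' dF.
have bI := blin_mulmx 1 (invmx Q).
have dI := blin_diff (invmx (B (z2 0)) *m ((f \o z2) 0 - (f \o z1) 0)) bI.
have bL : blin (fun q : V2 => Lam *m q.2).
  exact: (blin_comp (blin_snd _ _) (blin_mulmx _ _)).
have dL := blin_diff (0 : V2) bL.
have dIH := is_diff_comp dH dI.
have dN := is_diffB dIH dL.
rewrite (_ : 'd nonlin 0 q = 'd ((mulmx (invmx Q) \o
  (fun q => invmx (B (z2 q)) *m ((f \o z2) q - (f \o z1) q))) -
  (fun q : V2 => Lam *m q.2)) 0 q) //.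
rewrite (@diff_val _ _ _ _ _ _ _ dN) !fctE /= z10 z20 subrr mulmx0 addr0.
have -> : 'd f uB (dz2 q) - 'd f uB (dz1 q) = 'd f uB (Q *m q.2).
  rewrite -linearB /=; congr ('d f uB _).
  by rewrite /dz2 -/(dz1 q) addrC addKr.
rewrite dfQ.
by rewrite mulKmx ?uBu // mulKmx // subrr.
Qed.

End LayerCoordinates.

(** * The strongly stable family *)

Section StableFamily.
Context {R : realType} (N : nat) (P : normedModType R).
Local Notation V2 := ('cV[R]_N * 'cV[R]_N)%type.
Local Notation E := (bcfun R 'cV[R]_N).
Context (mu : 'I_N -> R) (eta m : R) (h : V2 -> 'cV[R]_N) (Om : set V2)
  (iota : P -> 'cV[R]_N).
Local Notation Lam := (diag_mx (\row_j mu j)).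
Hypothesis eta0 : 0 < eta.
Hypothesis m0 : 0 < m.
Hypothesis nu_m : forall j, m <= `|mu j + eta|.
Hypothesis oOm : open Om.
Hypothesis Om0 : Om 0.
Hypothesis sh : tsmooth Om h.
Hypothesis h0 : forall a, h (a, 0) = 0.
Hypothesis dh0 : forall q, 'd h 0 q = 0.
Hypothesis biota : blin iota.
Hypothesis iota_le : forall s, `|iota s| <= `|s|.
Hypothesis iota0 : forall s j, 0 <= mu j + eta -> iota s j 0 = 0.

Definition weight (t : R) : R := expR (- eta * Num.max t 0).

Lemma weight_continuous : continuous weight.
Proof.
move=> t; suff H : {for t, continuous ((fun s => expR (- eta * s)) \o
   (fun y : R => Num.max y 0))} by exact: H.
by apply: continuous_comp; [exact: continuous_max0 | exact: continuous_expRM].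
Qed.

Lemma weight01 t : 0 < weight t <= 1.
Proof.
rewrite /weight expR_gt0 /= -[leRHS](@expR0 R) ler_expR mulNr oppr_le0.
by rewrite mulr_ge0 ?(ltW eta0) // le_max lexx orbT.
Qed.

Lemma weight0 : weight 0 = 1.
Proof. by rewrite /weight maxxx mulr0 expR0. Qed.

Lemma weight_derive (y : R) : 0 < y -> is_derive y 1 weight (- eta * weight y).
Proof.
move=> y0; have -> : weight y = expR (- eta * y) by rewrite /weight max_l // ltW.
exact: (near_max0 y0 (is_derive_expRM (- eta) y)).
Qed.

Lemma weight_cvg0 : weight t @[t --> +oo] --> 0.
Proof.
apply/cvgrPdist_le => e e0; near=> t.
rewrite sub0r normrN gtr0_norm; last by case/andP: (weight01 t).
have t0 : 0 < t by near: t; exact: nbhs_pinfty_gt.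
rewrite /weight max_l ?(ltW t0) // mulNr expRN.
have te : (eta * e)^-1 <= t by near: t; apply: nbhs_pinfty_ge; exact: num_real.
rewrite -[leRHS]invrK lef_pV2 ?posrE ?expR_gt0 ?invr_gt0 //.
apply: le_trans (expR_ge1Dx _); apply: ler_wpDl => //.
by move: te; rewrite invfM mulrC -ler_pdivlMr ?invr_gt0 // invrK mulrC.
Unshelve. all: by end_near. Qed.

Let prA (q : V2) : V2 := (q.1, 0).
Let prB (q : V2) : V2 := (0, q.2).
Let ev (t : R) (x : E) : V2 := (x 0, x t).

(** The argument of [h] is [(x 0, exp (- eta t) x t)]: its first component, which
    moves the end state, is not weighted, and [h] vanishes when the second one
    does. *)
Lemma superpos_weight (rho : R) : 0 < rho ->
  (forall q : V2, `|q| < rho -> Om q) ->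
  superpos (ball (0 : E) rho) (ball (0 : V2) rho) prA prB ev h.
Proof.
move=> rho0 rhoOm.
have ball0 (V : normedModType R) (v : V) : ball (0 : V) rho v = (`|v| < rho) :> Prop.
  by rewrite -ball_normE /= sub0r normrN.
split.
- exact: ball_open.
- exact: ball_open.
- by apply: (@blin_comp _ _ _ _ fst (fun w : 'cV[R]_N => (w, 0)));
    [exact: blin_fst | exact: blin_inl].
- by apply: (@blin_comp _ _ _ _ snd (fun w : 'cV[R]_N => (0, w)));
    [exact: blin_snd | exact: blin_inr].
- by move=> t; apply: blin_pair; exact: blin_eval.
- exists 1 => // t x; rewrite mul1r prod_normE /= ge_max.
  by rewrite !bcfun_norm_ge.
- move=> x t; suff H : {for t, continuous (fun t : R => (x 0, x t))} by exact: H.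
  apply: (@cvg_pair _ _ _ (nbhs t) (nbhs (x 0)) (nbhs (x t)) _ _ _ (fun _ : R => x 0) x).
    exact: cvg_cst.
  exact: bcfun_continuous.
- by move=> M; apply: pair_ball_compact; exact: col_ball_compact.
- move=> x; rewrite ball0 => xr; exists ((rho - `|x|) / 2).
    by rewrite divr_gt0 // subr_gt0.
  exists [set q : V2 | `|q| <= rho - (rho - `|x|) / 2].
    split; first by apply: pair_ball_compact; exact: col_ball_compact.
    move=> q /= qr; rewrite ball0 (le_lt_trans qr) // gtrBl.
    by rewrite divr_gt0 // subr_gt0.
  move=> y yd t s /andP[s0 s1] /=.
  rewrite prod_normE /= scaler0 addr0 add0r.
  have le v : `|(x + y : E) v| <= rho - (rho - `|x|) / 2.
    rewrite (le_trans (bcfun_norm_ge _ _)) // (le_trans (ler_normD _ _)) //.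
    by lra.
  rewrite ge_max le normrZ ger0_norm //=.
  rewrite -[leRHS]mul1r; apply: ler_pM => //; exact: le.
- move=> k; apply: tsm_sub (sh k) => q; rewrite ball0; exact: rhoOm.
- by move=> v _; exact: h0.
Qed.

(** With [w = exp (- eta y) x] the equation for [x] has the linear part
    [Lam + eta], without zero eigenvalues, and the weighted nonlinearity is a
    superposition operator with zero differential at 0: [smooth_fixed_point]
    applies.  The components of [x 0] other than the prescribed ones vanish to
    first order, since the bounded solution of the homogeneous equation does
    not have them. *)
Theorem strong_stable_family : exists (d : R) (w : P -> R -> 'cV[R]_N),
  [/\ 0 < d, tsmooth (ball (0 : P) d) (fun s => w s 0),
      is_diff 0 (fun s => w s 0) iota &
      forall s, `|s| < d ->
      [/\ continuous (w s), w s t @[t --> +oo] --> (0 : 'cV[R]_N),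
          forall t, `|w s t| <= 2 * `|s| /\ Om (w s 0, w s t),
          forall y : R, 0 < y -> is_derive y 1 (w s) (Lam *m w s y + h (w s 0, w s y)) &
          forall j, mu j + eta < 0 -> w s 0 j 0 = iota s j 0]].
Proof.
have [rho rho0 rhoOm] := open_eps oOm Om0.
have {}rhoOm (q : V2) : `|q| < rho -> Om q by move=> /rhoOm; rewrite add0r.
have ball0 (V : normedModType R) (v : V) : ball (0 : V) rho v = (`|v| < rho) :> Prop.
  by rewrite -ball_normE /= sub0r normrN.
have H := superpos_weight rho0 rhoOm.
have B0 : ball (0 : E) rho 0 by exact: ballxx.
pose Psi := superpos_op weight prA prB ev h.
have PsiE x t : ball (0 : E) rho x ->
    Psi x t = (weight t)^-1 *: h (x 0, weight t *: x t).
  move=> xb; rewrite /Psi (superpos_opE weight_continuous weight01 t H xb) /superpos_fun.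
  by congr (_ *: h _); congr (_, _); rewrite /= ?scaler0 ?addr0 ?add0r.
have sPsi : tsmooth (ball (0 : E) rho) Psi.
  by move=> k; exact: (superpos_tsm weight_continuous weight01 k H).
have Psi0 : Psi 0 = 0.
  apply: bcfunP => t; rewrite PsiE //.
  by rewrite -[(0 : E) 0]/(0 : 'cV[R]_N) -[(0 : E) t]/(0 : 'cV[R]_N) scaler0 h0 scaler0.
have dPsi0 y : 'd Psi 0 y = 0.
  have D := superpos_diff weight_continuous weight01 H B0.
  have -> := @diff_val _ _ _ _ _ _ _ D.
  have HT := superpos_tangent H.
  apply: bcfunP => t; rewrite (superpos_opE weight_continuous weight01 t HT) //.
  rewrite /superpos_fun /=.
  have -> : prA (ev t 0) + weight t *: prB (ev t 0) = 0.
    by congr (_, _); rewrite /= -?[(0 : E) _]/(0 : 'cV[R]_N) ?scaler0 addr0.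
  by rewrite dh0 scaler0.
pose K (z : P * E) : E := linsol_op m0 nu_m (iota z.1, z.2).
have bK : blin K.
  apply: (@blin_comp _ _ _ _ (fun z : P * E => (iota z.1, z.2)) (linsol_op m0 nu_m)).
    by apply: blin_pair; [exact: (blin_comp (blin_fst _ _) biota) | exact: blin_snd].
  exact: blin_linsol_op.
have Ksnd g : `|K (0, g)| <= m^-1 * `|g|.
  rewrite (le_trans (linsol_op_bound _ _ _ _)) //= (blin0 biota) normr0 max_r 1?mulrC //.
  by rewrite mulr_ge0 // invr_ge0 ltW.
have Kfst s : `|K (s, 0)| <= 1 * `|s|.
  rewrite (le_trans (linsol_op_bound _ _ _ _)) //= normr0 mul0r max_l // mul1r.
  exact: iota_le.
have mV0 : 0 < m^-1 by rewrite invr_gt0.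
have [d [x [d0 xP sx dx]]] :=
  smooth_fixed_point bK mV0 ltr01 Ksnd Kfst (ball_open (0 : E) rho) B0 sPsi Psi0 dPsi0.
have evx s : weight 0 *: x s 0 = x s 0 by rewrite weight0 scale1r.
exists d, (fun s t => weight t *: x s t).
have w0E : (fun s : P => weight 0 *: x s 0) = (fun y : E => y 0) \o x.
  by apply/funext => s; rewrite evx.
split => //.
- rewrite w0E => k; apply: tsm_postcomp; [exact: ball_open | exact: blin_eval | exact: sx].
- rewrite w0E.
  have De := blin_diff (x 0) (@blin_eval R R 'cV[R]_N 0).
  (* Only the contracted components of the homogeneous solution survive at 0. *)
  suff E0 : (fun y : E => y 0) \o (fun s => K (s, 0)) = iota.
    by have := is_diff_comp dx De; rewrite E0.
  apply/funext => s /=.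
  have [_ dL L0] := linsol_opP m0 nu_m (iota s) 0.
  apply/colP => j; have [nj|pj] := ltP (mu j + eta) 0; first exact: L0.
  rewrite iota0 //; apply/eqP; rewrite -normr_le0.
  have npj : ~ (mu j + eta < 0) by move=> nj; move: pj; rewrite leNgt nj.
  have := @linear_ode_bound _ (mu j + eta) 0 0 _ _ (nu_neq0 m0 nu_m j)
    (@bcfun_coord_continuous _ _ (linsol_op m0 nu_m (iota s, 0)) j) (fun y y0 => dL y y0 j).
  rewrite mul0r maxxx; apply => //.
  + by move=> t _; rewrite -[(0 : E) t]/(0 : 'cV[R]_N) mxE normr0.
  + by move=> _; exists `|linsol_op m0 nu_m (iota s, 0)| => t _; exact: bcfun_coord_le.
move=> s sd; have [xrho xK xs] := xP s sd.
have xrho' : `|x s| < rho by move: xrho; rewrite ball0.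
have wx t : `|weight t *: x s t| <= `|x s|.
  have /andP[t0 t1] := weight01 t.
  rewrite normrZ gtr0_norm // -[leRHS]mul1r ler_pM // ?(ltW t0) //.
  exact: bcfun_norm_ge.
have [xneg dxs xs0] := linsol_opP m0 nu_m (iota s) (Psi (x s)).
rewrite -[linsol_op _ _ _]/(K (s, Psi (x s))) -xK in xneg dxs xs0.
split.
- move=> t; apply: continuousZ; first exact: weight_continuous.
  exact: bcfun_continuous.
- apply/cvgrPdist_le => e e0.
  have e'0 : 0 < e / (`|x s| + 1) by rewrite divr_gt0 // ltr_wpDl.
  have /cvgrPdist_le /(_ _ e'0) := weight_cvg0.
  apply: filterS => t; rewrite !sub0r !normrN normrZ ler_pdivlMr ?ltr_wpDl //.
  apply: le_trans; rewrite ler_wpM2l // (le_trans (bcfun_norm_ge _ _)) //.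
  by rewrite lerDl.
- move=> t; split; first by rewrite (le_trans (wx t)) // -[2]mulr1.
  apply: rhoOm; rewrite prod_normE /= gt_max.
  by rewrite !(le_lt_trans (wx _)).
- move=> y y0; apply: col_derive => j.
  have D := is_deriveM (weight_derive y0) (dxs y y0 j).
  rewrite (_ : (fun t => _) = weight * (fun t : R => x s t j 0)); last first.
    by apply/funext => t; rewrite mxE.
  apply: (is_derive_eq D); rewrite PsiE // evx mul_diag_mx !mxE.
  have w0 : weight y != 0 by rewrite gt_eqF //; case/andP: (weight01 y).
  rewrite -![_ *: _]/(_ * _) -[x s y j 0 *: _]/(x s y j 0 * _).
  by field.
- by move=> j nj; rewrite evx xs0.
Qed.

End StableFamily.

(** * Uniqueness of small bounded solutions; layers and their coordinates *)

Section Uniqueness.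
Context {R : realType} (N : nat).
Local Notation V2 := ('cV[R]_N * 'cV[R]_N)%type.
Local Notation E := (bcfun R 'cV[R]_N).

(** The difference [D] of two solutions is the bounded solution of
    [D' = Lam D + G] with zero initial data in the contracted directions, and
    [|G| <= (m / 2) |D|] by smallness.  The linear estimate gives
    [|D| <= |D| / 2].  The functions are extended by constants to the negative
    half-line. *)
Lemma bounded_solution_unique (mu : 'I_N -> R) (m : R) (h : V2 -> 'cV[R]_N)
    (Om : set V2) : 0 < m -> (forall j, m <= `|mu j|) ->
  open Om -> Om 0 -> tsmooth Om h -> (forall q, 'd h 0 q = 0) ->
  exists2 d : R, 0 < d & forall w1 w2 : R -> 'cV[R]_N,
    (forall w, w = w1 \/ w = w2 ->
      [/\ continuous (fun t : R => w (Num.max t 0)),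
          forall t : R, 0 <= t -> `|w t| < d &
          forall y : R, 0 < y ->
            is_derive y 1 w (diag_mx (\row_j mu j) *m w y + h (w 0, w y))]) ->
    (forall j, mu j < 0 -> w1 0 j 0 = w2 0 j 0) ->
    forall t : R, 0 <= t -> w1 t = w2 t.
Proof.
move=> m0 mu_m oOm Om0 sh dh0.
have e0 : 0 < m / 2 by rewrite divr_gt0.
have [d d0 dP] := small_lipschitz oOm Om0 sh dh0 e0.
exists d => // w1 w2 wP w0.
have [c1 b1 o1] := wP w1 (or_introl erefl).
have [c2 b2 o2] := wP w2 (or_intror erefl).
have max0 (t : R) : 0 <= Num.max t 0 by rewrite le_max lexx orbT.
have small (w : R -> 'cV[R]_N) (t : R) : (forall t : R, 0 <= t -> `|w t| < d) ->
    `|(w 0, w (Num.max t 0))| < d.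
  by move=> bw; rewrite prod_normE /= gt_max !bw.
pose D (t : R) := w1 (Num.max t 0) - w2 (Num.max t 0).
have Dbc : D \in @bounded_continuous R R 'cV[R]_N.
  apply/asboolP; split.
    by move=> t; apply: (@continuousB _ _ _ _ _ t); [exact: c1 | exact: c2].
  exists (d + d) => t; rewrite (le_trans (ler_normB _ _)) // lerD // ltW //.
    exact: b1.
  exact: b2.
pose G (t : R) := h (w1 0, w1 (Num.max t 0)) - h (w2 0, w2 (Num.max t 0)).
have hc (w : R -> 'cV[R]_N) : continuous (fun t : R => w (Num.max t 0)) ->
    (forall t : R, 0 <= t -> `|w t| < d) ->
    continuous (fun t : R => h (w 0, w (Num.max t 0))).
  move=> cw bw t.
  suff H : {for t, continuous (h \o (fun t : R => (w 0, w (Num.max t 0))))} by exact: H.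
  apply: continuous_comp.
    apply: (@cvg_pair R _ _ (nbhs t) (nbhs (w 0)) (nbhs (w (Num.max t 0))) _ _ _
      (fun _ : R => w 0) (fun t : R => w (Num.max t 0))); first exact: cvg_cst.
    exact: cw.
  by apply: (sh 0%N); exact: (dP _ (small w t bw)).1.
have Gle t : `|G t| <= m / 2 * `|BCFun Dbc|.
  rewrite /G (le_trans ((dP _ (small w1 t b1)).2.2 _ (small w2 t b2))) //.
  rewrite ler_wpM2l ?(ltW e0) // prod_normE /= ge_max; apply/andP; split.
    have := bcfun_norm_ge (BCFun Dbc) 0.
    by rewrite -[(BCFun Dbc) 0]/(D 0) /D maxxx.
  exact: (bcfun_norm_ge (BCFun Dbc) t).
have Gbc : G \in @bounded_continuous R R 'cV[R]_N.
  apply/asboolP; split; last by exists (m / 2 * `|BCFun Dbc|).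
  move=> t; apply: (@continuousB _ _ _ (fun t : R => h (w1 0, w1 (Num.max t 0)))
    (fun t : R => h (w2 0, w2 (Num.max t 0))) t); exact: hc.
have L : linsol mu 0 (BCFun Gbc) (BCFun Dbc).
  split.
  - by move=> y y0; rewrite /= /D maxxx max_r.
  - move=> y y0 j.
    have d1 := near_max0 y0 (col_deriveE j (o1 y y0)).
    have d2 := near_max0 y0 (col_deriveE j (o2 y y0)).
    have D12 := is_deriveB d1 d2.
    rewrite (_ : (fun t => _) = (fun t : R => w1 (Num.max t 0) j 0) -
       (fun t : R => w2 (Num.max t 0) j 0)); last first.
      by apply/funext => t; rewrite /= /D !mxE.
    apply: (is_derive_eq D12).
    rewrite /= /D /G max_l ?(ltW y0) // !mul_diag_mx !mxE.
    by ring.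
  - by move=> j nj; rewrite /= /D maxxx !mxE w0 // subrr.
have := linsol_bound m0 mu_m L; rewrite normr0.
have Gn : `|BCFun Gbc| <= m / 2 * `|BCFun Dbc|.
  by apply: bcfun_norm_le => //; rewrite mulr_ge0 // ltW.
have Gm : `|BCFun Gbc| / m <= `|BCFun Dbc| / 2.
  rewrite ler_pdivrMr // (le_trans Gn) //.
  by rewrite le_eqVlt; apply/orP; left; apply/eqP; ring.
rewrite max_r ?divr_ge0 ?(ltW m0) // => /le_trans /(_ Gm) Dn.
have D0 : `|BCFun Dbc| <= 0.
  have := normr_ge0 (BCFun Dbc); move: Dn; lra.
move=> t t0; apply/eqP; rewrite -subr_eq0 -normr_le0.
have := bcfun_norm_ge (BCFun Dbc) t; rewrite -[(BCFun Dbc) t]/(D t) /D max_l //.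
by move=> /le_trans; apply.
Qed.

End Uniqueness.

Section LayerProfiles.
Context {R : realType} (N : nat) (U : set 'cV[R]_N)
  (f : 'cV[R]_N -> 'cV[R]_N) (B : 'cV[R]_N -> 'M[R]_N) (mu : 'I_N -> R)
  (uB : 'cV[R]_N) (Q : 'M[R]_N).
Local Notation Lam := (diag_mx (\row_j mu j)).
Hypothesis oU : open U.
Hypothesis sf : tsmooth U f.
Hypothesis sB : tsmooth U B.
Hypothesis uBu : forall u, U u -> B u \in unitmx.
Hypothesis uQ : Q \in unitmx.

Lemma endstateK a : endstate uB Q a + Q *m a = uB.
Proof. by rewrite /endstate subrK. Qed.

Lemma layer_of_coordinates (V : set 'cV[R]_N) (w : R -> 'cV[R]_N) :
  continuous w -> w t @[t --> +oo] --> (0 : 'cV[R]_N) ->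
  (forall t : R, 0 <= t -> V (endstate uB Q (w 0) + Q *m w t)) ->
  (forall t : R, 0 <= t -> nonlin_dom U uB Q (w 0, w t)) ->
  (forall y : R, 0 < y ->
     is_derive y 1 w (Lam *m w y + nonlin f B mu uB Q (w 0, w y))) ->
  layer_profile V f B uB (endstate uB Q (w 0))
    (fun t => endstate uB Q (w 0) + Q *m w t).
Proof.
move=> cw w0 Vw dom dw.
set z := endstate uB Q (w 0).
pose gam u := invmx (B u) *m (f u - f z).
have Uv t : 0 <= t -> U (z + Q *m w t) by move=> /dom[].
have dv (y : R) : 0 < y -> is_derive y 1 (fun t => z + Q *m w t) (gam (z + Q *m w y)).
  move=> y0; have /is_derive1_diff D := dw y y0.
  have bQ : blin (fun v : 'cV[R]_N => Q *m v) by exact: blin_mulmx.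
  have D2 := is_diff_comp D (blin_diff (w y) bQ).
  have D3 := is_diffD (is_diff_cst z y) D2.
  apply/is_derive1_diff.
  suff <- : 0 + (fun v : 'cV[R]_N => Q *m v) \o (fun k : R => k *:
     (Lam *m w y + nonlin f B mu uB Q (w 0, w y))) =
     (fun k : R => k *: gam (z + Q *m w y)) by exact: D3.
  apply/funext => k; rewrite !fctE add0r /= -scalemxAr; congr (_ *: _).
  by rewrite mulmxDr /nonlin /= mulmxBr mulKVmx // addrC subrK.
have sgam : tsmooth U gam.
  move=> k; apply: (tsm_bilin oU (bbilin_mulmx N N 1)).
    exact: (tsm_invmx oU uBu (sB k.+1)).
  by apply: tsmB; [exact: oU | exact: sf | exact: tsm_cst].
have cv : continuous (fun t => z + Q *m w t).
  move=> t; apply: (@continuousD _ _ _ (cst z) (fun t => Q *m w t)).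
    exact: cst_continuous.
  suff H : {for t, continuous ((fun v : 'cV[R]_N => Q *m v) \o w)} by exact: H.
  apply: continuous_comp; first exact: cw.
  exact: (blin_continuous (blin_mulmx 1 Q)).
split => //.
- exact: (ode_smooth_halfline oU sgam cv).
- move=> y y0; rewrite derive1E; have [_ ->] := dv y y0.
  by rewrite mulKVmx // uBu //; apply: Uv; exact: ltW.
- exact: endstateK.
- rewrite -[X in _ --> X]addr0 -(mulmx0 1 Q); apply: cvgD; first exact: cvg_cst.
  have cQ : continuous (fun u : 'cV[R]_N => Q *m u).
    exact: (blin_continuous (blin_mulmx 1 Q)).
  exact: (cvg_comp _ _ w0 (cQ 0)).
Qed.

Lemma coordinates_of_layer (V : set 'cV[R]_N) z v :
  V `<=` U -> V z -> layer_profile V f B uB z v ->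
  let w t := invmx Q *m (v t - z) in
  [/\ continuous (fun t : R => w (Num.max t 0)), endstate uB Q (w 0) = z &
      forall y : R, 0 < y ->
        is_derive y 1 w (Lam *m w y + nonlin f B mu uB Q (w 0, w y))].
Proof.
move=> VU Vz [[cv sv] Vv ode v0 _] w.
have w0 : endstate uB Q (w 0) = z.
  by rewrite /endstate /w mulKVmx // v0 opprB addrC subrK.
have bI := blin_mulmx 1 (invmx Q).
split => //.
  move=> t; suff H : {for t, continuous ((fun u : 'cV[R]_N => invmx Q *m u) \o
      (fun t : R => v (Num.max t 0) - z))} by exact: H.
  apply: continuous_comp; last exact: (blin_continuous bI).
  apply: (@continuousB _ _ _ (fun t : R => v (Num.max t 0)) (cst z)); last first.
    exact: cst_continuous.
  have max0 (s : R) : 0 <= Num.max s 0 by rewrite le_max lexx orbT.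
  apply/cvgrPdist_lt => e e0.
  have /subspace_continuousP /(_ (Num.max t 0) (max0 t)) := cv.
  move=> /cvgrPdist_lt /(_ e e0); rewrite near_withinE => H.
  apply: (@filterS _ (nbhs t) _ _ _ _ (@continuous_max0 R t _ H)) => s /=; apply.
  exact: max0.
move=> y y0.
have Uvy : U (v y) by apply/VU/Vv/ltW.
have D : is_derive y 1 v (invmx (B (v y)) *m (f (v y) - f z)).
  have [dv _] := sv 0%N.
  have dvy := dv y y0; apply: DeriveDef; first exact: dvy.
  by rewrite -ode // mulKmx ?uBu // derive1E.
have /is_derive1_diff D1 := D.
have D2 := is_diffB D1 (is_diff_cst z y).
have D3 := is_diff_comp D2 (blin_diff (v y - z) bI).
apply/is_derive1_diff.
suff <- : (fun u : 'cV[R]_N => invmx Q *m u) \o ((fun k : R => k *: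
    (invmx (B (v y)) *m (f (v y) - f z))) - 0) =
    (fun k : R => k *: (Lam *m w y + nonlin f B mu uB Q (w 0, w y))) by exact: D3.
apply/funext => k; rewrite /= subr0 -scalemxAr; congr (_ *: _).
have -> : nonlin f B mu uB Q (w 0, w y) =
   invmx Q *m (invmx (B (v y)) *m (f (v y) - f z)) - Lam *m w y.
  rewrite /nonlin /= w0; have -> : z + Q *m w y = v y.
    by rewrite /w mulKVmx // addrC subrK.
  by [].
by rewrite [RHS]addrC subrK.
Qed.

End LayerProfiles.

(** * The manifold of end states *)

Section PidCoordinates.
Context {R : realType} (N p : nat).
Hypothesis p_le : (p <= N)%N.

Lemma pid_col_proj (a : 'cV[R]_N) (i : 'I_p) :
  ((pid_mx p : 'M[R]_(p, N)) *m a) i 0 = a (widen_ord p_le i) 0.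
Proof.
rewrite mxE (bigD1 (widen_ord p_le i)) //= mxE eqxx ltn_ord mul1r.
rewrite big1 ?addr0 // => k ki; rewrite mxE.
case: eqP => [ik|]; last by rewrite mul0r.
by case/eqP: ki; apply: val_inj => /=.
Qed.

Lemma pid_col_inj_lt (s : 'cV[R]_p) (j : 'I_N) (jp : (j < p)%N) :
  ((pid_mx p : 'M[R]_(N, p)) *m s) j 0 = s (Ordinal jp) 0.
Proof.
rewrite mxE (bigD1 (Ordinal jp)) //= mxE eqxx jp mul1r.
rewrite big1 ?addr0 // => k ki; rewrite mxE.
case: eqP => [ik|]; last by rewrite mul0r.
by case/eqP: ki; apply: val_inj => /=.
Qed.

Lemma pid_col_inj_ge (s : 'cV[R]_p) (j : 'I_N) : (p <= j)%N ->
  ((pid_mx p : 'M[R]_(N, p)) *m s) j 0 = 0.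
Proof.
move=> pj; rewrite mxE big1 // => k _.
by rewrite mxE ltnNge pj andbF mul0r.
Qed.

Lemma pid_col_inj_norm (s : 'cV[R]_p) :
  `|(pid_mx p : 'M[R]_(N, p)) *m s| <= `|s|.
Proof.
apply: mx_norm_le => // j k; rewrite ord1.
have [jp|pj] := ltnP j p; first by rewrite (pid_col_inj_lt _ jp) coord_norm_le.
by rewrite pid_col_inj_ge // normr0.
Qed.

Lemma pid_col_proj_norm (a : 'cV[R]_N) :
  `|(pid_mx p : 'M[R]_(p, N)) *m a| <= `|a|.
Proof.
by apply: mx_norm_le => // j k; rewrite ord1 pid_col_proj coord_norm_le.
Qed.

End PidCoordinates.

Section SpectralData.
Context {R : realType} (N p : nat).
Hypothesis p_le : (p <= N)%N.
Context (lam : 'I_N -> R).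
Hypothesis lam_lt : forall i j : 'I_N, (i < j)%N -> lam i < lam j.
Hypothesis lam_sign : forall j : 'I_N,
  (j.+1 = p -> lam j < 0) /\ (j = p :> nat -> 0 <= lam j).

Lemma lam_le (i j : 'I_N) : (i <= j)%N -> lam i <= lam j.
Proof.
rewrite leq_eqVlt => /orP[/eqP ij|/lam_lt/ltW //].
by have -> : i = j by apply: val_inj.
Qed.

Lemma lam_neg (j : 'I_N) : (j < p)%N -> lam j < 0.
Proof.
case: p p_le lam_sign => // q qN sgn jq.
have := (sgn (Ordinal qN)).1 erefl; apply: le_lt_trans.
by apply: lam_le.
Qed.

Lemma lam_nonneg (j : 'I_N) : (p <= j)%N -> 0 <= lam j.
Proof.
move=> pj; have pN : (p < N)%N by exact: leq_ltn_trans (ltn_ord j).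
have := (lam_sign (Ordinal pN)).2 erefl => /le_trans; apply.
exact: lam_le.
Qed.

Lemma lam_pos (j : 'I_N) : (forall i : 'I_N, i = p :> nat -> 0 < lam i) ->
  (p <= j)%N -> 0 < lam j.
Proof.
move=> pos pj; have pN : (p < N)%N by exact: leq_ltn_trans (ltn_ord j).
have := pos (Ordinal pN) erefl => /lt_le_trans; apply.
exact: lam_le.
Qed.

End SpectralData.

Lemma gradE (R : realType) N (f : 'cV[R]_N -> 'cV[R]_N) u w :
  'd f u w = grad f u *m w.
Proof.
rewrite {1}(col_sum_delta w) linear_sum; apply/colP => i.
rewrite summxE mxE; apply: eq_bigr => j _.
by rewrite linearZ !mxE mulrC.
Qed.

Lemma positive_mx_unit (R : realType) N (A : 'M[R]_N) :
  positive_mx A -> A \in unitmx.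
Proof.
move=> posA; rewrite -row_free_unit -kermx_eq0; apply/negPn/negP => /rowV0Pn[v vk v0].
have vA : v *m A = 0 by apply/sub_kermxP.
have v0' : v^T != 0 by apply: contra v0 => /eqP vT; rewrite -[v]trmxK vT trmx0.
by have := posA v^T v0'; rewrite trmxK vA mul0mx mxE ltxx.
Qed.

Section Family.
Context {R : realType} (N p : nat).
Hypothesis p_le : (p <= N)%N.
Context (U : set 'cV[R]_N) (f : 'cV[R]_N -> 'cV[R]_N) (B : 'cV[R]_N -> 'M[R]_N)
  (mu : 'I_N -> R) (uB : 'cV[R]_N) (Q : 'M[R]_N).
Local Notation Lam := (diag_mx (\row_j mu j)).
Local Notation iota := (fun s : 'cV[R]_p => (pid_mx p : 'M[R]_(N, p)) *m s).
Local Notation proj := (fun a : 'cV[R]_N => (pid_mx p : 'M[R]_(p, N)) *m a).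
Hypothesis oU : open U.
Hypothesis sf : tsmooth U f.
Hypothesis sB : tsmooth U B.
Hypothesis uBu : forall u, U u -> B u \in unitmx.
Hypothesis UuB : U uB.
Hypothesis uQ : Q \in unitmx.
Hypothesis dfQ : forall w, 'd f uB (Q *m w) = B uB *m (Q *m (Lam *m w)).
Hypothesis mu_neg : forall j : 'I_N, (j < p)%N -> mu j < 0.
Hypothesis mu_nonneg : forall j : 'I_N, (p <= j)%N -> 0 <= mu j.

(** The first [p] coordinates of [uB - u] in the eigenvector basis.  Since the
    contracted components of [w s 0] are exactly [s], this affine map inverts
    the chart of the manifold globally. *)
Definition chart_inv (u : 'cV[R]_N) : 'cV[R]_p := proj (invmx Q *m (uB - u)).

Lemma layer_family : exists (d : R) (w : 'cV[R]_p -> R -> 'cV[R]_N),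
  [/\ 0 < d, tsmooth (ball (0 : 'cV[R]_p) d) (fun s => w s 0),
      is_diff (0 : 'cV[R]_p) (fun s => w s 0) iota &
      forall s, `|s| < d ->
      [/\ continuous (w s), w s t @[t --> +oo] --> (0 : 'cV[R]_N),
          forall t, `|w s t| <= 2 * `|s| /\ nonlin_dom U uB Q (w s 0, w s t),
          forall y : R, 0 < y ->
            is_derive y 1 (w s) (Lam *m w s y + nonlin f B mu uB Q (w s 0, w s y)) &
          chart_inv (endstate uB Q (w s 0)) = s]].
Proof.
(* [eta] must move the nonnegative eigenvalues off 0, and no other across it. *)
have [e e0 eP] : exists2 e : R, 0 < e & forall j : 'I_N,
    e <= (if (j < p)%N then - mu j else 1).
  by apply: pos_min => j; case: ltnP => // jp; rewrite oppr_gt0 mu_neg.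
pose eta := e / 2; have eta0 : 0 < eta by rewrite divr_gt0.
have eta_e : eta < e by rewrite ltr_pdivrMr // ltr_pMr // ltr1n.
have nu_neg (j : 'I_N) : (j < p)%N -> mu j + eta < 0.
  by move=> jp; have := eP j; rewrite jp; lra.
have nu_pos (j : 'I_N) : (p <= j)%N -> 0 < mu j + eta.
  by move=> /mu_nonneg; lra.
have [m m0 mP] : exists2 m : R, 0 < m & forall j, m <= `|mu j + eta|.
  apply: pos_min => j; rewrite normr_gt0.
  by have [/nu_neg/lt_eqF->|/nu_pos/gt_eqF->] := ltnP j p.
have biota : blin iota by exact: blin_mulmx.
have iota_le s : `|iota s| <= `|s| by exact: pid_col_inj_norm.
have iota0 s (j : 'I_N) : 0 <= mu j + eta -> iota s j 0 = 0.
  have [/nu_neg|pj _] := ltnP j p; first by rewrite ltNge => /negP.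
  exact: pid_col_inj_ge.
have oD : open (nonlin_dom U uB Q) by exact: open_nonlin_dom.
have D0 : nonlin_dom U uB Q 0 by exact: nonlin_dom0.
have sN : tsmooth (nonlin_dom U uB Q) (nonlin f B mu uB Q) by exact: nonlin_smooth.
have N0 a : nonlin f B mu uB Q (a, 0) = 0 by exact: nonlin0.
have dN0 q : 'd (nonlin f B mu uB Q) 0 q = 0 by exact: (nonlin_diff0 oU).
have [d [w [d0 sw dw wP]]] := strong_stable_family eta0 m0 mP
  oD D0 sN N0 dN0 biota iota_le iota0.
exists d, w; split => // s sd; have [cw w0 wb ode ws] := wP s sd.
split => //; rewrite /chart_inv /endstate subKr mulKmx //.
apply/colP => i; have ip : (widen_ord p_le i < p)%N by exact: ltn_ord i.
rewrite (pid_col_proj p_le) ws; last exact: nu_neg.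
by rewrite (pid_col_inj_lt _ ip); congr (s _ 0); apply: val_inj.
Qed.

Context (d : R) (w : 'cV[R]_p -> R -> 'cV[R]_N).
Hypothesis d0 : 0 < d.
Hypothesis sw : tsmooth (ball (0 : 'cV[R]_p) d) (fun s => w s 0).
Hypothesis dw : is_diff (0 : 'cV[R]_p) (fun s => w s 0) iota.
Hypothesis wP : forall s, `|s| < d ->
      [/\ continuous (w s), w s t @[t --> +oo] --> (0 : 'cV[R]_N),
          forall t, `|w s t| <= 2 * `|s| /\ nonlin_dom U uB Q (w s 0, w s t),
          forall y : R, 0 < y ->
            is_derive y 1 (w s) (Lam *m w s y + nonlin f B mu uB Q (w s 0, w s y)) &
          chart_inv (endstate uB Q (w s 0)) = s].

Definition chart (s : 'cV[R]_p) : 'cV[R]_N := endstate uB Q (w s 0).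
Definition layer_manifold : set 'cV[R]_N := chart @` ball (0 : 'cV[R]_p) d.

Lemma ball_norm0 (s : 'cV[R]_p) : ball (0 : 'cV[R]_p) d s <-> `|s| < d.
Proof. by rewrite -ball_normE /= sub0r normrN. Qed.

Lemma chartK s : `|s| < d -> chart_inv (chart s) = s.
Proof. by move=> /wP[]. Qed.

Lemma w0_0 : w 0 0 = 0.
Proof.
have s0 : `|0 : 'cV[R]_p| < d by rewrite normr0.
have [_ _ wb _ _] := wP s0; have [+ _] := wb 0.
by rewrite normr0 mulr0 normr_le0 => /eqP.
Qed.

Lemma chart0 : chart 0 = uB.
Proof. by rewrite /chart /endstate w0_0 mulmx0 subr0. Qed.

Lemma layer_manifold_uB : layer_manifold uB.
Proof. by exists 0; [exact: ballxx | exact: chart0]. Qed.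

Lemma layer_manifold_layers (V : set 'cV[R]_N) s : `|s| < d ->
  (forall t : R, 0 <= t -> V (chart s + Q *m w s t)) -> V (chart s) ->
  layer_set V f B uB (chart s).
Proof.
move=> sd Vv Vz; have [cw w0 wb ode _] := wP sd; split => //.
exists (fun t => endstate uB Q (w s 0) + Q *m w s t).
by apply: (layer_of_coordinates oU sf sB uBu uQ) => // t _; exact: (wb t).2.
Qed.

Lemma layer_manifold_sub : layer_manifold `<=` layer_set U f B uB.
Proof.
move=> _ [s /ball_norm0 sd <-]; have [_ _ wb _ _] := wP sd.
apply: layer_manifold_layers => // [t _|]; last by have [_ []] := wb 0.
by have [_ []] := wb t.
Qed.

Lemma blin_chart_inv : blin (fun u : 'cV[R]_N => proj (invmx Q *m u)).
Proof. exact: (blin_comp (blin_mulmx 1 (invmx Q)) (blin_mulmx 1 (pid_mx p))). Qed.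

Lemma chart_inv_diff u :
  is_diff u chart_inv (fun h => - (proj (invmx Q *m h))).
Proof.
apply: (@diff_shift _ _ _ _ _ (proj (invmx Q *m uB))).
  exact: blin_opp blin_chart_inv.
by move=> y; rewrite /chart_inv !mulmxBr.
Qed.

Lemma chart_inv_continuous : continuous chart_inv.
Proof.
move=> u; apply: differentiable_continuous.
exact: (@ex_diff _ _ _ _ _ _ _ (chart_inv_diff u)).
Qed.

Lemma chart_inv0 : chart_inv uB = 0.
Proof. by rewrite /chart_inv subrr !mulmx0. Qed.

Lemma chart_smooth : tsmooth (ball (0 : 'cV[R]_p) d) chart.
Proof.
have oO := ball_open (0 : 'cV[R]_p) d.
move=> k; apply: tsmB => //; first exact: tsm_cst.
apply: (@tsm_postcomp _ k _ _ _ _ (fun s => w s 0) (mulmx Q)) => //.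
exact: blin_mulmx.
Qed.

Lemma chart_diff0 : is_diff (0 : 'cV[R]_p) chart (fun h => - (Q *m iota h)).
Proof.
have D := is_diff_comp dw (blin_diff (w 0 0) (blin_mulmx 1 Q)).
have D2 := is_diffB (is_diff_cst uB (0 : 'cV[R]_p)) D.
suff <- : 0 - (fun u : 'cV[R]_N => Q *m u) \o iota =
  (fun h : 'cV[R]_p => - (Q *m iota h)) by exact: D2.
by apply/funext => h; rewrite !fctE sub0r.
Qed.

(** One chart covers the manifold, and it has an affine left inverse; the
    latter forces the differential of the chart to be injective. *)
Lemma layer_submanifold : submanifold p layer_manifold.
Proof.
move=> x Mx; exists setT, (ball (0 : 'cV[R]_p) d), chart, chart_inv.
have oO := ball_open (0 : 'cV[R]_p) d.
split; first by split=> //; exact: openT.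
split.
- exact: (tsmooth_smooth_on oO chart_smooth).
- move=> s Os h k hk.
  have dc : differentiable chart s by exact: (chart_smooth 1).1.
  have di := chart_inv_diff (chart s).
  have di' := @ex_diff _ _ _ _ _ _ _ di.
  have E : \forall t \near s, id t = (chart_inv \o chart) t.
    by apply: filterS (open_nbhs_nbhs (conj oO Os)) => t /ball_norm0 /chartK /= ->.
  have H1 := @diff_val _ _ _ _ _ _ _ (near_eq_is_diff E (is_diff_id s)).
  have H2 := diff_comp dc di'.
  have H3 := @diff_val _ _ _ _ _ _ _ di.
  have key v : v = - (proj (invmx Q *m 'd chart s v)).
    apply: (etrans (esym (congr1 (fun g => g v) H1))).
    apply: (etrans (congr1 (fun g => g v) H2)).
    exact: (congr1 (fun g => g ('d chart s v)) H3).
  by rewrite (key h) (key k) hk.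
- by rewrite setIT.
- by move=> s /ball_norm0; exact: chartK.
- exact: continuous_subspaceT chart_inv_continuous.
Qed.

(** A curve [c] in the manifold satisfies [c = chart \o chart_inv \o c], so its
    velocity lies in the range of ['d chart 0], and the images of lines
    through 0 realize every vector of this range. *)
Lemma layer_tangent_space : tangent_space layer_manifold uB =
  [set v | exists y : 'cV[R]_N, v = Q *m iota (proj y)].
Proof.
apply/seteqP; split=> v.
  move=> [e [c [e0 [sc Mc c0 cv]]]].
  have dc : differentiable c 0 by apply: (sc 1%N).1; rewrite /= normr0.
  have Dc : is_diff (0 : R) c (fun h : R => h *: v).
    apply/is_derive1_diff; apply: DeriveDef; first exact/derivable1_diffP.
    by rewrite -derive1E.
  have di := chart_inv_diff (c 0).
  have D1 := is_diff_comp Dc di.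
  have i0 : (chart_inv \o c) 0 = 0 by rewrite /= c0 chart_inv0.
  have D2 := is_diff_comp D1 _; rewrite i0 in D2.
  have {D2}D := D2 _ _ _ chart_diff0.
  have E : \forall t \near (0 : R), (chart \o (chart_inv \o c)) t = c t.
    apply/nbhs_ballP; exists e => // t; rewrite -ball_normE /= sub0r normrN => te.
    have [s /ball_norm0 sd <-] := Mc t te.
    by rewrite chartK.
  have H1 := @diff_val _ _ _ _ _ _ _ (near_eq_is_diff E D).
  have H2 := @diff_val _ _ _ _ _ _ _ Dc.
  exists (invmx Q *m v).
  have := etrans (esym (congr1 (fun g => g 1) H1)) (congr1 (fun g => g 1) H2).
  by rewrite /= !scale1r !mulmxN opprK => ->.
move=> [y ->]; set s := proj y.
pose e := d / (`|s| + 1).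
have s1 : 0 < `|s| + 1 by rewrite ltr_wpDl.
have e0 : 0 < e by rewrite divr_gt0.
have small t : `|t| < e -> `|(- t) *: s| < d.
  rewrite ltr_pdivlMr // => te; rewrite normrZ normrN (le_lt_trans _ te) //.
  by rewrite ler_wpM2l // lerDl.
have bl : blin (fun t : R => (- t) *: s).
  have b1 := bbilin_l s (bbilin_scale 'cV[R]_p).
  by apply: (@blin_comp _ _ _ _ (fun t : R => - t) (fun t : R => t *: s)) => //;
    exact: blin_opp (blin_id _).
exists e, (fun t => chart ((- t) *: s)); split => //.
have oe : open [set t : R | `|t| < e].
  rewrite (_ : mkset _ = ball (0 : R) e); first exact: ball_open.
  by apply/seteqP; split=> t; rewrite -ball_normE /= sub0r normrN.
split.
- apply: tsmooth_smooth_on => // k.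
  apply: (@tsm_comp _ k _ _ _ _ (ball (0 : 'cV[R]_p) d) (fun t : R => (- t) *: s) chart) => //.
  + exact: ball_open.
  + by move=> t /= te; apply/ball_norm0; exact: small.
  + exact: tsm_blin.
  + exact: chart_smooth.
- by move=> t te; exists ((- t) *: s) => //; apply/ball_norm0; exact: small.
- by rewrite oppr0 scale0r chart0.
- have D1 := blin_diff (0 : R) bl.
  have E0 : (fun t : R => (- t) *: s) 0 = 0 by rewrite /= oppr0 scale0r.
  have D := chart_diff0; rewrite -E0 in D.
  have DD := is_diff_comp D1 D.
  rewrite derive1E deriveE; last exact: (@ex_diff _ _ _ _ _ _ _ DD).
  have -> := @diff_val _ _ _ _ _ _ _ DD.
  by rewrite /= scaleN1r !mulmxN opprK.
Qed.

(** A layer that stays near [uB] gives a small bounded solution of the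
    coordinate equation, to be compared with the member of the family that has
    the same contracted components at 0.  Conversely a member of the family is
    bounded by twice its parameter, so its layer stays in any given
    neighborhood of [uB] when its end state is close to [uB]. *)
Lemma layer_local_uniqueness : (forall j : 'I_N, (p <= j)%N -> 0 < mu j) ->
  exists V0 : set 'cV[R]_N, [/\ nbhs uB V0, V0 `<=` U &
    forall V : set 'cV[R]_N, open V -> V uB -> V `<=` V0 ->
    exists2 W : set 'cV[R]_N, nbhs uB W &
      layer_set V f B uB `&` W = layer_manifold `&` W].
Proof.
move=> mu_pos.
have [m m0 mP] : exists2 m : R, 0 < m & forall j, m <= `|mu j|.
  apply: pos_min => j; rewrite normr_gt0.
  by have [/mu_neg/lt_eqF->|/mu_pos/gt_eqF->] := ltnP j p.
have oD : open (nonlin_dom U uB Q) by exact: open_nonlin_dom.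
have D0 : nonlin_dom U uB Q 0 by exact: nonlin_dom0.
have sN : tsmooth (nonlin_dom U uB Q) (nonlin f B mu uB Q) by exact: nonlin_smooth.
have dN0 q : 'd (nonlin f B mu uB Q) 0 q = 0 by exact: (nonlin_diff0 oU).
have [dh dh0 uniq] := bounded_solution_unique m0 mP oD D0 sN dN0.
have [cI cI0 bI] := blin_bound (blin_mulmx 1 (invmx Q)).
have [cQ cQ0 bQ] := blin_bound (blin_mulmx 1 Q).
have [r1 r10 rU] := open_eps oU UuB.
(* Coordinates of a layer in [ball uB r] are differences of two of its points,
   hence below [2 cI r <= dh]; those of [w1 0] are below [cI r <= d]. *)
pose r := Num.min r1 (Num.min d (dh / 2) / cI).
have r0 : 0 < r by rewrite lt_min r10 divr_gt0 // lt_min d0 divr_gt0.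
have ball_uB (e : R) u : ball uB e u <-> `|u - uB| < e by rewrite -ball_normE /= distrC.
exists (ball uB r); split; first exact: nbhsx_ballx.
  move=> u /ball_uB ur; rewrite -(subrK uB u) addrC; apply: rU.
  by rewrite (lt_le_trans ur) // ge_min lexx.
move=> V oV VuB VV0.
have cIr : cI * r <= Num.min d (dh / 2).
  by rewrite mulrC -ler_pdivlMr // /r ge_min lexx orbT.
have [e e0 eV] := open_eps oV VuB.
exists (chart_inv @^-1` ball (0 : 'cV[R]_p) (e / (4 * cQ))).
  apply: chart_inv_continuous; rewrite chart_inv0; apply: nbhsx_ballx.
  by rewrite divr_gt0 // mulr_gt0.
apply/seteqP; split=> z [Mz Wz]; (split; last exact: Wz); last first.
  have [s /ball_norm0 sd zE] := Mz.
  move: Wz; rewrite -zE /= chartK // -ball_normE /= sub0r normrN => se.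
  have [_ _ wb _ _] := wP sd.
  have bound t : `|Q *m w s t| <= cQ * (2 * `|s|).
    by rewrite (le_trans (bQ _)) // ler_wpM2l ?(ltW cQ0) //; have [] := wb t.
  have se' : cQ * (4 * `|s|) < e.
    by move: se; rewrite ltr_pdivlMr ?mulr_gt0 //; apply: le_lt_trans;
      rewrite le_eqVlt; apply/orP; left; apply/eqP; ring.
  have b0 := bound 0; have s0 := normr_ge0 s.
  have cs0 : 0 <= cQ * `|s| by rewrite mulr_ge0 // ltW.
  apply: layer_manifold_layers => // [t _|]; rewrite /chart /endstate.
    rewrite -addrA; apply: eV.
    rewrite (le_lt_trans (ler_normD _ _)) // normrN.
    by have := bound t; lra.
  by apply: eV; rewrite normrN; lra.
have [Vz [v lv]] := Mz.
have VU : V `<=` U.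
  move=> u /VV0 /ball_uB ur; rewrite -(subrK uB u) addrC; apply: rU.
  by rewrite (lt_le_trans ur) // ge_min lexx.
have [cw1 w10 ode1] := @coordinates_of_layer _ _ _ f B mu _ _ uBu uQ _ _ _ VU Vz lv.
set w1 := (fun t => invmx Q *m (v t - z)) in cw1 w10 ode1.
have [_ Vv _ v0 _] := lv.
have nb u : V u -> `|u - uB| < r by move=> /VV0 /ball_uB.
have w1b (t : R) : 0 <= t -> `|w1 t| < dh.
  move=> t0; have n1 := nb _ (Vv t t0); have n2 := nb _ Vz.
  have : `|v t - z| < r + r.
    have -> : v t - z = (v t - uB) - (z - uB) by rewrite opprB addrA subrK.
    by rewrite (le_lt_trans (ler_normB _ _)) // ltrD.
  move=> n3; rewrite (le_lt_trans (bI _)) //.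
  have : cI * `|v t - z| < cI * (r + r) by rewrite ltr_pM2l.
  move=> /lt_le_trans; apply; rewrite mulrDr.
  by move: cIr; rewrite le_min => /andP[_]; lra.
set a := w1 0.
have ad : `|a| < Num.min d (dh / 2).
  rewrite (lt_le_trans _ cIr) // (le_lt_trans (bI _)) // ltr_pM2l //.
  by rewrite v0 distrC; exact: nb.
set s := proj a.
have sd' : `|s| < Num.min d (dh / 2) by rewrite (le_lt_trans (pid_col_proj_norm p_le _)).
move: sd'; rewrite lt_min => /andP[sd sdh].
have [cw w0 wb ode ws] := wP sd.
exists s; first exact/ball_norm0.
suff E : w1 0 = w s 0 by rewrite /chart -E.
apply: (uniq w1 (w s)) => //.
  move=> _ [->|->]; first by split; [exact: cw1 | exact: w1b | exact: ode1].
  split; last exact: ode.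
    move=> t; suff H : {for t, continuous ((w s) \o (fun t : R => Num.max t 0))} by exact: H.
    by apply: continuous_comp; [exact: continuous_max0 | exact: cw].
  by move=> t _; have [wt _] := wb t; rewrite (le_lt_trans wt) // mulrC -ltr_pdivlMr.
move=> j nj; have [jp|/mu_nonneg] := ltnP j p; last by rewrite leNgt nj.
have := congr1 (fun u : 'cV[R]_p => u (Ordinal jp) 0) ws.
rewrite /chart_inv /endstate subKr mulKmx // /s !(pid_col_proj p_le) -/a.
by rewrite (_ : widen_ord p_le (Ordinal jp) = j) //; apply: val_inj.
Qed.

End Family.

(** * Layers of the viscous system *)

Theorem theorem3p4 (R : realType) (N : nat) (U : set 'cV[R]_N)
    (f : 'cV[R]_N -> 'cV[R]_N) (B : 'cV[R]_N -> 'M[R]_N)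
    (lam : 'I_N -> 'cV[R]_N -> R)
    (l : 'I_N -> 'cV[R]_N -> 'rV[R]_N)
    (r : 'I_N -> 'cV[R]_N -> 'cV[R]_N)
    (b : 'I_N -> 'cV[R]_N -> R)
    (p : nat) (uB : 'cV[R]_N)
    (U_open : open U) (U_convex : convex_set U)
    (f_smooth : smooth_on U f)
    (f_hyp : strictly_hyperbolic U f lam l r)
    (B_smooth : smooth_on U B)
    (B_pos : forall u, U u -> positive_mx (B u))
    (UuB : U uB)
    (p_le : (p <= N)%N)
    (B_eigen : \forall u \near uB, forall j : 'I_N,
       B u *m r j u = b j u *: r j u /\ 0 < b j u)
    (* 0-based indices: lambda_p, lambda_{p+1} are lam (p-1), lam p; each
       inequality is dropped when its index is out of range *)
    (lam_sign : \forall u \near uB, forall j : 'I_N,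
       (j.+1 = p -> lam j u < 0) /\ (j = p :> nat -> 0 <= lam j u)) :
  [/\ layer_set U f B uB uB,
      exists (q : nat) (M : set 'cV[R]_N),
        [/\ (p <= q)%N, submanifold q M, M uB & M `<=` layer_set U f B uB] &
      (forall j : 'I_N, j = p :> nat -> 0 < lam j uB) ->
      exists M : set 'cV[R]_N,
        [/\ submanifold p M,
            M uB,
            M `<=` layer_set U f B uB,
            (* near uB, M is the set of layers whose profile stays near uB *)
            exists V0 : set 'cV[R]_N,
              [/\ nbhs uB V0, V0 `<=` U &
                forall V : set 'cV[R]_N, open V -> V uB -> V `<=` V0 ->
                exists2 W : set 'cV[R]_N, nbhs uB W &
                  layer_set V f B uB `&` W = M `&` W] &
            tangent_space M uB =
              [set w | exists c : 'I_N -> R,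
                 w = \sum_(j < N | (j < p)%N) c j *: r j uB]]].

Proof.
have sf := smooth_on_tsmooth U_open f_smooth.
have sB := smooth_on_tsmooth U_open B_smooth.
have uBu u : U u -> B u \in unitmx by move=> /B_pos; exact: positive_mx_unit.
have [lam_lt _ fr _ uQ] := f_hyp uB UuB.
have Beig := nbhs_singleton B_eigen.
have sgn := nbhs_singleton lam_sign.
pose Q : 'M[R]_N := \matrix_(i, j) r j uB i 0.
pose mu (j : 'I_N) := lam j uB / b j uB.
have b0 j : 0 < b j uB by exact: (Beig j).2.
have colQ j : col j Q = r j uB by apply/colP => i; rewrite !mxE.
have Qsum (c : 'cV[R]_N) : Q *m c = \sum_j c j 0 *: r j uB.
  apply/colP => i; rewrite mxE summxE; apply: eq_bigr => j _.
  by rewrite !mxE mulrC.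
have dfQ v : 'd f uB (Q *m v) = B uB *m (Q *m (diag_mx (\row_j mu j) *m v)).
  rewrite gradE !Qsum !mulmx_sumr; apply: eq_bigr => j _.
  rewrite -!scalemxAr fr (Beig j).1 !scalerA mul_diag_mx !mxE; congr (_ *: _).
  by rewrite /mu; field; rewrite gt_eqF.
have mu_neg (j : 'I_N) : (j < p)%N -> mu j < 0.
  by move=> jp; rewrite /mu pmulr_llt0 ?invr_gt0 //; exact: (lam_neg p_le lam_lt sgn jp).
have mu_nonneg (j : 'I_N) : (p <= j)%N -> 0 <= mu j.
  by move=> pj; rewrite /mu divr_ge0 ?(ltW (b0 j)) //; exact: (lam_nonneg lam_lt sgn pj).
have [d [w [d0 sw dw wP]]] :=
  layer_family p_le U_open sf sB uBu UuB uQ dfQ mu_neg mu_nonneg.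
have MuB := layer_manifold_uB d0 wP.
have Msub := layer_manifold_sub U_open sf sB uBu uQ wP.
have Msm := layer_submanifold sw wP.
split; first exact: Msub.
  by exists p, (layer_manifold uB Q d w).
move=> lam_p0; exists (layer_manifold uB Q d w); split=> //.
  apply: (layer_local_uniqueness p_le U_open sf sB uBu UuB uQ dfQ mu_neg mu_nonneg d0 wP).
  by move=> j pj; rewrite /mu divr_gt0 //; exact: (lam_pos lam_lt lam_p0 pj).
rewrite (layer_tangent_space d0 sw dw wP); apply/seteqP; split=> v.
  move=> [y ->]; exists (fun j => y j 0); rewrite Qsum (big_mkcond (fun j : 'I_N => (j < p)%N)).
  apply: eq_bigr => j _; case: ifPn => [jp|]; last first.
    by rewrite -leqNgt => /pid_col_inj_ge ->; rewrite scale0r.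
  rewrite (pid_col_inj_lt _ jp) (pid_col_proj p_le); congr (y _ 0 *: _).
  exact: val_inj.
move=> [c ->]; exists (\col_j c j); rewrite Qsum (big_mkcond (fun j : 'I_N => (j < p)%N)).
apply: eq_bigr => j _; case: ifPn => [jp|]; last first.
  by rewrite -leqNgt => /pid_col_inj_ge ->; rewrite scale0r.
rewrite (pid_col_inj_lt _ jp) (pid_col_proj p_le) mxE; congr (c _ *: _).
exact: val_inj.
Qed.
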